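(* Assume that there exists an invariant relation $\perp$ on small subsets of $\mathbb M$ satisfying left and right monotonicity, right base monotonicity, local character, extension, and the independence theorem over models. Then: (i) $\perp\to\perp^{f}$, i.e. $A\perp_C B$ implies $A\perp^{f}_C B$ for all small $A,B,C$; (ii) $T$ is simple; (iii) $\perp^{f}=\perp^{d}$; (iv) $\perp^{f}$ is symmetric. Assume further that $\perp$ satisfies finite character, left normality and left transitivity. Then $\perp=\perp^{f}=\perp^{d}$ and $\perp$ is symmetric.
   Context: Setting. $T$ is a complete first-order theory with only infinite models in an at most countable language $L$. $\mathbb M$ is a monster model of $T$: for a fixed big enough cardinal $\bar\kappa$ (e.g. strongly inaccessible), $\mathbb M$ is $\bar\kappa^+$-universal, $\bar\kappa$-saturated and strongly $\bar\kappa$-homogeneous. ''Small'' means of cardinality $<\bar\kappa$; all sets and (possibly infinite) tuples of $\mathbb M$ considered are small; a small model is a small elementary substructure of $\mathbb M$. Juxtaposition denotes union. $A\equiv_C B$ for sets means $\sigma(A)=B$ for some $\sigma\in \mathrm{Aut}(\mathbb M/C)$; for tuples it means equality of types over $C$. A ternary relation $\perp$ is invariant if $A\perp_C B\iff \sigma(A)\perp_{\sigma(C)}\sigma(B)$ for all $\sigma\in\mathrm{Aut}(\mathbb M)$; it is symmetric if $A\perp_C B\Rightarrow B\perp_C A$. Axioms. - Right monotonicity: $A\perp_C BD\Rightarrow A\perp_C B$. Left monotonicity: $AD\perp_C B\Rightarrow A\perp_C B$. - Right base monotonicity: if $C\subseteq B\subseteq D$ and $A\perp_C D$ then $A\perp_B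 D$. - Local character: for all $A$ there is a (small) cardinal $\kappa=\kappa(A)$ such that for all $B$ there is $B_0\subseteq B$ with $|B_0|<\kappa$ and $A\perp_{B_0}B$. - Extension: if $A\perp_C B$ then for any $D\supseteq B$ there is $A'\equiv_{BC}A$ with $A'\perp_C D$. - The independence theorem over models: for every small model $M$, if $A\perp_M B$, $C_1\perp_M A$, $C_2\perp_M B$ and $C_1\equiv_M C_2$, then there is $C$ with $C\perp_M AB$, $C\equiv_{MA}C_1$ and $C\equiv_{MB}C_2$ (here the $C$'s may be taken as enumerated tuples). - Finite character: if $a\perp_C B$ for all finite $a\subseteq A$ then $A\perp_C B$. - Left normality: $A\perp_C B\Rightarrow AC\perp_C B$. - Left transitivity: if $C\subseteq B\subseteq D$, $B\perp_C A$ and $D\perp_B A$ then $D\perp_C A$. Dividing and forking. A formula $\phi(x,b)$ divides over $C$ if for some $k$ there is a sequence $(b_i)_{i<\omega}$ of realisations of $\mathrm{tp}(b/C)$ such that $\{\phi(x,b_i):i<\omega\}$ is $k$-inconsistent (any $k$ of them are jointly inconsistent). A formula forks over $C$ if it implies a finite disjunction of formulas each of which divides over $C$. A partial type divides (forks) over $C$ if it implies a formula that divides (forks) over $C$. $A\perp^{d}_C B$ (resp. $A\perp^{f}_C B$) means that $\mathrm{tp}(A/BC)$ does not divide (resp. does not fork) over $C$. Simplicity. For $k\ge 2$, a formula $\phi(x,y)$ has the $k$-tree property if there is $(b_s)_{s\in\omega^{<\omega}}$ such that $\{\phi(x,b_s): s\text{ is a finite initial segment of }\nu\}$ is consistent for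 each $\nu\in\omega^\omega$, and $\{\phi(x,b_{s^\frown i}): i<\omega\}$ is $k$-inconsistent for all $s\in\omega^{<\omega}$. $T$ is simple if no formula has the $k$-tree property for any $k$. *)

(* Defs.v *)
From mathcomp Require Import all_boot.
From mathcomp Require Import boolp classical_sets functions cardinality.

Set Implicit Arguments.
Unset Strict Implicit.
Unset Printing Implicit Defensive.

Local Open Scope classical_set_scope.
Local Open Scope card_scope.

(* A cardinal is represented by a type [K] (its cardinality), and the cardinals
   below |K| by the small subsets of [K]. *)

Definition card_lt T U (A : set T) (B : set U) : Prop :=
  A #<= B /\ ~ (B #<= A).

Definition small (K : Type) T (A : set T) : Prop := card_lt A [set: K].

(* Regularity is stated as: a union of fewer than |K| sets of size < |K| has
   size < |K|. *)
Definition strongly_inaccessible (K : Type) : Prop :=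
  [/\ ~ countable [set: K],
      forall (I : set K) (F : K -> set K), small K I ->
        (forall i, I i -> small K (F i)) -> small K (\bigcup_(i in I) F i) &
      forall A : set K, small K A -> small K [set X : set K | X `<=` A]].

Record language := Language {
  fun_symb : Type;
  fun_arity : fun_symb -> nat;
  rel_symb : Type;
  rel_arity : rel_symb -> nat }.

Definition countable_language (L : language) : Prop :=
  countable [set: fun_symb L] /\ countable [set: rel_symb L].

Inductive term (L : language) (X : Type) : Type :=
| Var (x : X)
| App (f : fun_symb L) (ts : 'I_(fun_arity f) -> term L X).

(* [formula L X]: first-order formulas with free variables in [X], where [X]
   may be infinite. The variable bound by [All] is [None]. *)
Inductive formula (L : language) (X : Type) : Type :=
| Bot
| Equal (t1 t2 : term L X)
| Rel (r : rel_symb L) (ts : 'I_(rel_arity r) -> term L X)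
| Imp (p q : formula L X)
| All (p : formula L (option X)).

Arguments Bot {L X}.

Record structure (L : language) := Structure {
  carrier :> Type;
  fun_int : forall f : fun_symb L, ('I_(fun_arity f) -> carrier) -> carrier;
  rel_int : forall r : rel_symb L, ('I_(rel_arity r) -> carrier) -> Prop }.

Fixpoint eval L (M : structure L) X (e : X -> M) (t : term L X) : M :=
  match t with
  | Var x => e x
  | App f ts => fun_int (fun i => eval e (ts i))
  end.

Definition extend X (U : Type) (e : X -> U) (u : U) (o : option X) : U :=
  if o is Some x then e x else u.

Fixpoint sat L (M : structure L) X (e : X -> M) (p : formula L X) : Prop :=
  match p with
  | Bot => False
  | Equal t1 t2 => eval e t1 = eval e t2
  | Rel r ts => rel_int (fun i => eval e (ts i))
  | Imp p q => sat e p -> sat e q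
  | All p => forall u : M, sat (extend e u) p
  end.

Definition sentence L := formula L void.

Definition holds L (M : structure L) (p : sentence L) : Prop :=
  sat (of_void M) p.

Definition models L (M : structure L) (T : set (sentence L)) : Prop :=
  forall p, T p -> holds M p.

Definition complete_theory L (T : set (sentence L)) : Prop :=
  (exists M : structure L, models M T) /\
  forall p, (forall M : structure L, models M T -> holds M p) \/
            (forall M : structure L, models M T -> ~ holds M p).

Definition only_infinite_models L (T : set (sentence L)) : Prop :=
  forall M : structure L, models M T -> infinite_set [set: M].

Definition elementary_embedding L (N M : structure L) (j : N -> M) : Prop :=
  forall X (p : formula L X) (e : X -> N),
    sat e p <-> sat (fun x => j (e x)) p.

Definition fun_closed L (M : structure L) (N : set M) : Prop :=
  forall (f : fun_symb L) (ts : 'I_(fun_arity f) -> M),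
    (forall i, N (ts i)) -> N (fun_int ts).

Definition substructure L (M : structure L) (N : set M) (hN : fun_closed N) :
    structure L :=
  @Structure L N
    (fun f ts => exist _ (fun_int (fun i => set_val (ts i)))
       (mem_set (hN f (fun i => set_val (ts i)) (fun i => set_valP (ts i)))))
    (fun r ts => rel_int (fun i => set_val (ts i))).

Definition elementary_substructure L (M : structure L) (N : set M) : Prop :=
  exists hN : fun_closed N,
    @elementary_embedding L (substructure hN) M (fun x : N => set_val x).

Definition automorphism L (M : structure L) (s : M -> M) : Prop :=
  [/\ bijective s,
      forall (f : fun_symb L) (ts : 'I_(fun_arity f) -> M),
        s (fun_int ts) = fun_int (fun i => s (ts i)) &
      forall (r : rel_symb L) (ts : 'I_(rel_arity r) -> M),
        rel_int ts <-> rel_int (fun i => s (ts i))].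

Definition automorphism_over L (M : structure L) (C : set M) (s : M -> M) :=
  automorphism s /\ forall c, C c -> s c = c.

(* [PFormula phi b] is phi(x, b), with [x] a tuple of variables indexed by [V]
   (only finitely many of them occur) and [b] a finite tuple. *)
Record pformula L (M : structure L) (V : Type) := PFormula {
  pf_arity : nat;
  pf_formula : formula L (V + 'I_pf_arity);
  pf_param : 'I_pf_arity -> M }.

Arguments PFormula {L M V pf_arity}.

Definition join_assign (V W U : Type) (a : V -> U) (b : W -> U) (v : V + W) :=
  match v with inl x => a x | inr y => b y end.

Definition psat L (M : structure L) V (a : V -> M) (p : pformula M V) : Prop :=
  sat (join_assign a (@pf_param _ _ _ p)) (pf_formula p).

Definition realises L (M : structure L) V (a : V -> M)
    (p : set (pformula M V)) : Prop :=
  forall phi, p phi -> psat a phi.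

Definition over L (M : structure L) V (C : set M) (phi : pformula M V) : Prop :=
  forall i, C (@pf_param _ _ _ phi i).

Definition tp L (M : structure L) V (a : V -> M) (C : set M) :
    set (pformula M V) :=
  [set phi | over C phi /\ psat a phi].

Definition tuple_equiv L (M : structure L) V (C : set M) (a b : V -> M) :=
  tp a C = tp b C.

Definition set_equiv L (M : structure L) (C A B : set M) : Prop :=
  exists s : M -> M, automorphism_over C s /\ s @` A = B.

Definition saturated L (K : Type) (M : structure L) : Prop :=
  forall (C : set M) (p : set (pformula M unit)), small K C ->
    p `<=` [set phi | over C phi] ->
    (forall q, q `<=` p -> finite_set q -> exists a, realises a q) ->
    exists a, realises a p.

(* |K|^+-universality *)
Definition universal L (K : Type) (T : set (sentence L)) (M : structure L) :=
  forall N : structure L, models N T -> [set: N] #<= [set: K] ->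
    exists j : N -> M, elementary_embedding j.

Definition strongly_homogeneous L (K : Type) (M : structure L) : Prop :=
  forall (A : set M) (f : A -> M), small K A ->
    tp (fun x : A => set_val x) set0 = tp f set0 ->
    exists2 s : M -> M, automorphism s & forall x : A, s (set_val x) = f x.

Definition monster L (K : Type) (T : set (sentence L)) (M : structure L) :=
  [/\ models M T, universal K T M, saturated K M & strongly_homogeneous K M].

(* Following the usual monster model convention, implications between formulas
   or partial types and consistency are evaluated in the monster model [M]. *)

(* Indexed, rather than as a set of formulas: in a constant sequence, equal
   formulas at distinct indices count as distinct. *)
Definition k_inconsistent L (M : structure L) V (k : nat)
    (chi : nat -> pformula M V) : Prop :=
  forall s : 'I_k -> nat, injective s ->
    ~ exists a : V -> M, forall i, psat a (chi (s i)).

Definition implies L (M : structure L) V (p : set (pformula M V))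
    (phi : pformula M V) : Prop :=
  forall a : V -> M, realises a p -> psat a phi.

Definition divides L (M : structure L) V (C : set M) (phi : pformula M V) :=
  exists (k : nat) (b : nat -> 'I_(pf_arity phi) -> M),
    (forall i, realises (b i) (tp (@pf_param _ _ _ phi) C)) /\
    k_inconsistent k (fun i => PFormula (pf_formula phi) (b i)).

Definition forks L (M : structure L) V (C : set M) (phi : pformula M V) :=
  exists (m : nat) (chi : 'I_m -> pformula M V),
    (forall i, divides C (chi i)) /\
    forall a : V -> M, psat a phi -> exists i, psat a (chi i).

Definition type_divides L (M : structure L) V (C : set M)
    (p : set (pformula M V)) : Prop :=
  exists phi, implies p phi /\ divides C phi.

Definition type_forks L (M : structure L) V (C : set M)
    (p : set (pformula M V)) : Prop :=
  exists phi, implies p phi /\ forks C phi.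

(* Ternary relations are written in the order [perp A C B]: A is independent
   from B over C. A set [A] is enumerated by itself when taking its type. *)
Definition nondividing L (M : structure L) (A C B : set M) : Prop :=
  ~ type_divides C (tp (fun x : A => set_val x) (B `|` C)).

Definition nonforking L (M : structure L) (A C B : set M) : Prop :=
  ~ type_forks C (tp (fun x : A => set_val x) (B `|` C)).

Definition tree_property L (M : structure L) m n
    (phi : formula L ('I_m + 'I_n)) (k : nat) : Prop :=
  exists b : seq nat -> 'I_n -> M,
    (forall nu : nat -> nat, exists a : 'I_m -> M,
       forall l : nat, psat a (PFormula phi (b (mkseq nu l)))) /\
    (forall s : seq nat,
       k_inconsistent k (fun i => PFormula phi (b (rcons s i)))).

Definition simple L (M : structure L) : Prop :=
  forall m n (phi : formula L ('I_m + 'I_n)) (k : nat), 2 <= k ->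
    ~ tree_property M phi k.

(* A relation on small sets is the restriction to small sets of some
   [perp : set M -> set M -> set M -> Prop]; values elsewhere are irrelevant. *)

Section TernaryRelations.
Variables (L : language) (K : Type) (M : structure L).
Variable perp : set M -> set M -> set M -> Prop.
Implicit Types A B C D N : set M.

Definition invariant_rel : Prop :=
  forall (s : M -> M) A C B, automorphism s ->
    small K A -> small K C -> small K B ->
    (perp A C B <-> perp (s @` A) (s @` C) (s @` B)).

Definition symmetric_rel : Prop :=
  forall A C B, small K A -> small K C -> small K B ->
    perp A C B -> perp B C A.

Definition right_monotonicity : Prop :=
  forall A C B D, small K A -> small K C -> small K B -> small K D ->
    perp A C (B `|` D) -> perp A C B.

Definition left_monotonicity : Prop :=
  forall A D C B, small K A -> small K D -> small K C -> small K B ->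
    perp (A `|` D) C B -> perp A C B.

Definition right_base_monotonicity : Prop :=
  forall A C B D, small K A -> small K C -> small K B -> small K D ->
    C `<=` B -> B `<=` D -> perp A C D -> perp A B D.

Definition local_character : Prop :=
  forall A, small K A ->
    exists kappa : set K, small K kappa /\
      forall B, small K B ->
        exists B0, [/\ B0 `<=` B, card_lt B0 kappa & perp A B0 B].

Definition extension : Prop :=
  forall A C B D, small K A -> small K C -> small K B -> small K D ->
    perp A C B -> B `<=` D ->
    exists A', set_equiv (B `|` C) A' A /\ perp A' C D.

Definition independence_theorem : Prop :=
  forall N A B (I : Type) (c1 c2 : I -> M),
    small K N -> elementary_substructure N ->
    small K A -> small K B -> small K [set: I] ->
    perp A N B -> perp (range c1) N A -> perp (range c2) N B ->
    tuple_equiv N c1 c2 ->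
    exists c : I -> M, [/\ perp (range c) N (A `|` B),
      tuple_equiv (N `|` A) c c1 & tuple_equiv (N `|` B) c c2].

Definition finite_character : Prop :=
  forall A C B, small K A -> small K C -> small K B ->
    (forall a, finite_set a -> a `<=` A -> perp a C B) -> perp A C B.

Definition left_normality : Prop :=
  forall A C B, small K A -> small K C -> small K B ->
    perp A C B -> perp (A `|` C) C B.

Definition left_transitivity : Prop :=
  forall A C B D, small K A -> small K C -> small K B -> small K D ->
    C `<=` B -> B `<=` D -> perp B C A -> perp D B A -> perp D C A.

End TernaryRelations.

Definition rel_included L (K : Type) (M : structure L)
    (perp1 perp2 : set M -> set M -> set M -> Prop) : Prop :=
  forall A C B, small K A -> small K C -> small K B ->
    perp1 A C B -> perp2 A C B.

Definition rel_equal L (K : Type) (M : structure L)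
    (perp1 perp2 : set M -> set M -> set M -> Prop) : Prop :=
  forall A C B, small K A -> small K C -> small K B ->
    (perp1 A C B <-> perp2 A C B).

(* Main.v *)
(* Call the given relation "independence".

   Independence implies non-dividing.  If [R x b] divides over [C], compactness
   gives conjugates [b_j] of [b], indexed by [K], such that the [R x b_j] are
   k-inconsistent.  Local character yields a small model [N] containing [C] and
   k of these [b_j], of the same type over [N], each independent over [N] from
   the previous ones; by the independence theorem over [N] a realisation of [R x b]
   independent from [b] moves to a common realisation of the k formulas.
   Extension turns non-dividing into non-forking.

   Simplicity, forking = dividing, symmetry.  Local character excludes long
   sequences [b_l] such that all [R x b_l] are consistent and each of them
   k-divides over the previous terms; by compactness it excludes arbitrarily long
   finite approximations of such sequences.  A tree property provides such
   approximations.  So does a formula that divides over [C] but is consistent along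
   arbitrarily long sequences whose terms do not divide over [C] with respect to the
   previous ones (read such a sequence backwards and use left transitivity of
   non-dividing); this is the part of Kim's lemma from which forking = dividing and
   symmetry follow.

   Non-forking implies independence.  If the terms of a sequence [f] satisfy
   [f_<i] independent from [f_i] over [C] for all i, then local character of [A] and
   left transitivity make [A] independent from some [f_i].  This gives symmetry of
   independence and its validity for types finitely satisfiable in a model.  Over a
   model [N], take for [f] a coheir sequence in the type of [B]: it is indiscernible, so
   when [A] is non-dividing from [B] there is [A'] such that all the pairs [A'], [f_i]
   have the type of [A], [B] over [N].  A general base [C] is extended to a model
   independent from [A] and [B] over [C]. *)

From Stdlib Require List.
Require Import Defs.
From mathcomp Require Import all_boot.
From mathcomp Require Import zify.
From mathcomp Require Import boolp classical_sets functions cardinality.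
From mathcomp Require Import filter wochoice.

Set Implicit Arguments.
Unset Strict Implicit.
Unset Printing Implicit Defensive.

Local Open Scope classical_set_scope.
Local Open Scope card_scope.

(** * Embeddings and smallness *)

(** Two obstacles shape the proof. Local character bounds the size of a base by a cardinal that
    depends on the independent set, so sequences of length omega are too short. They are indexed by
    [K] and cut at some [delta] that no set below that cardinal can reach cofinally. As [K] is not
    small, such a sequence is not a small tuple, and compactness is therefore proved for up to |[K]|
    variables, with only the parameters small.

    The other obstacle is indiscernibility, on which the usual proof of Kim's lemma relies. No
    indiscernible sequence is extracted here. The bound of [nondiv_sequence_bound] asks only that
    each term have the type of [b] over [C], and it is the same for all sequences, which allows a
    finite pigeonhole argument in the proof that forking is dividing. Where indiscernibility is
    needed, the sequence is generated by an ultrafilter and has it for free.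

    Types are handled through definable sets and conjugation through automorphisms, so that tuples
    of any small length need no syntax of their own. *)

Definition emb (T U : Type) : Prop := exists f : T -> U, injective f.

Lemma emb_refl T : emb T T.
Proof. by exists id. Qed.

Lemma emb_trans T U V : emb T U -> emb U V -> emb T V.
Proof.
by move=> [f fi] [g gi]; exists (g \o f) => x y /gi /fi.
Qed.

Lemma emb_surj T U (f : T -> U) : (forall u, exists t, f t = u) -> emb U T.
Proof. by move=> /choice[g fg]; exists g => x y e; rewrite -(fg x) e fg. Qed.

Lemma set_val_inj T (A : set T) : injective (fun x : A => set_val x).
Proof. by move=> x y; rewrite set_valE => /val_inj. Qed.

Definition sub_elt T (A : set T) x (h : A x) : A := exist _ x (mem_set h).

Lemma set_val_sub T (A : set T) x (h : A x) : set_val (sub_elt h) = x.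
Proof. by []. Qed.

Lemma sub_elt_inj {T} {A : set T} {x y} {hx : A x} {hy : A y} :
  sub_elt hx = sub_elt hy -> x = y.
Proof. by case. Qed.

Lemma set_val_in T (A : set T) (x : A) : A (set_val x).
Proof. exact: set_valP. Qed.

Lemma emb_sub T (A B : set T) : A `<=` B -> emb A B.
Proof.
move=> AB; exists (fun x => sub_elt (AB _ (set_val_in x))) => x y.
by move=> /sub_elt_inj /set_val_inj.
Qed.

Lemma emb_map T U (A : set T) (B : set U) (f : T -> U) :
  (forall x, A x -> B (f x)) -> (forall x y, A x -> A y -> f x = f y -> x = y) ->
  emb A B.
Proof.
move=> AB fi; exists (fun x => sub_elt (AB _ (set_val_in x))) => x y.
by move=> /sub_elt_inj /(fi _ _ (set_val_in x) (set_val_in y)) /set_val_inj.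
Qed.

Lemma emb_set T (A : set T) : emb A T.
Proof. by exists (fun x => set_val x); apply: set_val_inj. Qed.

Lemma emb_setT T : emb T [set: T].
Proof.
exists (fun x => sub_elt (I : [set: T] x)) => x y.
by move=> /sub_elt_inj.
Qed.

Lemma card_leE T U (A : set T) (B : set U) : (A #<= B) <-> emb A B.
Proof.
split=> [/card_leP[f]|[f fi]].
  by exists f => x y e; apply: (@inj _ _ _ f); rewrite ?inE.
apply/card_leP; apply/injfunPex; exists f => // x y _ _; exact: fi.
Qed.

Lemma emb_total T U : emb T U \/ emb U T.
Proof.
pose P := [set G : set (T * U) |
  forall a b, G a -> G b -> (a.1 = b.1 <-> a.2 = b.2)].
have [|G [PG maxG]] := @Zorn_bigcup _ P.
  move=> F FP tot a b [X FX Xa] [Y FY Yb].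
  by case: (tot _ _ FX FY) => XY; [apply: (FP _ FY) => //; apply: XY|
    apply: (FP _ FX) => //; apply: XY].
have [|] := pselect (forall t, exists u, G (t, u)) => [/choice[f Gf]|].
  left; exists f => x y e.
  by apply/(PG (x, f x) (y, f y)).
have [|] := pselect (forall u, exists t, G (t, u)) => [/choice[f Gf] _|].
  right; exists f => x y e.
  by apply/(PG (f x, x) (f y, y)).
move=> /existsNP[u nu] /existsNP[t nt].
exfalso; apply: (maxG (G `|` [set (t, u)])).
  split; first by move=> x Gx; left.
  by move=> h; apply: nt; exists u; apply: h; right.
move=> a b [Ga|->] [Gb|->] //=.
- exact: PG.
- by split=> e; [case: nt; exists a.2; rewrite -e -surjective_pairing|
    case: nu; exists a.1; rewrite -e -surjective_pairing].
- by split=> e; [case: nt; exists b.2; rewrite e -surjective_pairing|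
    case: nu; exists b.1; rewrite e -surjective_pairing].
Qed.

Lemma emb_fun A B : emb (A -> B) (set (A * B)).
Proof.
exists (fun f => [set p | f p.1 = p.2]) => f g e; apply: funext => x.
by have : [set p : A * B | f p.1 = p.2] (x, f x) by []; rewrite e.
Qed.

Lemma cantor T : ~ emb (set T) T.
Proof.
move=> [f fi]; pose D := [set x | exists2 X : set T, f X = x & ~ X x].
have [|] := pselect (D (f D)) => h; last by apply: (h); exists D.
by case: (h) => X /fi ->.
Qed.

(** Transfinite recursion in which a choice may rely on the correctness of the earlier ones. [P i]
    reads its function only below [i], so the dummy value [x0] elsewhere does no harm. *)
Lemma wf_choice (I X : Type) (lt : I -> I -> Prop) (wf : well_founded lt)
    (x0 : X) (P : I -> (I -> X) -> X -> Prop) :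
  (forall i f g x, (forall j, lt j i -> f j = g j) -> P i f x -> P i g x) ->
  (forall i f, (forall j, lt j i -> P j f (f j)) -> exists x, P i f x) ->
  exists f, forall i, P i f (f i).
Proof.
move=> ext step.
pose restr i (rec : forall j, lt j i -> X) j :=
  if pselect (lt j i) is left h then rec j h else x0.
pose body i (rec : forall j, lt j i -> X) :=
  if pselect (exists x, P i (restr i rec) x) is left h
  then projT1 (cid h) else x0.
pose f := Fix wf (fun _ => X) body.
have fE i : f i = body i (fun j _ => f j).
  apply: Fix_eq => j g h gh.
  by have -> : g = h by apply: functional_extensionality_dep => y;
    apply: functional_extensionality_dep => p.
exists f; apply: (well_founded_ind wf) => i IH.
have [x Px] := step i f IH.
rewrite fE /body; case: pselect => [h|].
  apply: ext (projT2 (cid h)) => j ji.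
  by rewrite /restr; case: pselect.
case; exists x; apply: ext Px => j ji.
by rewrite /restr; case: pselect.
Qed.

(** The principle gives a unique minimum in every inhabited set. Minima of sets with at most three
    elements yield the axioms of a total order. *)
Lemma well_order_exists (T : Type) : exists lt : T -> T -> Prop,
  [/\ well_founded lt, forall x y z, lt x y -> lt y z -> lt x z &
      forall x y, [\/ lt x y, x = y | lt y x]].
Proof.
have [R wR] := well_ordering_principle {classic T}.
have mn (A : T -> Prop) : (exists x, A x) ->
    exists z, [/\ A z, forall x, A x -> R z x &
      forall z', A z' -> (forall x, A x -> R z' x) -> z = z'].
  move=> [x Ax]; have [|z [[zA zl] uz]] := wR [pred y : {classic T} | `[< A y >]].
    by exists x; apply/asboolP.
  exists z; split; first exact/asboolP.
    by move=> y Ay; apply: zl; apply/asboolP.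
  move=> z' Az' zl'; apply: uz; split; first exact/asboolP.
  by move=> y /asboolP; apply: zl'.
have rfl x : R x x.
  by have [|z [-> zl _]] := mn (fun u => u = x); [exists x|apply: zl].
have anti x y : R x y -> R y x -> x = y.
  move=> xy yx; have [|z [_ _ uz]] := mn (fun u => u = x \/ u = y).
    by exists x; left.
  have <- : z = x by apply: uz; [left|move=> u [->|->]].
  by apply: uz; [right|move=> u [->|->]].
have tot x y : R x y \/ R y x.
  have [|z [[->|->] zl _]] := mn (fun u => u = x \/ u = y); first by exists x; left.
    by left; apply: zl; right.
  by right; apply: zl; left.
have tr x y z : R x y -> R y z -> R x z.
  move=> xy yz.
  have [|u [uE ul _]] := mn (fun u => [\/ u = x, u = y | u = z]).
    by exists x; constructor 1.
  have [Rx Ry Rz] : [/\ R u x, R u y & R u z].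
    by split; apply: ul; [constructor 1|constructor 2|constructor 3].
  case: uE => e; first by rewrite -e.
    have : x = y by apply: anti => //; rewrite -e.
    by move=> ->.
  have : y = z by apply: anti => //; rewrite -e.
  by move=> <-.
exists (fun x y => R x y /\ x <> y); split.
- move=> x; apply: contrapT => nx.
  have [|z [nz zl _]] := mn (fun u => ~ Acc (fun x y => R x y /\ x <> y) u).
    by exists x.
  apply: nz; constructor => y [yz ne]; apply: contrapT => ny.
  by apply: ne; apply: anti yz _; apply: zl.
- move=> x y z [xy nxy] [yz nyz]; split; first exact: tr xy yz.
  by move=> e; apply: nxy; apply: anti => //; rewrite e.
- move=> x y; have [->|/eqP ne] := eqVneq (x : {classic T}) y; first by constructor 2.
  have ne' : y <> x by move=> e; apply: ne.
  by case: (tot x y) => h; [constructor 1|constructor 3].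
Qed.

Section Small.
Variable K : Type.
Hypothesis inaccK : strongly_inaccessible K.

(** Cardinals are comparable, so the absence of an embedding of [K] is the strict inequality. Types
    instead of sets cover index types, formulas and tuples as well. *)
Record smallT (X : Type) : Prop := SmallT { smallT_not_emb : ~ emb K X }.

Lemma smallE T (A : set T) : small K A <-> smallT A.
Proof.
rewrite /small /card_lt !card_leE; split=> [[_ nA]|[sA]].
  split=> KA.
  by apply: nA; apply: emb_trans KA; apply: emb_set.
have nA : ~ emb [set: K] A by move=> h; apply: sA; apply: emb_trans h; apply: emb_setT.
by split=> //; case: (emb_total A [set: K]).
Qed.

Lemma smallT_emb X Y : emb X Y -> smallT Y -> smallT X.
Proof. by move=> XY [sY]; split=> /emb_trans/(_ XY). Qed.

Lemma smallT_surj X Y (f : Y -> X) :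
  (forall x, exists y, f y = x) -> smallT Y -> smallT X.
Proof. by move=> /emb_surj; apply: smallT_emb. Qed.

Lemma smallT_range X T (f : X -> T) : smallT X -> smallT (range f).
Proof.
apply: (@smallT_surj _ _ (fun i => sub_elt (imageT f i))) => k.
have [i _ e] := set_val_in k; exists i; apply: set_val_inj.
by rewrite set_val_sub e.
Qed.

(** Regularity in its most convenient form: a copy of [K] in [X] would be a union of small fibres
    over a small index set. *)
Lemma smallT_fibers X I (f : X -> I) :
  smallT I -> (forall i, smallT [set x | f x = i]) -> smallT X.
Proof.
move=> sI sf; split=> -[h hi].
have [[g gi]|/(smallT_not_emb sI) //] := emb_total I K.
have [_ + _] := inaccK.
move=> /(_ (range g) (fun k => [set x | g (f (h x)) = k])).
have -> : \bigcup_(i in range g) [set x | g (f (h x)) = i] = [set: K].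
  by apply/seteqP; split=> // x _; exists (g (f (h x))).
rewrite !smallE => H; apply: smallT_not_emb (H _ _) (emb_setT K).
  exact: smallT_range.
move=> _ [i _ <-]; apply/smallE; apply: smallT_emb (sf i).
have fi (x : [set x | g (f (h x)) = g i]) : [set x | f x = i] (h (set_val x)).
  by apply: gi; exact: set_val_in x.
exists (fun x => sub_elt (fi x)) => x y /sub_elt_inj /hi.
exact: set_val_inj.
Qed.

Lemma smallT_sub T (A B : set T) : A `<=` B -> smallT B -> smallT A.
Proof. by move=> /emb_sub; apply: smallT_emb. Qed.

Lemma smallT_nat : smallT nat.
Proof.
split=> -[f fi]; have [+ _ _] := inaccK; apply; rewrite /countable card_leE.
apply: emb_trans (emb_set _) _; apply: emb_trans (emb_setT _).
by exists f.
Qed.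

Lemma smallT_countable (X : countType) : smallT X.
Proof. by apply: smallT_emb smallT_nat; exists pickle; apply: pcan_inj pickleK. Qed.

Lemma smallT_sigma I (F : I -> Type) :
  smallT I -> (forall i, smallT (F i)) -> smallT {i & F i}.
Proof.
move=> sI sF; apply: (@smallT_fibers _ _ (@projT1 _ _)) => // i.
apply: (@smallT_surj _ _ (fun u =>
  sub_elt (erefl : [set x | projT1 x = i] (existT F i u)))) (sF i) => x.
case: x => -[j u] h; have /= e := set_mem h; subst j; exists u.
exact: set_val_inj.
Qed.

Lemma smallT_prod X Y : smallT X -> smallT Y -> smallT (X * Y).
Proof.
move=> sX sY; apply: smallT_emb (@smallT_sigma X (fun=> Y) sX (fun=> sY)).
by exists (fun p => existT (fun=> Y) p.1 p.2) => -[a b] [c d] [] -> ->.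
Qed.

Lemma smallT_sum X Y : smallT X -> smallT Y -> smallT (X + Y).
Proof.
move=> sX sY.
apply: (@smallT_fibers _ bool (fun s => if s is inl _ then true else false)).
  exact: smallT_countable.
case.
  apply: (@smallT_surj _ X (fun x => sub_elt (erefl :
    [set s : X + Y | (if s is inl _ then true else false) = true] (inl x)))) => //.
  case=> -[x|y] h; last by have := set_mem h.
  by exists x; apply: set_val_inj.
apply: (@smallT_surj _ Y (fun y => sub_elt (erefl :
  [set s : X + Y | (if s is inl _ then true else false) = false] (inr y)))) => //.
case=> -[x|y] h; first by have := set_mem h.
by exists y; apply: set_val_inj.
Qed.

Lemma smallT_option X : smallT X -> smallT (option X).
Proof.
move=> sX; apply: smallT_emb _ (smallT_sum (smallT_countable unit) sX).
by exists (fun o => if o is Some x then inr x else inl tt) => -[x|] [y|] // [->].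
Qed.

Lemma smallT_set X : smallT X -> smallT (set X).
Proof.
move=> sX; have [[g gi]|/(smallT_not_emb sX) //] := emb_total X K.
have [_ _ /(_ (range g))] := inaccK; rewrite !smallE => H.
apply: smallT_emb (H _).
  exists (fun A => sub_elt (@image_subset _ _ g A setT (@subsetT _ A) :
    [set X0 | X0 `<=` range g] (g @` A))) => A B /sub_elt_inj e.
  have sub C D : g @` C = g @` D -> C `<=` D.
    move=> CD x Cx; have [y Dy /gi <- //] : (g @` D) (g x).
    by rewrite -CD; exists x.
  by apply/seteqP; split; apply: sub.
exact: smallT_range.
Qed.

Lemma smallT_fun X Y : smallT X -> smallT Y -> smallT (X -> Y).
Proof.
move=> sX sY; apply: smallT_emb (emb_fun _ _) _; apply: smallT_set.
exact: smallT_prod.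
Qed.

Lemma smallT_setT X : smallT X -> smallT [set: X].
Proof. by apply: smallT_emb; apply: emb_set. Qed.

Lemma smallT_bigcup I T (D : set I) (F : I -> set T) :
  smallT D -> (forall i, D i -> smallT (F i)) -> smallT (\bigcup_(i in D) F i).
Proof.
move=> sD sF.
have sS := @smallT_sigma D (fun i => F (set_val i)) sD (fun i => sF _ (set_val_in i)).
apply: smallT_emb sS.
have h (x : \bigcup_(i in D) F i) : exists p : {i : D & F (set_val i)},
    set_val (projT2 p) = set_val x.
  have [i Di Fx] := set_val_in x.
  by exists (existT (fun i : D => F (set_val i)) (sub_elt Di) (sub_elt Fx)).
have [f fE] := choice h; exists f => x y e.
by apply: set_val_inj; rewrite -(fE x) e.
Qed.

Lemma smallT_setU T (A B : set T) : smallT A -> smallT B -> smallT (A `|` B).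
Proof.
move=> sA sB; rewrite -bigcup2E; apply: smallT_bigcup.
  exact: smallT_emb (emb_set _) smallT_nat.
move=> [|[|i]] _ //=; apply: (@smallT_emb _ unit); last exact: smallT_countable.
by exists (fun=> tt) => x; case: (set_val_in x).
Qed.

Lemma smallT_set0 T : smallT (set0 : set T).
Proof.
apply: (@smallT_emb _ unit); last exact: smallT_countable.
by exists (fun=> tt) => x; case: (set_val_in x).
Qed.

Lemma smallT_set1 T (x : T) : smallT [set x].
Proof.
apply: (@smallT_emb _ unit); last exact: smallT_countable.
exists (fun=> tt) => y z _; apply: set_val_inj.
by rewrite (set_val_in y) (set_val_in z).
Qed.

End Small.

(** * The well-order of K *)

Record initial_order (K : Type) (lt : K -> K -> Prop) : Prop := InitialOrder {
  io_wf : well_founded lt;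
  io_trans : forall x y z, lt x y -> lt y z -> lt x z;
  io_total : forall x y, [\/ lt x y, x = y | lt y x];
  io_small : forall k, smallT K [set x | lt x k] }.

Lemma io_irr K (lt : K -> K -> Prop) (io : initial_order lt) x : ~ lt x x.
Proof. by elim/(well_founded_ind (io_wf io)): x => x IH h; apply: IH (h). Qed.

Lemma wf_min (T : Type) (lt : T -> T -> Prop) (wf : well_founded lt)
    (P : T -> Prop) : (exists x, P x) -> exists x, P x /\ forall y, lt y x -> ~ P y.
Proof.
move=> [x Px]; apply: contrapT => nex.
have np : forall y, ~ P y.
  elim/(well_founded_ind wf) => y IH Py.
  by apply: nex; exists y.
exact: np Px.
Qed.

Section Order.
Variable K : Type.
Hypothesis inaccK : strongly_inaccessible K.

(** If some initial segment is not small, [K] embeds into the least such segment. The order pulled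
    back along this embedding has small segments by minimality. *)
Lemma initial_order_exists : exists lt : K -> K -> Prop, initial_order lt.
Proof.
have [lt [wf tr tot]] := well_order_exists K.
have [sm|/existsNP nsm] := pselect (forall k, smallT K [set x | lt x k]).
  by exists lt.
have [k0 [nk0 min]] := wf_min wf nsm.
have [f fi] : emb K [set x | lt x k0] by apply: contrapT => h; apply: nk0.
pose lt' x y := lt (set_val (f x)) (set_val (f y)).
have fk x : lt (set_val (f x)) k0 by exact: set_val_in (f x).
exists lt'; split.
- have A : forall z x, z = set_val (f x) -> Acc lt' x.
    elim/(well_founded_ind wf) => z IH x e; constructor => y yx.
    by apply: IH (erefl _); rewrite e.
  by move=> x; apply: A (erefl _).
- by move=> x y z; apply: tr.
- move=> x y; have [h|h|h] := tot (set_val (f x)) (set_val (f y)).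
  + by constructor 1.
  + by constructor 2; apply: fi; apply: set_val_inj.
  + by constructor 3.
- move=> k; have /contrapT := min _ (fk k).
  apply: smallT_emb.
  exists (fun x : [set x | lt' x k] =>
    sub_elt (set_val_in x : [set y | lt y (set_val (f k))] _)).
  by move=> x y /sub_elt_inj /set_val_inj /fi /set_val_inj.
Qed.

Variable lt : K -> K -> Prop.
Hypothesis io : initial_order lt.

Lemma not_lt x y : ~ lt x y -> lt y x \/ y = x.
Proof. by case: (io_total io x y) => // h _; [right|left]. Qed.

Lemma smallT_le k : smallT K [set x | lt x k \/ x = k].
Proof.
have -> : [set x | lt x k \/ x = k] = [set x | lt x k] `|` [set k] by [].
apply: smallT_setU => //; first exact: io_small.
exact: smallT_set1.
Qed.

Lemma small_bounded (S : set K) : smallT K S -> exists b, forall s, S s -> lt s b.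
Proof.
move=> sS; apply: contrapT => /forallNP nb.
have h b : exists s : S, lt b (set_val s) \/ b = set_val s.
  have /existsNP[s /not_implyP[Ss /not_lt]] := nb b.
  by exists (sub_elt Ss).
have [f fE] := choice h.
suff [] : smallT K K by apply; exact: emb_refl.
apply: (@smallT_fibers K inaccK K S f) => // s.
by apply: (smallT_sub _ (smallT_le (set_val s))) => x /= <-; exact: fE.
Qed.

Lemma emb_fibers (Q X I : Type) (f : X -> I) : emb (Q * Q) Q -> emb I Q ->
  (forall i, emb [set x | f x = i] Q) -> emb X Q.
Proof.
move=> QQ [g gi] sf; apply: emb_trans QQ.
pose h i := projT1 (cid (sf i)); have hi i : injective (h i) := projT2 (cid (sf i)).
exists (fun x => (g (f x), h (f x) (sub_elt (erefl (f x) : [set y | f y = f x] x)))).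
move=> x y [/gi e].
have key i j (px : [set z | f z = i] x) (py : [set z | f z = j] y) : i = j ->
    h i (sub_elt px) = h j (sub_elt py) -> x = y.
  by move=> ij; subst j => /hi /sub_elt_inj.
exact: key.
Qed.

(* [delta] is the cardinal successor of the set of subsets of [option kappa * nat],
   which is equipotent to its square. *)
Lemma cofinality_exists (kappa : set K) : small K kappa ->
  exists delta, forall S : set K, (forall s, S s -> lt s delta) ->
    card_lt S kappa -> exists2 gamma, lt gamma delta & forall s, S s -> lt s gamma.
Proof.
rewrite smallE // => sk.
(* The factor [nat] lets [Q] absorb its square; [option] keeps the base inhabited when [kappa] is
   empty, so that [bool] embeds into [Q]. *)
pose Q := set (option kappa * nat).
have kQ : emb kappa Q.
  exists (fun x => [set (Some x, 0)]) => x y e.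
  by have : [set (Some x, 0)] (Some x, 0) by []; rewrite e => -[].
have bQ : emb bool Q.
  exists (fun b => if b then [set: option kappa * nat] else set0).
  have n : [set: option kappa * nat] <> set0.
    by move=> e; have : [set: option kappa * nat] (None, 0) by []; rewrite e.
  by move=> [] [] // e; case: n.
have QQ : emb (Q * Q) Q.
  exists (fun p => [set z | if odd z.2 then p.1 (z.1, z.2./2) else p.2 (z.1, z.2./2)]).
  move=> [A B] [C D] /= e.
  have e' z : (if odd z.2 then A (z.1, z.2./2) else B (z.1, z.2./2)) =
    (if odd z.2 then C (z.1, z.2./2) else D (z.1, z.2./2)).
    by move: (congr1 (@^~ z) e).
  congr (_, _); apply: funext => -[x n].
    by have := e' (x, n.*2.+1); rewrite /= odd_double /= uphalf_double.
  by have := e' (x, n.*2); rewrite /= odd_double /= doubleK.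
have sQ : smallT K (set Q).
  apply: smallT_set => //; apply: smallT_set => //; apply: smallT_prod => //.
    exact: smallT_option.
  exact: smallT_nat.
have ex : exists d, ~ emb [set x | lt x d \/ x = d] Q.
  have [[f fi]|/(smallT_not_emb sQ) //] := emb_total (set Q) K.
  have [b fb] := small_bounded (smallT_range f sQ).
  exists b => h; apply: (@cantor Q); apply: emb_trans h.
  exists (fun x => sub_elt (or_introl (fb _ (imageT f x)) :
    [set z | lt z b \/ z = b] (f x))) => x y.
  by move=> /sub_elt_inj /fi.
(* By minimality, closed segments below [d] embed into [Q]. A set of size less than |[kappa]|
   cofinal in [d] would cover the segment of [d] by at most |[Q]| of them, and that segment would
   embed into [Q] too. *)
have [d [nondiv dmin]] := wf_min (io_wf io) ex.
exists d => S Sd [/card_leE SQ _]; apply: contrapT => nb; apply: nondiv.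
have {}SQ : emb S Q by apply: emb_trans kQ.
have h (x : [set x | lt x d]) : exists s : S,
    lt (set_val x) (set_val s) \/ set_val x = set_val s.
  have xd : lt (set_val x) d by exact: set_val_in x.
  apply: contrapT => /forallNP nx; apply: nb; exists (set_val x) => // s Ss.
  apply: contrapT => /not_lt H; apply: (nx (sub_elt Ss)); exact: H.
have [f fE] := choice h.
have dQ : emb [set x | lt x d] Q.
  apply: (emb_fibers (f := f) QQ SQ) => s.
  have /contrapT := dmin _ (Sd _ (set_val_in s)); apply: emb_trans.
  apply: (@emb_map _ _ _ _ (fun x => set_val x)) => [x /= <-|x y _ _]; first exact: fE.
  exact: set_val_inj.
pose below (x : [set y | lt y d \/ y = d]) := `[< lt (set_val x) d >].
apply: (emb_fibers (f := below) QQ bQ) => -[].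
  apply: emb_trans dQ.
  apply: (@emb_map _ _ _ _ (fun x => set_val x)) => [x /= /asboolP //|x y _ _].
  exact: set_val_inj.
apply: emb_trans bQ; exists (fun=> true) => x y _.
have aux (z : [set y | below y = false]) : set_val (set_val z) = d.
  have /asboolP := set_val_in z.
  by case: (set_val_in (set_val z)).
by apply: set_val_inj; apply: set_val_inj; rewrite !aux.
Qed.

(** Embed the fibres one after the other. The values used before stage [k] form a small set, so its
    complement has room for the small fibre of [k]. This keeps [K] many small blocks of variables
    within the reach of compactness. *)
Lemma emb_rank X (rho : X -> K) :
  (forall k, smallT K [set x | rho x = k]) -> emb X K.
Proof.
move=> sf.
have [x0|nX] := pselect (exists x : X, True); last first.
  by exists (fun x => False_rect _ (nX (ex_intro _ x I))) => x; case: nX; exists x.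
case: x0 => x0 _.
pose P k (f : K -> X -> K) (g : X -> K) :=
  (forall x y, rho x = k -> rho y = k -> g x = g y -> x = y) /\
  (forall x y, rho x = k -> lt (rho y) k -> g x <> f (rho y) y).
have [|k f _|f Pf] := @wf_choice K (X -> K) lt (io_wf io) (fun=> rho x0) P.
- move=> i f g h e [P1 P2]; split=> // x y xi yi.
  by rewrite -(e _ yi); apply: P2.
- pose A := [set z | exists2 y, lt (rho y) k & f (rho y) y = z].
  have sA : smallT K A.
    have -> : A = (fun y => f (rho y) y) @` (\bigcup_(j in [set j | lt j k]) [set x | rho x = j]).
      apply/seteqP; split=> z [y].
        by move=> yk <-; exists y => //; exists (rho y).
      by move=> [j jk /= e] <-; exists y => //; rewrite e.
    have := @smallT_bigcup K inaccK _ _ [set j | lt j k] (fun j => [set x | rho x = j])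
      (io_small io k) (fun j _ => sf j).
    set D := \bigcup_(j in _) _ => sD.
    apply: (@smallT_surj K _ D
      (fun x => sub_elt (imageP (fun y => f (rho y) y) (set_val_in x)))) => // z.
    have [y Dy e] := set_val_in z; exists (sub_elt Dy).
    by apply: set_val_inj.
  have [[g gi]|h] := emb_total [set x | rho x = k] (~` A).
    pose g' x := if pselect (rho x = k) is left h
      then set_val (g (sub_elt (h : [set x | rho x = k] x))) else rho x0.
    exists g'; split=> x y; rewrite /g'; case: pselect => // xk.
      by move=> _; case: pselect => // yk _ /set_val_inj /gi /sub_elt_inj.
    move=> _ yk e; have := set_val_in (g (sub_elt (xk : [set x | rho x = k] x))).
    by apply; exists y.
  exfalso; have := smallT_setU inaccK sA (smallT_emb h (sf k)).
  by rewrite setUv => -[]; apply; apply: emb_setT.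
- exists (fun x => f (rho x) x) => x y e.
  have [h|h|h] := io_total io (rho x) (rho y).
  + by have [_ /(_ y x erefl h)] := Pf (rho y); rewrite e.
  + by have [Pe _] := Pf (rho y); apply: Pe => //; rewrite -e -h.
  + by have [_ /(_ x y erefl h)] := Pf (rho x); rewrite e.
Qed.

End Order.

(** * Definable sets *)

Section Syntax.
Variable L : language.

Fixpoint rename_term X Y (f : X -> Y) (t : term L X) : term L Y :=
  match t with
  | Var x => Var L (f x)
  | App g ts => App (fun i => rename_term f (ts i))
  end.

Fixpoint rename X Y (f : X -> Y) (p : formula L X) : formula L Y :=
  match p with
  | Bot => Bot
  | Equal t1 t2 => Equal (rename_term f t1) (rename_term f t2)
  | Rel r ts => Rel (fun i => rename_term f (ts i))
  | Imp p q => Imp (rename f p) (rename f q)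
  | All p => All (rename (omap f) p)
  end.

Lemma eval_rename (M : structure L) X Y (f : X -> Y) (t : term L X) (e : Y -> M) :
  eval e (rename_term f t) = eval (e \o f) t.
Proof. by elim: t => //= g ts IH; congr fun_int; apply: funext. Qed.

Lemma extend_omap (U : Type) X Y (f : X -> Y) (e : Y -> U) u :
  extend e u \o omap f = extend (e \o f) u.
Proof. by apply: funext => -[]. Qed.

Lemma sat_rename (M : structure L) X (p : formula L X) Y (f : X -> Y) (e : Y -> M) :
  sat e (rename f p) <-> sat (e \o f) p.
Proof.
elim: p Y f e => {X} [X|X t1 t2|X r ts|X p IHp q IHq|X p IH] Y f e //=.
- by rewrite !eval_rename.
- suff -> : (fun i => eval e (rename_term f (ts i))) = (fun i => eval (e \o f) (ts i)) by [].
  by apply: funext => i; rewrite eval_rename.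
- by rewrite IHp IHq.
- by split=> H u; move: (H u); rewrite IH extend_omap.
Qed.

Lemma term_support X (t : term L X) : exists l : list X,
  forall (M : structure L) (e e' : X -> M),
    (forall x, List.In x l -> e x = e' x) -> eval e t = eval e' t.
Proof.
elim: t => [x|g ts IH]; first by exists [:: x] => M e e' /(_ x); apply; left.
have [l lP] := choice IH.
exists (flatten [seq l i | i <- enum 'I_(fun_arity g)]) => M e e' h /=.
congr fun_int; apply: funext => i; apply: lP => x xl; apply: h.
have : i \in enum 'I_(fun_arity g) by rewrite mem_enum.
elim: (enum _) => //= j s IHs; rewrite inE => /orP[/eqP <-|/IHs H];
  apply/List.in_or_app; by [left|right].
Qed.

Lemma formula_support X (p : formula L X) : exists l : list X,
  forall (M : structure L) (e e' : X -> M),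
    (forall x, List.In x l -> e x = e' x) -> (sat e p <-> sat e' p).
Proof.
elim: p => {X} [X|X t1 t2|X r ts|X p [lp IHp] q [lq IHq]|X p [l IH]].
- by exists [::].
- have [l1 P1] := term_support t1; have [l2 P2] := term_support t2.
  exists (l1 ++ l2) => M e e' h /=.
  by rewrite (P1 _ e e') ?(P2 _ e e') // => x xl; apply: h; apply/List.in_or_app;
    [right|left].
- have [l lP] := choice (fun i => term_support (ts i)).
  exists (flatten [seq l i | i <- enum 'I_(rel_arity r)]) => M e e' h /=.
  suff -> : (fun i => eval e (ts i)) = (fun i => eval e' (ts i)) by [].
  apply: funext => i; apply: lP => x xl; apply: h.
  have : i \in enum 'I_(rel_arity r) by rewrite mem_enum.
  elim: (enum _) => //= j s IHs; rewrite inE => /orP[/eqP <-|/IHs H];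
    apply/List.in_or_app; by [left|right].
- exists (lp ++ lq) => M e e' h /=.
  by rewrite (IHp _ e e') ?(IHq _ e e') // => x xl; apply: h; apply/List.in_or_app;
    [right|left].
- exists (pmap id l) => M e e' h /=.
  have H u : sat (extend e u) p <-> sat (extend e' u) p.
    apply: IH => -[x|] //= xl; apply: h.
    elim: l xl => //= -[y|] l IHl [] //=; last by move=> ?; right; apply: IHl.
    by move=> [->]; left.
  by split=> G u; apply/H.
Qed.

Definition Not X (p : formula L X) := Imp p Bot.

Definition Ex X (p : formula L (option X)) := Not (All (Not p)).

Lemma sat_Ex (M : structure L) X (p : formula L (option X)) (e : X -> M) :
  sat e (Ex p) <-> exists u, sat (extend e u) p.
Proof.
split=> [/= h|[u pu] /= h]; last exact: h pu.
by apply: contrapT => /forallNP n; apply: h => u pu; apply: (n u).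
Qed.

Lemma ex_elim X (l : list X) (p : formula L X) : exists q : formula L X,
  forall (M : structure L) (e : X -> M), sat e q <->
    exists h : X -> M, (forall x, ~ List.In x l -> h x = e x) /\ sat h p.
Proof.
elim: l => [|z l [q qP]].
  exists p => M e; split=> [pe|[h [he ph]]]; first by exists e.
  by have <- : h = e by apply: funext => x; apply: he.
exists (Ex (rename (fun x => if pselect (x = z) then None else Some x) q)) => M e.
rewrite sat_Ex; split=> [[u]|[h [he ph]]].
  rewrite sat_rename => /qP[h [he ph]]; exists h; split=> // x xzl.
  rewrite he; last by move=> xl; apply: xzl; right.
  by rewrite /=; case: pselect => //= xz; case: xzl; left.
exists (h z); rewrite sat_rename; apply/qP; exists h; split=> // x xl /=.
case: pselect => [xz|xz] /=; first by rewrite xz.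
by apply: he => -[zx|//]; apply: xz.
Qed.

(** Only finitely many variables occur in [p], so quantifying over a tuple of any length is
    first-order. *)
Lemma proj_formula Y Z (p : formula L (Y + Z)) : exists q : formula L Y,
  forall (M : structure L) (m0 : M) (e : Y -> M), sat e q <->
    exists h : Z -> M, sat (join_assign e h) p.
Proof.
have [s sP] := formula_support p.
pose isr (v : Y + Z) := if v is inr _ then true else false.
have [q0 q0P] := ex_elim [seq v <- s | isr v] p.
(* The truth of [q0] does not depend on the [inr] variables, which remain in its index type. One
   dummy quantifier, witnessed by [m0], gives all of them a value. *)
exists (Ex (rename (fun v : Y + Z => if v is inl y then Some y else None) q0)).
move=> M m0 e; rewrite sat_Ex; split=> [[u]|[h ph]].
  rewrite sat_rename => /q0P[h [he ph]]; exists (fun z => h (inr z)).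
  suff -> : join_assign e (fun z => h (inr z)) = h by [].
  apply: funext => -[y|z] //=; rewrite he //=.
  elim: s {sP q0P he} => //= -[y'|z'] s IHs //= [] //.
exists m0; rewrite sat_rename; apply/q0P.
pose g (v : Y + Z) := if pselect (List.In v s) then join_assign e h v else
  if v is inl y then e y else m0.
exists g; split.
  move=> [y|z] /= nin; first by rewrite /g; case: pselect.
  rewrite /g; case: pselect => // zs; case: nin.
  elim: s zs {sP q0P g} => //= v s IHs [->|/IHs H] /=; first by left.
  by case: (isr v) => //=; right.
by apply/(sP _ g (join_assign e h)) => // x xs; rewrite /g; case: pselect.
Qed.

End Syntax.

Section Definable.
Variables (L : language) (M : structure L).

Definition pval V (C : set M) (a : V -> M) : V + C -> M :=
  join_assign a (fun c : C => set_val c).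

(* A single formula whose variables are those of the tuple and one for each element
   of [C]; only finitely many of them occur. *)
Definition definable (C : set M) V (S : set (V -> M)) : Prop :=
  exists p : formula L (V + C), forall a, S a <-> sat (pval a) p.

(** Substitutions of variables or constants for variables, seen as maps on assignments. *)
Definition coordwise (C : set M) V W (t : (V -> M) -> (W -> M)) : Prop :=
  forall w, (exists v, forall a, t a w = a v) \/ (exists2 c, C c & forall a, t a w = c).

Lemma definable_ext C V (S S' : set (V -> M)) :
  (forall a, S a <-> S' a) -> definable C S' -> definable C S.
Proof. by move=> SS [p pP]; exists p => a; rewrite SS. Qed.

Lemma definable_pre (D C : set M) V W (S : set (W -> M)) (t : (V -> M) -> (W -> M)) :
  definable D S -> D `<=` C -> coordwise C t -> definable C [set a | S (t a)].
Proof.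
move=> [p pP] DC ct.
have h w : exists x : V + C, forall a, t a w = pval a x.
  by case: (ct w) => [[v vE]|[c Cc cE]]; [exists (inl v)|exists (inr (sub_elt Cc))].
have [g gE] := choice h.
exists (rename (fun x : W + D => match x with inl w => g w
  | inr d => inr (sub_elt (DC _ (set_val_in d))) end) p) => a.
rewrite sat_rename /= pP.
suff -> : pval (C := D) (t a) = pval a \o (fun x : W + D => match x with inl w => g w
  | inr d => inr (sub_elt (DC _ (set_val_in d))) end) by [].
by apply: funext => -[w|d] /=.
Qed.

Lemma definable_mono (D C : set M) V (S : set (V -> M)) : D `<=` C -> definable D S -> definable C S.
Proof.
move=> DC dS; apply: (@definable_pre D C V V S id) => // v.
by left; exists v.
Qed.

Lemma definable_formula C V (p : formula L V) : definable C [set a : V -> M | sat a p].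
Proof. by exists (rename inl p) => a; rewrite sat_rename. Qed.

Lemma definableC C V (S : set (V -> M)) : definable C S -> definable C [set a | ~ S a].
Proof. by move=> [p pP]; exists (Not p) => a /=; rewrite pP. Qed.

Lemma definableIm C V (S S' : set (V -> M)) : definable C S -> definable C S' ->
  definable C [set a | S a -> S' a].
Proof. by move=> [p pP] [q qP]; exists (Imp p q) => a /=; rewrite pP qP. Qed.

Lemma definableAnd C V (S S' : set (V -> M)) : definable C S -> definable C S' ->
  definable C [set a | S a /\ S' a].
Proof.
move=> dS dS'; apply: definable_ext (definableC (definableIm dS (definableC dS'))) => a /=.
by split=> [[Sa Sa'] h|h]; [exact: h|split; apply: contrapT => n; apply: h].
Qed.

Lemma definableIff C V (S S' : set (V -> M)) : definable C S -> definable C S' ->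
  definable C [set a | S a <-> S' a].
Proof. by move=> dS dS'; apply: definableAnd; apply: definableIm. Qed.

Lemma definableTrue C V (P : Prop) : definable C [set a : V -> M | P].
Proof.
have [HP|HP] := pselect P; last by exists Bot => a.
by exists (Not Bot) => a; split=> // _ /=.
Qed.

Lemma definableAll C V n (F : 'I_n -> set (V -> M)) : (forall i, definable C (F i)) ->
  definable C [set a | forall i, F i a].
Proof.
move=> dF.
apply: (@definable_ext _ _ _ [set a | forall i, i \in enum 'I_n -> F i a]).
  by move=> a; split=> h i; [move=> _|]; apply: h; rewrite ?mem_enum.
elim: (enum _) => [|i s IHs]; first by apply: definable_ext (definableTrue _ _ True) => a.
apply: definable_ext (definableAnd (dF i) IHs) => a; split=> /= [h|[h1 h2] j].
  by split=> [|j js]; apply: h; rewrite inE ?eqxx // js orbT.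
by rewrite inE => /orP[/eqP ->|/h2].
Qed.

Lemma definable_eq C V (v w : V) : definable C [set a : V -> M | a v = a w].
Proof. exact: (definable_formula C (Equal (Var L v) (Var L w))). Qed.

Lemma definable_proj C Y Z (m0 : M) (S : set (Y + Z -> M)) : definable C S ->
  definable C [set a | exists h : Z -> M, S (join_assign a h)].
Proof.
move=> [p pP].
have [q qP] := proj_formula (rename (fun x : (Y + Z) + C => match x with
  | inl (inl y) => inl (inl y) | inl (inr z) => inr z | inr c => inl (inr c) end) p).
exists q => a; rewrite (qP _ m0) /=.
have E h : S (join_assign a h) <-> sat (join_assign (pval a) h) (rename
    (fun x : (Y + Z) + C => match x with
    | inl (inl y) => inl (inl y) | inl (inr z) => inr z | inr c => inl (inr c) end) p).
  rewrite pP sat_rename.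
  suff -> : pval (C := C) (join_assign a h) = join_assign (pval a) h \o
    (fun x : (Y + Z) + C => match x with
    | inl (inl y) => inl (inl y) | inl (inr z) => inr z | inr c => inl (inr c) end) by [].
  by apply: funext => -[[]|].
by split=> -[h] /E Sh; exists h.
Qed.

Lemma definable_supp C V (S : set (V -> M)) : definable C S -> exists l : list V,
  forall a a', (forall x, List.In x l -> a x = a' x) -> S a -> S a'.
Proof.
move=> [p pP]; have [l lP] := formula_support p.
exists (pmap (fun x : V + C => if x is inl v then Some v else None) l) => a a' h.
rewrite !pP => H; apply/(lP _ (pval a) (pval a')) => // -[v|c] //= vl; apply: h.
elim: l vl {lP} => [|[v1|c] l IHl] //= [].
- by move=> [->]; left.
- by move=> /IHl; right.
- by [].
- by move=> /IHl.
Qed.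

Lemma definable_finite C (X : set M) V (S : set (V -> M)) : definable (X `|` C) S ->
  exists n (m : 'I_n -> M) (R : set (V + 'I_n -> M)),
    [/\ forall i, X (m i), definable C R & forall a, S a <-> R (join_assign a m)].
Proof.
have [[x0 Xx0]|nX] := pselect (exists x, X x); last first.
  move=> dS; exists 0, (fun i : 'I_0 => False_rect M (notF (ltn_ord i))).
  exists [set a | S (fun v => a (inl v))]; split=> [[]//||a].
    apply: (definable_pre dS); first by move=> x [Xx|//]; case: nX; exists x.
    by move=> v; left; exists (inl v).
  by [].
move=> [p pP]; have [l lP] := formula_support p.
pose ms := pmap (fun x : V + (X `|` C) => if x is inr c
  then (if pselect (X (set_val c)) then Some (set_val c : {classic M}) else None) else None) l.
(* The additional head [x0] puts the default of [nth] into [X]; it accounts for the shift by one in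
   [ren]. *)
exists (size ms).+1, (fun i => nth x0 (x0 :: ms) i).
have msX i : X (nth x0 (x0 :: ms) i).
  have /allP/(_ (nth x0 (x0 :: ms) i)) : all (fun x : {classic M} => `[< X x >]) (x0 :: ms).
    rewrite /= asboolT //= /ms.
    elim: l {lP ms} => //= -[v|c] l IHl //=.
    by case: pselect => //= h; rewrite asboolT.
  have [ilt|ige] := ltnP i (size (x0 :: ms)).
    by rewrite mem_nth // => /(_ isT) /asboolP.
  by rewrite nth_default.
pose ren (x : V + (X `|` C)) : (V + 'I_(size ms).+1) + C := match x with
  | inl v => inl (inl v)
  | inr c => match pselect (C (set_val c)) with
    | left h => inr (sub_elt h)
    | right _ => inl (inr (inord (index (set_val c : {classic M}) ms).+1)) end end.
exists [set a | sat (pval a) (rename ren p)]; split=> // [|a]; first by exists (rename ren p).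
rewrite /= sat_rename pP; apply: lP => -[v|c] //= cl.
rewrite /ren; case: pselect => //= nC.
have Xc : X (set_val c) by case: (set_val_in c).
have cms : (set_val c : {classic M}) \in ms.
  rewrite /ms; elim: l cl {msX ren ms} => [|[v|c'] l IHl] //= [] //.
    by move=> [->]; case: pselect => //= _; rewrite inE eqxx.
  by move=> /IHl; case: pselect => //= _; rewrite inE => ->; rewrite orbT.
rewrite inordK ?ltnS /=; last by rewrite index_mem.
by rewrite (@nth_index {classic M}).
Qed.

End Definable.

(** * Automorphisms and types *)

Section Automorphisms.
Variables (L : language) (M : structure L).

Lemma eval_automorphism (s : M -> M) X (e : X -> M) (t : term L X) :
  automorphism s -> s (eval e t) = eval (s \o e) t.
Proof.
move=> [_ sf _]; elim: t => //= f ts IH; rewrite sf; congr fun_int.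
by apply: funext => i; apply: IH.
Qed.

Lemma sat_automorphism (s : M -> M) X (p : formula L X) (e : X -> M) :
  automorphism s -> sat e p <-> sat (s \o e) p.
Proof.
move=> aut; have [[t st ts] sf sr] := aut.
elim: p e => {X} [X|X t1 t2|X r us|X p IHp q IHq|X p IH] e //=.
- rewrite -!(eval_automorphism _ _ aut); split=> [->//|]; exact: (can_inj st).
- rewrite sr; suff -> : (fun i => s (eval e (us i))) = (fun i => eval (s \o e) (us i)) by [].
  by apply: funext => i; rewrite (eval_automorphism _ _ aut).
- by rewrite IHp IHq.
- have E u : s \o extend e u = extend (s \o e) (s u) by apply: funext => -[].
  split=> H u; last by rewrite IH E.
  by rewrite -(ts u) -E -IH.
Qed.

Lemma automorphism_over_comp (C : set M) (s t : M -> M) :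
  automorphism_over C s -> automorphism_over C t -> automorphism_over C (s \o t).
Proof.
move=> [[sb sf sr] sC] [[tb tf tr] tC]; split; last by move=> c Cc /=; rewrite tC // sC.
split; first exact: bij_comp.
- by move=> f ts /=; rewrite tf sf.
- by move=> r ts /=; rewrite tr sr.
Qed.

Lemma automorphism_over_inv (C : set M) (s : M -> M) : automorphism_over C s ->
  exists t, [/\ automorphism_over C t, cancel s t & cancel t s].
Proof.
move=> [[[t st ts] sf sr] sC]; exists t; split=> //; split; last first.
  by move=> c Cc; rewrite -{1}(sC c Cc) st.
split; first by exists s.
- move=> f us; apply: (can_inj st); rewrite ts sf; congr fun_int.
  by apply: funext => i; rewrite ts.
- move=> r us; rewrite (sr r (fun i => t (us i))).
  suff -> : (fun i => s (t (us i))) = us by [].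
  by apply: funext => i; rewrite ts.
Qed.

Lemma automorphism_over_mono (C D : set M) s : C `<=` D ->
  automorphism_over D s -> automorphism_over C s.
Proof. by move=> CD [as_ sD]; split=> // c /CD /sD. Qed.

Lemma definable_automorphism C V (S : set (V -> M)) s a :
  automorphism_over C s -> definable C S -> S a <-> S (s \o a).
Proof.
move=> [as_ sC] [p pP]; rewrite !pP (sat_automorphism _ _ as_).
suff -> : s \o pval a = pval (C := C) (s \o a) by [].
by apply: funext => -[v|c] //=; rewrite sC //; apply: set_val_in.
Qed.

Lemma automorphism_over_image (C : set M) s : automorphism_over C s -> s @` C = C.
Proof.
move=> [_ sC]; apply/seteqP; split=> [x [c Cc <-]|c Cc]; first by rewrite sC.
by exists c => //; apply: sC.
Qed.

Lemma range_comp (s : M -> M) V (a : V -> M) : s @` range a = range (s \o a).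
Proof.
apply/seteqP; split=> [x [y [v _ <-] <-]|x [v _ <-]]; first by exists v.
by exists (a v) => //; exists v.
Qed.

(** Equality of types over [C]: one implication is enough because complements of definable sets are
    definable. *)
Definition same_type (C : set M) V (a b : V -> M) : Prop :=
  forall S, definable C S -> S a -> S b.

Lemma same_type_sym C V (a b : V -> M) : same_type C a b -> same_type C b a.
Proof.
move=> ab S dS Sb; apply: contrapT => nSa.
exact: ab (definableC dS) nSa Sb.
Qed.

Lemma same_type_trans C V (a b c : V -> M) : same_type C a b -> same_type C b c -> same_type C a c.
Proof. by move=> ab bc S dS /(ab _ dS); apply: bc. Qed.

Lemma same_type_mono (C D : set M) V (a b : V -> M) : C `<=` D -> same_type D a b -> same_type C a b.
Proof. by move=> CD ab S /(definable_mono CD); apply: ab. Qed.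

Lemma same_type_comp C V W (f : W -> V) (a b : V -> M) : same_type C a b -> same_type C (a \o f) (b \o f).
Proof.
move=> ab S dS; apply: (ab [set a : V -> M | S (a \o f)]).
by apply: (definable_pre dS) => // w; left; exists (f w).
Qed.

Lemma same_type_automorphism C V (a : V -> M) s : automorphism_over C s -> same_type C a (s \o a).
Proof. by move=> aut S dS /(definable_automorphism a aut dS). Qed.

Lemma definable_fiber (C D : set M) V W (R : set (V + W -> M)) (b : W -> M) :
  definable C R -> range b `<=` D -> C `<=` D -> definable D [set a | R (join_assign a b)].
Proof.
move=> dR bD CD; apply: (definable_pre dR CD) => -[v|w]; first by left; exists v.
by right; exists (b w) => //; apply: bD; exists w.
Qed.

Lemma definable_unfiber (C : set M) V W (S : set (V -> M)) (b : W -> M) :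
  definable (range b `|` C) S ->
  exists2 R : set (V + W -> M), definable C R & forall a, S a <-> R (join_assign a b).
Proof.
move=> [p pP].
have h (x : range b `|` C) : exists y : W + C, join_assign b (fun c : C => set_val c) y = set_val x.
  case: (set_val_in x) => [[w _ e]|Cx]; first by exists (inl w).
  by exists (inr (sub_elt Cx)).
have [g gE] := choice h.
pose ren (x : V + (range b `|` C)) : (V + W) + C := match x with
  | inl v => inl (inl v)
  | inr x => match g x with inl w => inl (inr w) | inr c => inr c end end.
exists [set a | sat (pval a) (rename ren p)]; first by exists (rename ren p).
move=> a /=; rewrite sat_rename pP.
suff -> : pval (C := range b `|` C) a = pval (C := C) (join_assign a b) \o ren by [].
apply: funext => -[v|x] //=; rewrite -(gE x) /ren.
by case: (g x).
Qed.

Lemma same_type_join (C : set M) V W (a a' : V -> M) (b : W -> M) :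
  same_type (range b `|` C) a a' <-> same_type C (join_assign a b) (join_assign a' b).
Proof.
split=> H S dS.
  by apply: (H [set a : V -> M | S (join_assign a b)]); apply: (definable_fiber dS) => x ?; [left|right].
by have [R dR RE] := definable_unfiber dS; rewrite !RE; apply: H.
Qed.

Lemma definable_pformula (C : set M) V (S : set (V -> M)) : definable C S ->
  exists2 phi : pformula M V, Defs.over C phi & forall a, S a <-> psat a phi.
Proof.
move=> dS; have : definable (C `|` set0) S by rewrite setU0.
move=> /definable_finite[n [m [R [Cm [p pP] RE]]]].
pose ren (x : (V + 'I_n) + (set0 : set M)) : V + 'I_n := match x with
  | inl y => y | inr c => False_rect _ (set_val_in c) end.
exists (PFormula (rename ren p) m) => // a'.
rewrite /psat /= sat_rename RE pP.
suff -> : pval (C := set0) (join_assign a' m) = join_assign a' m \o ren by [].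
by apply: funext => -[v|c] //; case: (set_val_in c).
Qed.

Lemma definable_psat (C : set M) V (phi : pformula M V) :
  Defs.over C phi -> definable C [set a : V -> M | psat a phi].
Proof.
move=> oC; apply: (definable_fiber (b := @pf_param _ _ _ phi) (D := C)
  (@definable_formula _ _ C _ (pf_formula phi))) => //.
by move=> x [i _ <-]; apply: oC.
Qed.

Lemma tuple_equivE (C : set M) V (a b : V -> M) : tuple_equiv C a b <-> same_type C a b.
Proof.
split=> [ab S dS|ab]; last first.
  apply/seteqP; split=> phi [oC aphi]; split=> //.
    exact: ab (definable_psat oC) aphi.
  exact: (same_type_sym ab) (definable_psat oC) aphi.
have [phi oC psatE] := definable_pformula dS.
rewrite !psatE => h; have : tp a C phi by [].
by rewrite ab => -[].
Qed.

End Automorphisms.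

Section Monster.
Variables (L : language) (K : Type) (M : structure L).
Hypothesis inaccK : strongly_inaccessible K.
Hypothesis satM : saturated K M.
Hypothesis homM : strongly_homogeneous K M.
Variable m0 : M.
Notation sm := (smallT K).

(** The map that fixes [C] and sends [a] to [b] is defined on the small set [C] together with
    [range a]. It is well defined because equalities among coordinates, and between coordinates and
    elements of [C], belong to the type. *)
Lemma homogeneous (C : set M) V (a b : V -> M) : sm C -> sm V -> same_type C a b ->
  exists2 s, automorphism_over C s & s \o a = b.
Proof.
move=> sC sV ab.
pose A := C `|` range a.
have aC v : C (a v) -> b v = a v.
  move=> Cav; apply: (ab [set x : V -> M | x v = a v]) => //.
  apply: (@definable_pre _ _ _ _ _ (V + unit) _ (fun x => join_assign x (fun=> a v))
    (@definable_eq _ M C (V + unit) (inl v) (inr tt))) => // -[w|[]].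
    by left; exists w.
  by right; exists (a v).
have aa v w : a v = a w -> b v = b w.
  by apply: (ab [set x : V -> M | x v = x w]); apply: definable_eq.
have h (x : A) : exists y : C + V,
    join_assign (fun c : C => set_val c) a y = set_val x.
  by case: (set_val_in x) => [Cx|[v _ e]]; [exists (inl (sub_elt Cx))|exists (inr v)].
have [g gE] := choice h.
pose f (x : A) := join_assign (fun c : C => set_val c) b (g x).
have sA : small K A.
  by apply/smallE => //; apply: smallT_setU => //; apply: smallT_range.
have [|s as_ sE] := homM (f := f) sA.
  apply/tuple_equivE => S dS Sval.
  apply: (ab [set a' : V -> M | S (fun x => join_assign (fun c : C => set_val c) a' (g x))]).
    apply: (definable_pre dS) => // x; case: (g x) => [c|v]; last by left; exists v.
    by right; exists (set_val c) => //; apply: set_val_in.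
  by congr S: Sval; apply: funext => x; rewrite gE.
have fE (x : A) : s (set_val x) = f x by exact: sE.
exists s.
  split=> // c Cc; have := fE (sub_elt (or_introl Cc : A c)).
  rewrite set_val_sub => ->; rewrite /f.
  have := gE (sub_elt (or_introl Cc : A c)); rewrite set_val_sub.
  by case: (g _) => [c'|v] //= e; rewrite aC e.
apply: funext => v /=.
have Av : A (a v) by right; exists v.
have := fE (sub_elt Av); rewrite set_val_sub => ->; rewrite /f.
have := gE (sub_elt Av); rewrite set_val_sub.
by case: (g _) => [c|w] //= e; [rewrite aC -?e //; apply: set_val_in|apply: aa].
Qed.

End Monster.

(** * Compactness and small models *)

Section SmallFormulas.
Variables (L : language) (K : Type).
Hypothesis inaccK : strongly_inaccessible K.
Hypothesis countL : countable_language L.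
Notation sm := (smallT K).

Lemma smallT_fun_symb : sm (fun_symb L).
Proof.
have [/card_leE h _] := countL; apply: smallT_emb (smallT_nat inaccK).
apply: emb_trans (emb_setT _) _; apply: emb_trans h _; exact: emb_set.
Qed.

Lemma smallT_rel_symb : sm (rel_symb L).
Proof.
have [_ /card_leE h] := countL; apply: smallT_emb (smallT_nat inaccK).
apply: emb_trans (emb_setT _) _; apply: emb_trans h _; exact: emb_set.
Qed.

Fixpoint term_level (X : Type) (n : nat) (t : term L X) : Prop :=
  match n, t with
  | 0, _ => False
  | n.+1, Var _ => True
  | n.+1, App f ts => forall i, term_level n (ts i)
  end.

Lemma term_level_mono X n m (t : term L X) : n <= m -> term_level n t -> term_level m t.
Proof.
elim: n m t => // n IH [|m] // [x|f ts] //= nm h i; exact: IH (h i).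
Qed.

Lemma ord_bound r (P : 'I_r -> nat -> Prop) :
  (forall i n m, n <= m -> P i n -> P i m) -> (forall i, exists n, P i n) ->
  exists n, forall i, P i n.
Proof.
move=> mono /choice[f fP]; exists (\max_i f i) => i.
by apply: mono (fP i); apply: leq_bigmax.
Qed.

Lemma term_level_ex X (t : term L X) : exists n, term_level n t.
Proof.
elim: t => [x|f ts IH]; first by exists 1.
have [|n nP] := @ord_bound _ (fun i n => term_level n (ts i)) _ IH.
  by move=> i n m; apply: term_level_mono.
by exists n.+1.
Qed.

Lemma smallT_cover T (P : nat -> set T) :
  (forall x, exists n, P n x) -> (forall n, sm (P n)) -> sm T.
Proof.
move=> ex sP.
apply: smallT_emb (@smallT_bigcup K inaccK nat T setT P _ _).
- apply: emb_trans (emb_setT _) _; apply: emb_sub => x _.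
  by have [n Pn] := ex x; exists n.
- exact/smallT_setT/smallT_nat.
- by [].
Qed.

Lemma smallT_term X : sm X -> sm (term L X).
Proof.
move=> sX; apply: (@smallT_cover _ (fun n => [set t | term_level n t])).
  exact: term_level_ex.
elim=> [|n IH].
  apply: smallT_sub (smallT_set0 inaccK _) => //.
pose D := (X + {f : fun_symb L & 'I_(fun_arity f) -> [set t : term L X | term_level n t]})%type.
have sD : sm D.
  apply: smallT_sum => //; apply: smallT_sigma => //; first exact: smallT_fun_symb.
  by move=> f; apply: smallT_fun => //; apply: smallT_countable.
pose F (d : D) : term L X := match d with inl x => Var L x
  | inr p => App (fun i => set_val (projT2 p i)) end.
apply: smallT_sub (smallT_range F sD) => -[x _|f ts /= h]; first by exists (inl x).
by exists (inr (existT _ f (fun i => sub_elt (h i : [set t | term_level n t] _)))).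
Qed.

(** Formulas are counted by height. The height precedes the variable type because [All] passes from
    [X] to [option X]. *)
Fixpoint formula_level (n : nat) : forall X : Type, formula L X -> Prop :=
  match n with
  | 0 => fun _ _ => False
  | n.+1 => fun X p => match p with
    | Imp p q => formula_level n p /\ formula_level n q
    | All p => formula_level n p
    | _ => True
    end
  end.

Lemma formula_level_mono n m X (p : formula L X) :
  n <= m -> formula_level n p -> formula_level m p.
Proof.
elim: n m X p => // n IH [|m] // X [|t1 t2|r ts|p q|p] //= nm; last exact: IH.
by move=> [h1 h2]; split; apply: IH nm _.
Qed.

Lemma formula_level_ex X (p : formula L X) : exists n, formula_level n p.
Proof.
elim: p => {X} [X|X t1 t2|X r ts|X p [n np] q [m mq]|X p [n np]]; try by exists 1.
  exists (maxn n m).+1; split; [apply: formula_level_mono np|apply: formula_level_mono mq].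
    exact: leq_maxl.
  exact: leq_maxr.
by exists n.+1.
Qed.

Lemma smallT_formula X : sm X -> sm (formula L X).
Proof.
move=> sX; apply: (@smallT_cover _ (fun n => [set p | formula_level n p])).
  exact: formula_level_ex.
move=> n; elim: n X sX => [|n IH] X sX.
  by apply: smallT_sub (smallT_set0 inaccK _).
have sT := smallT_term sX.
pose lev Y := [set p : formula L Y | formula_level n p].
pose D := ((unit + term L X * term L X) +
  ({r : rel_symb L & 'I_(rel_arity r) -> term L X} + (lev X * lev X + lev (option X))))%type.
have sD : sm D.
  apply: smallT_sum => //; first apply: smallT_sum => //.
  - exact: smallT_countable.
  - exact: smallT_prod.
  apply: smallT_sum => //; last apply: smallT_sum => //.
  - apply: smallT_sigma => //; first exact: smallT_rel_symb.
    by move=> f; apply: smallT_fun => //; apply: smallT_countable.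
  - by apply: smallT_prod => //; apply: IH.
  - by apply: IH; apply: smallT_option.
pose F (d : D) : formula L X := match d with
  | inl (inl _) => Bot | inl (inr p) => Equal p.1 p.2
  | inr (inl p) => Rel (projT2 p)
  | inr (inr (inl p)) => Imp (set_val p.1) (set_val p.2)
  | inr (inr (inr p)) => All (set_val p) end.
apply: smallT_sub (smallT_range F sD) => -[_|t1 t2 _|r ts _|p q /= [pn qn]|p /= pn].
- by exists (inl (inl tt)).
- by exists (inl (inr (t1, t2))).
- by exists (inr (inl (existT _ r ts))).
- by exists (inr (inr (inl (sub_elt (pn : lev X p), sub_elt (qn : lev X q))))).
- by exists (inr (inr (inr (sub_elt (pn : lev (option X) p))))).
Qed.

Lemma smallT_definable (M : structure L) (C : set M) V : sm C -> sm V ->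
  sm [set S : set (V -> M) | definable C S].
Proof.
move=> sC sV.
have sF : sm (formula L (V + C)) by apply: smallT_formula; apply: smallT_sum.
apply: smallT_sub (smallT_range (fun p => [set a : V -> M | sat (pval a) p]) sF).
move=> S [p pP]; exists p => //.
by apply: funext => a; apply/propext; rewrite pP.
Qed.

End SmallFormulas.

Section ElementarySubstructures.
Variables (L : language) (M : structure L).
Variable m0 : M.

Definition tarski_vaught (N : set M) : Prop := forall S : set (unit -> M),
  definable N S -> (exists a, S a) -> exists2 a, S a & N (a tt).

Lemma tarski_vaught_elementary N : tarski_vaught N -> elementary_substructure N.
Proof.
move=> tv.
have hN : fun_closed N.
  move=> f ts Nts.
  pose p : formula L (unit + 'I_(fun_arity f)) :=
    Equal (Var L (inl tt)) (App (fun i => Var L (inr i))).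
  have dS : definable N [set a : unit -> M | sat (join_assign a ts) p].
    apply: (definable_fiber (D := N) (b := ts) (@definable_formula _ M N _ p)) => //.
    by move=> x [i _ <-].
  have [|a /= e Na] := tv _ dS; first by exists (fun=> fun_int ts).
  by rewrite -e.
have ev X (e : X -> N) t :
    set_val (eval (M := substructure hN) e t) = eval (fun x => set_val (e x)) t.
  elim: t => //= f ts IHt.
  transitivity (fun_int (fun i => set_val (eval (M := substructure hN) e (ts i)))) => //.
  by congr fun_int; apply: funext => i; apply: IHt.
exists hN => X p; elim: p => {X} [X|X t1 t2|X r ts|X p IHp q IHq|X p IH] e //=.
- by rewrite -!ev; split=> [->//|/set_val_inj].
- suff <- : (fun i => set_val (eval (M := substructure hN) e (ts i))) =
    (fun i => eval (fun x => set_val (e x)) (ts i)) by [].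
  by apply: funext => i; apply: ev.
- by rewrite IHp IHq.
- have E (u : N) : (fun x => set_val (extend e u x)) = extend (fun x => set_val (e x)) (set_val u).
    by apply: funext => -[].
  split=> H u; last by apply/IH; rewrite E; apply: H.
  apply: contrapT => nu.
  have [||a /= na Na] := tv [set a : unit -> M |
      ~ sat (extend (fun x => set_val (e x)) (a tt)) p].
  - apply: definableC; apply: (@definable_pre _ _ N N unit (option X) [set a : option X -> M | sat a p]
      (fun a => extend (fun x => set_val (e x)) (a tt)) (definable_formula _ _)) => // -[x|].
      by right; exists (set_val (e x)) => //; apply: set_val_in.
    by left; exists tt.
  - by exists (fun=> u).
  by apply: na; have /IH := H (sub_elt Na); rewrite E set_val_sub.
Qed.

Lemma elementary_realised N V (S : set (V -> M)) : elementary_substructure N ->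
  definable N S -> (exists a, S a) -> exists2 a, S a & forall v, N (a v).
Proof.
move=> [hN elem] [p pP] [a Sa].
(* The projection formula is evaluated in the substructure too, which must therefore be
   inhabited. *)
have [n0 _] : exists n : substructure hN, True.
  pose q : formula L void := Ex (Equal (Var L None) (Var L None)).
  have [_ H] := elem _ q (fun v => match v with end).
  have /H /sat_Ex[u _] : sat (fun x : void => set_val (match x with end : N)) q.
    by apply/sat_Ex; exists m0.
  by exists u.
pose ren (x : V + N) : N + V := match x with inl v => inr v | inr n => inl n end.
have [q qP] := proj_formula (rename ren p).
have : sat (fun x : N => set_val x) q.
  apply/(qP M m0); exists a; rewrite sat_rename.
  have /pP := Sa; congr sat; by apply: funext => -[].
move=> /(elem _ q id)/(qP _ n0)[h].
move=> /(elem _ (rename ren p)); rewrite sat_rename => H.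
exists (fun v => set_val (h v)); last by move=> v; apply: set_val_in.
rewrite pP; suff -> : pval (C := N) (fun v => set_val (h v)) =
  (fun x => set_val (join_assign id h x : N)) \o ren by [].
by apply: funext => -[].
Qed.

Lemma definable_image (s : M -> M) (C : set M) V (S : set (V -> M)) : automorphism s ->
  definable (s @` C) S -> definable C [set a : V -> M | S (s \o a)].
Proof.
move=> aut [p pP].
have h (x : s @` C) : exists c : C, s (set_val c) = set_val x.
  by have [c Cc e] := set_val_in x; exists (sub_elt Cc).
have [g gE] := choice h.
pose ren (x : V + (s @` C)) : V + C := match x with inl v => inl v | inr c => inr (g c) end.
exists (rename ren p) => a; rewrite /= pP sat_rename.
rewrite (sat_automorphism p (pval a \o ren) aut).
suff -> : pval (C := s @` C) (s \o a) = s \o (pval a \o ren) by [].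
by apply: funext => -[v|c] //=; rewrite gE.
Qed.

Lemma elementary_image (s : M -> M) N : automorphism s ->
  elementary_substructure N -> elementary_substructure (s @` N).
Proof.
move=> aut elN; apply: tarski_vaught_elementary => S dS [a Sa].
have as0 : automorphism_over set0 s by split.
have [t [[aut_t _] st ts]] := automorphism_over_inv as0.
have [|b Sb Nb] := elementary_realised elN (definable_image aut dS).
  by exists (t \o a) => /=; congr S: Sa; apply: funext => x /=; rewrite ts.
by exists (s \o b) => //; exists (b tt).
Qed.

End ElementarySubstructures.

Section Compactness.
Variables (L : language) (K : Type) (M : structure L).
Hypothesis inaccK : strongly_inaccessible K.
Hypothesis countL : countable_language L.
Hypothesis satM : saturated K M.
Variable m0 : M.
Notation sm := (smallT K).

Lemma lowenheim_skolem (X : set M) : sm X ->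
  exists N : set M, [/\ X `<=` N, sm N & elementary_substructure N].
Proof.
move=> sX.
pose wit (S : set (unit -> M)) : M := if pselect (exists a, S a) is left h
  then projT1 (cid h) tt else m0.
pose next N := N `|` (wit @` [set S | definable N S]).
pose N := fix N n := if n is n.+1 then next (N n) else X.
have sN n : sm (N n).
  elim: n => //= n IH; apply: smallT_setU => //.
  have sD := smallT_definable inaccK countL IH (smallT_countable inaccK unit).
  have -> : wit @` [set S | definable (N n) S] =
      range (fun S : [set S : set (unit -> M) | definable (N n) S] => wit (set_val S)).
    apply/seteqP; split=> x [S].
      by move=> dS <-; exists (sub_elt (dS : [set S | definable (N n) S] S)).
    by move=> _ <-; exists (set_val S) => //; apply: set_val_in.
  exact: smallT_range.
have mono n m : n <= m -> N n `<=` N m.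
  by move=> /subnK <-; elim: (m - n) => // k IH x /IH; left.
exists (\bigcup_n N n); split.
- by move=> x Xx; exists 0.
- apply: smallT_bigcup => //; exact/smallT_setT/smallT_nat.
apply: tarski_vaught_elementary => S dS exS.
have : definable ((\bigcup_n N n) `|` set0) S by rewrite setU0.
move=> /definable_finite[r [m [R [Nm dR RE]]]].
have [||n nP] := @ord_bound r (fun i n => N n (m i)).
- by move=> i n k nk; apply: mono.
- by move=> i; have [n _ h] := Nm i; exists n.
have dSn : definable (N n) S.
  apply: definable_ext RE _; apply: (definable_fiber dR) => // x [i _ <-]; exact: nP.
case: (exS) => a Sa.
have [b Sb be] : exists2 b, S b & b tt = wit S.
  by rewrite /wit; case: pselect => // h; exists (projT1 (cid h)) => //; apply: projT2.
exists b => //; exists n.+1 => //=; right; exists S => //.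
Qed.

Lemma list_max T (lt : T -> T -> Prop)
    (tot : forall x y, [\/ lt x y, x = y | lt y x])
    (tr : forall x y z, lt x y -> lt y z -> lt x z) (P : T -> Prop) (l : list T) :
  (forall x, List.In x l -> ~ P x) \/
  exists m, [/\ List.In m l, P m & forall x, List.In x l -> P x -> lt x m \/ x = m].
Proof.
elim: l => [|y l IH]; first by left.
have [Py|nPy] := pselect (P y); last first.
  case: IH => [IH|[m [ml Pm mP]]]; first by left => x /= [<-|/IH].
  by right; exists m; split; [right| |move=> x /= [<- //|]; apply: mP].
right; case: IH => [IH|[m [ml Pm mP]]].
  exists y; split; [by left|by []|] => x /= [<-|/IH //]; by right.
case: (tot y m) => [ym|ym|my].
- by exists m; split; [right| |move=> x /= [<-|]; [left|apply: mP]].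
- by exists m; split; [right| |move=> x /= [<-|]; [right|apply: mP]].
- exists y; split; [by left|by []|] => x /= [<-|xl Px]; first by right.
  by left; case: (mP x xl Px) => [xm|->//]; apply: tr my.
Qed.

Lemma definableAllList C V T (P : T -> set (V -> M)) (l : list T) :
  (forall t, definable C (P t)) -> definable C [set a : V -> M | forall t, List.In t l -> P t a].
Proof.
move=> dP; elim: l => [|t l IH].
  by apply: definable_ext (definableTrue _ _ True) => a; split=> // _ t [].
apply: definable_ext (definableAnd (dP t) IH) => a; split=> [h|[h1 h2] u /= [<-|/h2] //].
by split=> [|u ul]; apply: h; [left|right].
Qed.

(* By recursion along [K], choose the values of the variables one after the other. *)
Theorem compactness (X T : Type) (C : set M) (P : T -> set (X -> M)) :
  emb X K -> sm C -> (forall t, definable C (P t)) ->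
  (forall l : list T, exists a, forall t, List.In t l -> P t a) ->
  exists a, forall t, P t a.
Proof.
move=> [iota ii] sC dP fs.
have [lt0 io] := initial_order_exists K.
pose lt x y := lt0 (iota x) (iota y).
have tot x y : [\/ lt x y, x = y | lt y x].
  by case: (io_total io (iota x) (iota y)) => [h|/ii h|h];
    [constructor 1|constructor 2|constructor 3].
have tr x y z : lt x y -> lt y z -> lt x z by exact: (io_trans io).
have irr x : ~ lt x x by exact: (io_irr io).
have wf : well_founded lt.
  have A : forall z x, z = iota x -> Acc lt x.
    elim/(well_founded_ind (io_wf io)) => z IH x e; constructor => y yx.
    by apply: IH (erefl _); rewrite e.
  by move=> x; apply: A (erefl _).
have sseg x : sm [set y | lt y x].
  apply: smallT_emb (io_small io (iota x)); apply: (@emb_map _ _ _ _ iota) => // y z _ _.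
  exact: ii.
pose U l x f u := exists a : X -> M, [/\ forall y, lt y x -> a y = f y, a x = u &
  forall t, List.In t l -> P t a].
pose Pc x f u := forall l, U l x f u.
(* Finitely many conditions involve finitely many variables. The invariant at the greatest of these
   below [x] gives a solution that agrees with [f] on all of them, and the other values below [x]
   may be overwritten by [f]. *)
have patch (l : list T) (x : X) (f : X -> M) : (forall y, lt y x -> Pc y f (f y)) ->
    exists a : X -> M, (forall y, lt y x -> a y = f y) /\ forall t, List.In t l -> P t a.
  move=> IH.
  have [s sP] := definable_supp (definableAllList (C := C) l dP).
  have [a al as_] : exists2 a, (forall t, List.In t l -> P t a) &
      forall y, List.In y s -> lt y x -> a y = f y.
    have [n|[m [ml mx mP]]] := list_max tot tr (fun y => lt y x) s.
      by have [a al] := fs l; exists a => // y /n.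
    have [a [a1 a2 a3]] := IH m mx l; exists a => // y ys yx.
    by case: (mP y ys yx) => [ym|->//]; apply: a1.
  exists (fun y => if pselect (lt y x) then f y else a y); split.
    by move=> y yx; case: pselect.
  apply: (sP a) => // y ys; case: pselect => //; exact: as_.
have [|x f IH|f Pf] := @wf_choice X M lt wf m0 Pc _ _.
- move=> x f g u fg Pf l; have [a [a1 a2 a3]] := Pf l; exists a; split=> // y yx.
  by rewrite -fg // a1.
- pose fr := fun y : [set y | lt y x] => f (set_val y).
  pose C' := range fr `|` C.
  have sC' : sm C' by apply: smallT_setU => //; apply: smallT_range.
  (* Solvability of [l] becomes a condition on the value at [x] alone, over [C] and the values
     chosen so far. Initial segments are small, so saturation applies. *)
  have dU l : definable C' [set a : unit -> M | U l x f (a tt)].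
    pose asm (e : ([set y | lt y x] + unit) + X -> M) y :=
      match pselect (lt y x) with
      | left h => e (inl (inl (sub_elt (h : [set y | lt y x] y))))
      | right _ => if pselect (y = x) then e (inl (inr tt)) else e (inr y) end.
    have casm : coordwise C' asm.
      move=> y; left; rewrite /asm; case: pselect => [h|_].
        by exists (inl (inl (sub_elt (h : [set y | lt y x] y)))).
      by case: (pselect (y = x)) => ?; [exists (inl (inr tt))|exists (inr y)].
    have d1 := definable_proj m0 (definable_pre (definableAllList (C := C) l dP) (@subsetUr _ _ _) casm).
    have [|p pP] := @definable_pre _ _ _ C' _ _ _ (fun a : unit -> M => join_assign fr a) d1
        (@subset_refl _ _).
      by move=> [y|[]]; [right; exists (fr y) => //; left; exists y|left; exists tt].
    exists p => a; rewrite -pP /=; split=> [[b [b1 b2 b3]]|[h hP]].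
      exists b => t tl; suff -> : asm (join_assign (join_assign fr a) b) = b by apply: b3.
      apply: funext => y; rewrite /asm; case: pselect => [yx|_] /=; first by rewrite b1.
      by case: pselect => [yx|] //=; rewrite yx b2.
    exists (asm (join_assign (join_assign fr a) h)); split=> //.
      by move=> y yx; rewrite /asm; case: pselect.
    rewrite /asm; case: pselect => [/irr //|_]; by case: pselect.
  pose p := [set phi : pformula M unit | Defs.over C' phi /\
    exists l, forall a, psat a phi <-> U l x f (a tt)].
  have [|||a aP] := satM (C := C') (p := p).
  - exact/smallE.
  - by move=> phi [].
  - move=> q qp fq; have [s sE] := (finite_seqP (q : set {classic pformula M unit})).1 fq.
    have [l lP] : exists l, forall phi, phi \in (s : seq {classic pformula M unit}) ->
        forall a, U l x f (a tt) -> psat a phi.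
      have : forall phi, phi \in (s : seq {classic pformula M unit}) -> p phi.
        by move=> phi phis; apply: qp; rewrite sE.
      elim: s {sE} => [|phi s IHs] ps; first by exists nil.
      have [|l lP] := IHs; first by move=> psi h; apply: ps; rewrite inE h orbT.
      have [|_ [l' l'P]] := ps phi; first by rewrite inE eqxx.
      have sub l1 l2 u : (forall t, List.In t l2 -> List.In t l1) -> U l1 x f u -> U l2 x f u.
        by move=> h [a [a1 a2 a3]]; exists a; split=> // t /h; apply: a3.
      exists (l' ++ l) => psi; rewrite inE => /orP[/eqP ->|h] a Ua.
        by apply/l'P; apply: sub Ua => t tl; apply/List.in_or_app; left.
      by apply: lP => //; apply: sub Ua => t tl; apply/List.in_or_app; right.
    have [a [a1 a2]] := patch l x f IH.
    exists (fun=> a x) => phi; rewrite sE => /lP; apply; by exists a.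
  exists (a tt) => l.
  have [phi oC phiP] := definable_pformula (dU l).
  by apply/phiP/aP; split=> //; exists l => b; rewrite -phiP.
- exists f => t.
  have [s sP] := definable_supp (dP t).
  have [n|[m [ml _ mP]]] := list_max tot tr (fun=> True) s.
    have [a aP] := fs [:: t]; apply: (sP a); last by apply: aP; left.
    by move=> y /n.
  have [a [a1 a2 a3]] := Pf m [:: t].
  apply: (sP a); last by apply: a3; left.
  by move=> y ys; case: (mP y ys I) => [|->//]; apply: a1.
Qed.

End Compactness.

(** * Dividing and forking of tuples *)

Section Dividing.
Variables (L : language) (K : Type) (M : structure L).

(* Dividing of a definable set, witnessed by automorphisms instead of a sequence of
   realisations of the type of its parameters: [S (tau i \o a)] says that [a] is
   in the image of [S] under the inverse of [tau i]. *)
Definition divides_by (C : set M) V (k : nat) (S : set (V -> M)) : Prop :=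
  exists tau : nat -> M -> M, (forall i, automorphism_over C (tau i)) /\
    forall s : 'I_k -> nat, injective s ->
      ~ exists a : V -> M, forall j, S (tau (s j) \o a).

Definition divides_set (C : set M) V (S : set (V -> M)) : Prop := exists k, divides_by C k S.

Definition forks_set (C : set M) V (S : set (V -> M)) : Prop :=
  exists l : list (set (V -> M)),
    (forall Q, List.In Q l -> definable setT Q /\ divides_set C Q) /\
    forall a, S a -> exists2 Q, List.In Q l & Q a.

Definition nondiv V (a : V -> M) (C B : set M) : Prop :=
  forall S, definable (B `|` C) S -> S a -> ~ divides_set C S.

Definition nonfork V (a : V -> M) (C B : set M) : Prop :=
  forall S, definable (B `|` C) S -> S a -> ~ forks_set C S.

Lemma divides_by_sub C V k (S S' : set (V -> M)) : S' `<=` S ->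
  divides_by C k S -> divides_by C k S'.
Proof.
move=> SS [tau [tauC tauk]]; exists tau; split=> // s si [a aP].
by apply: tauk si _; exists a => j; apply: SS.
Qed.

Lemma divides_by_mono (C D : set M) V k (S : set (V -> M)) : C `<=` D ->
  divides_by D k S -> divides_by C k S.
Proof.
move=> CD [tau [tauD tauk]]; exists tau; split=> // i.
exact: automorphism_over_mono CD (tauD i).
Qed.

Lemma divides_set_sub C V (S S' : set (V -> M)) : S' `<=` S -> divides_set C S -> divides_set C S'.
Proof. by move=> SS [k h]; exists k; apply: divides_by_sub h. Qed.

Lemma divides_set_mono (C D : set M) V (S : set (V -> M)) : C `<=` D -> divides_set D S -> divides_set C S.
Proof. by move=> CD [k h]; exists k; apply: divides_by_mono h. Qed.

Lemma divides_set_comp C V W (f : W -> V) (S : set (W -> M)) :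
  divides_set C S -> divides_set C [set a : V -> M | S (a \o f)].
Proof.
move=> [k [tau [tauC tauk]]]; exists k, tau; split=> // s si [a aP].
by apply: tauk si _; exists (a \o f).
Qed.

Lemma forks_set_sub C V (S S' : set (V -> M)) : S' `<=` S -> forks_set C S -> forks_set C S'.
Proof. by move=> SS [l [l1 l2]]; exists l; split=> // a /SS /l2. Qed.

Lemma forks_set_mono (C D : set M) V (S : set (V -> M)) : C `<=` D -> forks_set D S -> forks_set C S.
Proof.
move=> CD [l [l1 l2]]; exists l; split=> // Q /l1[dQ h]; split=> //.
exact: divides_set_mono h.
Qed.

Lemma divides_set_forks_set C V (S : set (V -> M)) : definable setT S -> divides_set C S -> forks_set C S.
Proof.
move=> dS h; exists [:: S]; split=> [Q [<-|[]] //|a Sa].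
by exists S => //; left.
Qed.

Lemma nonfork_nondiv V (a : V -> M) C B : nonfork a C B -> nondiv a C B.
Proof.
move=> h S dS Sa ds; apply: (h S) => //; apply: divides_set_forks_set => //.
exact: definable_mono dS.
Qed.

Lemma nondiv_mono V (a : V -> M) C C' B B' : C `<=` C' -> B' `|` C' `<=` B `|` C ->
  nondiv a C B -> nondiv a C' B'.
Proof.
move=> CC BC h S dS Sa ds; apply: (h S) => //; first exact: definable_mono dS.
exact: divides_set_mono ds.
Qed.

Lemma nonfork_mono V (a : V -> M) C C' B B' : C `<=` C' -> B' `|` C' `<=` B `|` C ->
  nonfork a C B -> nonfork a C' B'.
Proof.
move=> CC BC h S dS Sa ds; apply: (h S) => //; first exact: definable_mono dS.
exact: forks_set_mono ds.
Qed.

Lemma nondiv_comp V W (f : W -> V) (a : V -> M) C B : nondiv a C B -> nondiv (a \o f) C B.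
Proof.
move=> h S dS Sa ds; apply: (h [set a : V -> M | S (a \o f)]) => //.
  by apply: (definable_pre dS) => // w; left; exists (f w).
exact: divides_set_comp.
Qed.

Lemma nondiv_same_type V (a a' : V -> M) C B : same_type (B `|` C) a a' -> nondiv a C B -> nondiv a' C B.
Proof. by move=> /same_type_sym e h S dS /(e _ dS); apply: h. Qed.

Lemma comp_join (s : M -> M) V W (a : V -> M) (b : W -> M) :
  s \o join_assign a b = join_assign (s \o a) (s \o b).
Proof. by apply: funext => -[]. Qed.

Lemma definable_move (C : set M) V W (R : set (V + W -> M)) (s t : M -> M) (a : V -> M) (b : W -> M) :
  definable C R -> automorphism_over C s -> cancel s t ->
  R (join_assign (s \o a) b) <-> R (join_assign a (t \o b)).
Proof.
move=> dR sC st.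
have [t' [t'C st' ts']] := automorphism_over_inv sC.
have tt' : t = t' by apply: funext => x; rewrite -{1}(ts' x) st.
rewrite (definable_automorphism (join_assign a (t \o b)) sC dR) comp_join.
by have -> : s \o (t \o b) = b by apply: funext => x /=; rewrite tt' ts'.
Qed.

Lemma divides_by_conj (C : set M) V W k (R : set (V + W -> M)) (b : W -> M) s :
  definable C R -> automorphism_over C s ->
  divides_by C k [set a : V -> M | R (join_assign a b)] ->
  divides_by C k [set a : V -> M | R (join_assign a (s \o b))].
Proof.
move=> dR sC [tau [tauC tauk]].
have [t [tC st ts]] := automorphism_over_inv sC.
exists (fun i => s \o (tau i \o t)); split=> [i|u ui [a aP]].
  by apply: automorphism_over_comp => //; apply: automorphism_over_comp.
apply: (tauk u ui); exists (t \o a) => j.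
by have /(definable_move _ _ dR sC st) := aP j; rewrite compA (_ : t \o s = id) //; apply: funext.
Qed.

End Dividing.

Lemma list_in_nth T (x0 : T) (l : list T) (i : 'I_(size l)) : List.In (nth x0 l i) l.
Proof.
case: i => i /=; elim: l i => //= x l IH [|i] il; first by left.
by right; apply: IH.
Qed.

Section MonsterDividing.
Variables (L : language) (K : Type) (M : structure L).
Hypothesis inaccK : strongly_inaccessible K.
Hypothesis countL : countable_language L.
Hypothesis satM : saturated K M.
Hypothesis homM : strongly_homogeneous K M.
Variable m0 : M.
Notation sm := (smallT K).

Lemma small_emb X : sm X -> emb X K.
Proof. by move=> [sX]; case: (emb_total X K). Qed.

(** Homogeneity trades conjugates of [b] for automorphisms. These move the realisation and not the
    parameters, whence the inverses. *)
Lemma divides_byE (C : set M) V W k (R : set (V + W -> M)) (b : W -> M) :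
  sm C -> sm W -> definable C R ->
  divides_by C k [set a : V -> M | R (join_assign a b)] <->
  exists b' : nat -> W -> M, (forall i, same_type C b (b' i)) /\
    forall s : 'I_k -> nat, injective s ->
      ~ exists a : V -> M, forall j, R (join_assign a (b' (s j))).
Proof.
move=> sC sW dR; split=> [[tau [tauC tauk]]|[b' [b'C b'k]]].
  pose t i := projT1 (cid (automorphism_over_inv (tauC i))).
  have tP i : [/\ automorphism_over C (t i), cancel (tau i) (t i) & cancel (t i) (tau i)].
    exact: projT2 (cid (automorphism_over_inv (tauC i))).
  exists (fun i => t i \o b); split=> [i|s si [a aP]].
    by apply: same_type_automorphism; case: (tP i).
  apply: (tauk s si); exists a => j; have [_ st _] := tP (s j).
  exact/(definable_move _ _ dR (tauC _) st).
have h i : exists tau, automorphism_over C tau /\ tau \o b' i = b.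
  by have [tau ? ?] := homogeneous inaccK homM sC sW (same_type_sym (b'C i)); exists tau.
have [tau tauP] := choice h.
exists tau; split=> [i|s si [a aP]]; first by case: (tauP i).
apply: (b'k s si); exists a => j; have [tC tb] := tauP (s j).
have [t [_ st _]] := automorphism_over_inv tC.
have /(definable_move _ _ dR tC st) := aP j; rewrite -tb.
by rewrite (_ : t \o (tau (s j) \o b' (s j)) = b' (s j)) //; apply: funext => w /=; rewrite st.
Qed.

Lemma realises_tp V (a a' : V -> M) C : realises a' (tp a C) <-> same_type C a a'.
Proof.
split=> [h S dS|h phi [oC aphi]].
  by have [phi oC phiP] := definable_pformula dS; rewrite !phiP => aphi; apply: h.
exact: h (definable_psat oC) aphi.
Qed.

(** By compactness, a type that implies [S] does so through one of its members. Dividing of a type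
    thus becomes dividing of a set that belongs to it. *)
Lemma type_implies V (a : V -> M) (D : set M) (S : set (V -> M)) :
  sm V -> sm D -> definable setT S -> (forall a', same_type D a a' -> S a') ->
  exists S0, [/\ definable D S0, S0 a & S0 `<=` S].
Proof.
move=> sV sD dS imp; apply: contrapT => nS.
have : definable (setT `|` set0) S by rewrite setU0.
move=> /definable_finite[n [m [R [_ dR RE]]]].
have {}dS : definable (range m `|` D) S.
  apply: definable_ext RE _; exact: (definable_fiber dR).
pose T := option [set S0 : set (V -> M) | definable D S0 /\ S0 a].
pose P (t : T) := if t is Some S0 then set_val S0 else [set a : V -> M | ~ S a].
have [||l|a' a'P] := @compactness _ _ _ inaccK satM m0 V T (range m `|` D) P (small_emb sV).
- apply: smallT_setU => //; apply: smallT_range; exact: smallT_countable.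
- move=> [S0|] /=; last exact: definableC.
  have [dS0 _] := set_val_in S0; apply: definable_mono dS0; exact: subsetUr.
- pose P' (t : T) := if t is Some S0 then set_val S0 else setT.
  have dP' t : definable D (P' t).
    case: t => [S0|] /=; first by have [] := set_val_in S0.
    by apply: definable_ext (definableTrue _ _ True).
  apply: contrapT => /forallNP n2; apply: nS.
  exists [set a' : V -> M | forall t, List.In t l -> P' t a']; split.
  + exact: definableAllList.
  + by move=> [S0|] _ //=; have [] := set_val_in S0.
  + move=> a' a'P; apply: contrapT => nSa'; apply: (n2 a') => -[S0|] // tl.
    exact: (a'P (Some S0)).
- apply: (a'P None); apply: imp => S0 dS0 S0a.
  exact: (a'P (Some (sub_elt (conj dS0 S0a : [set S0 | definable D S0 /\ S0 a] S0)))).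
Qed.

Lemma dividesE V (C : set M) (phi : pformula M V) : sm C ->
  divides C phi <-> divides_set C [set a | psat a phi].
Proof.
move=> sC; have dR := @definable_formula _ M C _ (pf_formula phi).
have E k := @divides_byE C V _ k _ (@pf_param _ _ _ phi) sC
  (smallT_countable inaccK _) dR.
split=> [[k [b [bC bk]]]|[k /E[b [bC bk]]]]; exists k.
  by apply/E; exists b; split=> // i; apply/realises_tp.
by exists b; split=> // i; apply/realises_tp.
Qed.

Lemma definable_setT_psat V (phi : pformula M V) : definable setT [set a | psat a phi].
Proof. exact: definable_psat. Qed.

Lemma forksE V (C : set M) (phi : pformula M V) : sm C ->
  forks C phi <-> forks_set C [set a | psat a phi].
Proof.
move=> sC; split=> [[m [chi [chid imp]]]|[l [l1 l2]]].
  exists (List.map (fun i => [set a | psat a (chi i)]) (enum 'I_m)); split.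
    move=> Q /List.in_map_iff[i [<- _]]; split; first exact: definable_setT_psat.
    exact/dividesE.
  move=> a /imp[i ai]; exists [set a | psat a (chi i)] => //.
  apply/List.in_map_iff; exists i; split=> //.
  have : i \in enum 'I_m by rewrite mem_enum.
  by elim: (enum _) => //= j s IHs; rewrite inE => /orP[/eqP ->|/IHs]; [left|right].
have h (i : 'I_(size l)) : exists psi : pformula M V, [set a | psat a psi] = nth setT l i.
  have [/definable_pformula[psi _ psiP] _] := l1 _ (list_in_nth setT i); exists psi.
  by apply: funext => a; apply/propext; rewrite psiP.
have [chi chiP] := choice h.
exists (size l), chi; split=> [i|a /l2[Q Ql Qa]].
  apply/dividesE => //; rewrite chiP.
  by have [] := l1 _ (list_in_nth setT i).
have [i ilt e] : exists2 i, i < size l & nth setT l i = Q.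
  elim: l Ql {l1 l2 h chi chiP} => //= Q' l IHl [->|/IHl[i il e]]; first by exists 0.
  by exists i.+1.
exists (Ordinal ilt); have := chiP (Ordinal ilt); rewrite /= e => E.
by have : [set a | psat a (chi (Ordinal ilt))] a by rewrite E.
Qed.

Lemma nondividingE (A C B : set M) : sm A -> sm C -> sm B ->
  nondividing A C B <-> nondiv (fun x : A => set_val x) C B.
Proof.
move=> sA sC sB; split=> [h S dS Sa dvS|h [phi [imp dphi]]].
  apply: h; have [phi oC phiP] := definable_pformula dS.
  exists phi; split.
    by move=> a ra; apply: ra; split=> //; apply/phiP.
  apply/dividesE => //; apply: divides_set_sub dvS => a; by move=> /phiP.
have [||S0 [dS0 S0a S0phi]] := @type_implies _ (fun x : A => set_val x) (B `|` C)
    [set a | psat a phi] sA _ (definable_setT_psat _).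
- exact: smallT_setU.
- by move=> a' /realises_tp; apply: imp.
apply: h dS0 S0a _; apply: divides_set_sub S0phi _; exact/dividesE.
Qed.

Lemma nonforkingE (A C B : set M) : sm A -> sm C -> sm B ->
  nonforking A C B <-> nonfork (fun x : A => set_val x) C B.
Proof.
move=> sA sC sB; split=> [h S dS Sa dvS|h [phi [imp dphi]]].
  apply: h; have [phi oC phiP] := definable_pformula dS.
  exists phi; split.
    by move=> a ra; apply: ra; split=> //; apply/phiP.
  apply/forksE => //; apply: forks_set_sub dvS => a; by move=> /phiP.
have [||S0 [dS0 S0a S0phi]] := @type_implies _ (fun x : A => set_val x) (B `|` C)
    [set a | psat a phi] sA _ (definable_setT_psat _).
- exact: smallT_setU.
- by move=> a' /realises_tp; apply: imp.
apply: h dS0 S0a _; apply: forks_set_sub S0phi _; exact/forksE.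
Qed.

(** Finite unions of forking sets fork, and no set in the type of [a] forks. Hence this type is
    finitely consistent with the complements of all forking sets over [D] and [C]. *)
Lemma nonfork_extension V (a : V -> M) (C B D : set M) : sm V -> sm C -> sm B -> sm D ->
  B `<=` D -> nonfork a C B -> exists a', same_type (B `|` C) a a' /\ nonfork a' C D.
Proof.
move=> sV sC sB sD BD nfa.
pose T := ([set S : set (V -> M) | definable (B `|` C) S /\ S a] +
  [set Q : set (V -> M) | definable (D `|` C) Q /\ forks_set C Q])%type.
pose P (t : T) := match t with inl S0 => set_val S0
  | inr Q => [set a : V -> M | ~ set_val Q a] end.
have [||l|a' a'P] := @compactness _ _ _ inaccK satM m0 V T (D `|` C) P (small_emb sV).
- exact: smallT_setU.
- move=> [S|Q] /=; last by apply: definableC; have [] := set_val_in Q.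
  by have [dS _] := set_val_in S; apply: definable_mono dS; apply: setSU.
- pose P' (t : T) := if t is inl S0 then set_val S0 else setT.
  have dP' t : definable (B `|` C) (P' t).
    case: t => [S|Q] /=; first by have [] := set_val_in S.
    by apply: definable_ext (definableTrue _ _ True).
  apply: contrapT => /forallNP n2.
  apply: (nfa [set a' : V -> M | forall t, List.In t l -> P' t a']).
  + exact: definableAllList.
  + by move=> [S|Q] _ //=; have [] := set_val_in S.
  have fl : forall l0 : list T, forks_set C [set a : V -> M | exists2 t, List.In t l0 &
      if t is inr Q then set_val Q a else False].
    elim=> [|t l0 [l1 [l1P l1c]]]; first by exists nil; split=> // a0 [].
    case: t => [S|Q].
      exists l1; split=> // a0 [t [<- //|tl h]]; apply: l1c; by exists t.
    have [_ [l2 [l2P l2c]]] := set_val_in Q.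
    exists (l2 ++ l1); split.
      by move=> Q' /List.in_app_iff[/l2P|/l1P].
    move=> a0 [t [<- /l2c|tl h]].
      by move=> [Q' ? ?]; exists Q' => //; apply/List.in_app_iff; left.
    have [|Q' ? ?] := l1c a0; first by exists t.
    by exists Q' => //; apply/List.in_app_iff; right.
  apply: forks_set_sub (fl l) => a' a'P; apply: contrapT => nh.
  apply: (n2 a') => -[S|Q] tl; first exact: (a'P (inl S)).
  by move=> Qa; apply: nh; exists (inr Q).
- exists a'; split=> [S dS Sa|Q dQ Qa' fQ].
    exact: (a'P (inl (sub_elt (conj dS Sa : [set S | definable (B `|` C) S /\ S a] S)))).
  exact: (a'P (inr (sub_elt (conj dQ fQ : [set Q | definable (D `|` C) Q /\ forks_set C Q] Q)))).
Qed.

End MonsterDividing.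

(** * Left transitivity and sequences *)

Section Transitivity.
Variables (L : language) (K : Type) (M : structure L).
Hypothesis inaccK : strongly_inaccessible K.
Hypothesis satM : saturated K M.
Hypothesis homM : strongly_homogeneous K M.
Variable m0 : M.
Notation sm := (smallT K).

Lemma list_nat_bound T (P : T -> nat -> Prop) (l : list T) :
  (forall t n m, n <= m -> P t n -> P t m) ->
  (forall t, List.In t l -> exists n, P t n) ->
  exists n, forall t, List.In t l -> P t n.
Proof.
move=> mono; elim: l => [|t l IH] ex; first by exists 0.
have [n nP] := IH (fun t tl => ex t (or_intror tl)).
have [m Pm] := ex t (or_introl erefl); exists (maxn n m) => u /= [<-|/nP].
  by apply: mono Pm; apply: leq_maxr.
by apply: mono; apply: leq_maxl.
Qed.

Lemma same_type_join_swap (C : set M) V W (a a' : V -> M) (b b' : W -> M) :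
  same_type C (join_assign a b) (join_assign a' b') -> same_type C (join_assign b a) (join_assign b' a').
Proof.
move=> /(@same_type_comp _ _ _ _ _ (fun x : W + V => match x with inl w => inr w | inr v => inl v end)).
have E (x : V -> M) (y : W -> M) : join_assign x y \o
    (fun x : W + V => match x with inl w => inr w | inr v => inl v end) = join_assign y x.
  by apply: funext => -[].
by rewrite !E.
Qed.

Lemma same_type_join_l (C : set M) V W (a a' : V -> M) (b b' : W -> M) :
  same_type C (join_assign a b) (join_assign a' b') -> same_type C a a'.
Proof. by move=> /(@same_type_comp _ _ _ _ _ inl). Qed.

Lemma range_set_val (B : set M) : range (fun x : B => set_val x) = B.
Proof.
apply/seteqP; split=> [x [y _ <-]|x Bx]; first exact: set_val_in.
by exists (sub_elt Bx).
Qed.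

(* A type that does not divide is consistent with a whole sequence witnessing
   that [S] divides; moving a realisation of it back to [d] turns the sequence
   into one over [C] and [d]. *)
Lemma divides_by_nondiv V U k (S : set (V -> M)) (d : U -> M) (C B : set M) :
  sm U -> sm C -> sm B -> definable (B `|` C) S -> divides_by C k S -> nondiv d C B ->
  divides_by (C `|` range d) k S.
Proof.
move=> sU sC sB dS dvS ndd.
pose b := fun x : B => set_val x.
have rb : range b = B by exact: range_set_val.
have [R dR RE] : exists2 R, definable C R & forall a, S a <-> R (join_assign a b).
  by apply: definable_unfiber; rewrite rb.
have ES : S = [set a : V -> M | R (join_assign a b)].
  by apply: funext => a; apply/propext.
have := dvS; rewrite {1}ES => /(divides_byE inaccK homM k b sC sB dR)[b' [b'C b'k]].
(* The unknowns are a tuple and a sequence of blocks: the tuple with any block has the type of [d]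
   and [b] over [C], and [k] distinct blocks never have a common solution. *)
pose T := ([set E : set (U + B -> M) | definable C E /\ E (join_assign d b)] * nat +
  {s : 'I_k -> nat | injective s})%type.
pose X := (U + nat * B)%type.
pose blk (x : X -> M) i : B -> M := fun w => x (inr (i, w)).
pose P (t : T) : set (X -> M) := match t with
  | inl p => [set x : X -> M | set_val p.1 (join_assign (fun u => x (inl u)) (blk x p.2))]
  | inr s => [set x : X -> M | ~ exists a : V -> M, forall j, R (join_assign a (blk x (sval s j)))]
  end.
have sX : sm X.
  by apply: smallT_sum => //; apply: smallT_prod => //; apply: smallT_countable.
have [|l|x xP] := @compactness _ _ _ inaccK satM m0 X T C P (small_emb sX) sC.
- move=> [[E i]|s] /=.
    have [dE _] := set_val_in E.
    apply: (definable_pre dE) => // -[u|w]; left; [by exists (inl u)|by exists (inr (i, w))].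
  apply: definableC.
  have dAll : definable C [set x : X + V -> M | forall j : 'I_k,
      R (join_assign (fun v => x (inr v)) (blk (fun y => x (inl y)) (sval s j)))].
    apply: definableAll => j; apply: (definable_pre dR) => // -[v|w]; left; first by exists (inr v).
    by exists (inl (inr (sval s j, w))).
  apply: definable_ext (definable_proj m0 dAll) => x /=.
  by split=> -[h hP]; exists h.
- pose E (t : T) : set (U + B -> M) := if t is inl p then set_val p.1 else setT.
  have dE t : definable C (E t).
    case: t => [p|s] /=; first by have [] := set_val_in p.1.
    by apply: definable_ext (definableTrue _ _ True).
  pose S' := [set u : U -> M | forall t, List.In t l -> E t (join_assign u b)].
  have dS' : definable (B `|` C) S'.
    apply: (@definable_fiber _ _ C (B `|` C) _ _ _ b (definableAllList l dE)).
      by rewrite rb; exact: subsetUl.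
    exact: subsetUr.
  have S'd : S' d by move=> [p|s] //= _; have [] := set_val_in p.1.
  (* [n] bounds all block indices mentioned in [l]. As [S'] does not divide, some [n] terms of [b']
     have a common solution [u]; they serve as the first [n] blocks. *)
  pose Q (t : T) (n : nat) : Prop := match t with inl p => is_true (p.2 < n) | inr s => forall j, sval s j < n end.
  have [||n nP] := @list_nat_bound T Q l.
  + move=> [p|s] n m nm /=; first by move=> h; apply: leq_trans nm.
    by move=> h j; apply: leq_trans nm.
  + move=> [p|s] _ /=; first by exists p.2.+1.
    exists (\max_j sval s j).+1 => j; by rewrite ltnS; apply: leq_bigmax.
  have nd' := ndd _ dS' S'd.
  have dvE k' : ~ exists b' : nat -> B -> M, (forall i, same_type C b (b' i)) /\
      forall s : 'I_k' -> nat, injective s ->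
      ~ exists u : U -> M, forall j, [set x : U + B -> M | forall t, List.In t l -> E t x] (join_assign u (b' (s j))).
    move=> h; apply: nd'; exists k'.
    by apply/(divides_byE inaccK homM k' b sC sB (definableAllList l dE)).
  have /existsNP[s0 /not_implyP[s0i /contrapT[u uP]]] : ~ forall s : 'I_n -> nat, injective s ->
      ~ exists u : U -> M, forall j, [set x : U + B -> M | forall t, List.In t l -> E t x] (join_assign u (b' (s j))).
    by move=> h; apply: (dvE n); exists b'.
  pose g i := if insub i is Some j then s0 j else 0.
  have gE (i : nat) (h : i < n) : g i = s0 (Ordinal h) by rewrite /g insubT.
  pose x (y : X) := match y with inl v => u v | inr p => b' (g p.1) p.2 end.
  exists x => -[[F i]|s] tl /=.
    have ilt := nP _ tl; have := uP (Ordinal ilt) _ tl; rewrite /= -gE.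
    by congr (set_val F); apply: funext => -[].
  have slt := nP _ tl.
  have bE j : blk x (sval s j) = b' (s0 (Ordinal (slt j))) by rewrite -gE.
  move=> [a aP]; apply: (b'k (fun j => s0 (Ordinal (slt j)))).
    move=> i j /s0i /(congr1 val) /=; exact: (svalP s).
  by exists a => j; rewrite -bE; apply: aP.
pose u w := x (inl w).
have uE i : same_type C (join_assign d b) (join_assign u (blk x i)).
  move=> E dE Edb.
  exact: (xP (inl (sub_elt (conj dE Edb : [set E | definable C E /\ E (join_assign d b)] E), i))).
have [s sC' su] := homogeneous inaccK homM sC sU (same_type_sym (same_type_join_l (uE 0))).
have zE i : same_type (range d `|` C) b (s \o blk x i).
  apply/same_type_join; apply: same_type_join_swap; apply: same_type_trans (uE i) _.
  by rewrite -{1}su -comp_join; apply: same_type_automorphism.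
rewrite setUC.
have sdC : sm (range d `|` C) by apply: smallT_setU => //; apply: smallT_range.
rewrite ES; apply/(divides_byE inaccK homM k b sdC sB (definable_mono (@subsetUr _ _ _) dR)).
exists (fun i => s \o blk x i); split=> // i0 i0i [a aP].
apply: (xP (inr (exist _ i0 i0i))).
have [t [tC st ts]] := automorphism_over_inv sC'.
exists (t \o a) => j /=.
apply/(definable_move _ _ dR tC ts); exact: aP.
Qed.

(** The automorphisms that witness dividing of [S] can be chosen to fix [d]. They then witness
    dividing of the fibre of [S] over [d], to which [e] belongs. *)
Lemma nondiv_left_transitivity V U (d : U -> M) (e : V -> M) (C B : set M) :
  sm U -> sm C -> sm B -> nondiv d C B -> nondiv e (C `|` range d) B ->
  nondiv (join_assign d e) C B.
Proof.
move=> sU sC sB ndd nde S dS Sde [k dvS].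
have [tau [tauC tauk]] := divides_by_nondiv sU sC sB dS dvS ndd.
pose S' := [set e' : V -> M | S (join_assign d e')].
apply: (nde S') => //.
  apply: (definable_pre dS) => [x [Bx|Cx]|[u|v]]; [by left|by right; left| |by left; exists v].
  by right; exists (d u) => //; right; right; exists u.
exists k, tau; split=> // s si [e' e'P]; apply: (tauk s si).
exists (join_assign d e') => j; rewrite comp_join.
suff -> : tau (s j) \o d = d by apply: e'P.
by apply: funext => u /=; have [_ ->] := tauC (s j); last by right; exists u.
Qed.

(** A formula over [C] about one term of a sequence, with parameters among coordinates of earlier
    terms. [lt_coord] fixes the coordinates and leaves the terms free, so that a test applies to
    sequences of every length. *)
Record level_test (C : set M) W := LevelTest {
  lt_size : nat;
  lt_set : set (W + 'I_lt_size -> M);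
  lt_coord : 'I_lt_size -> W;
  lt_definable : definable C lt_set }.
Arguments lt_set {C W} l _.
Arguments lt_coord {C W} l _.
Arguments lt_definable {C W} l.

(* Finite approximations to an infinite sequence [b l None] such that all the
   [R x (b l None)] are consistent and each of them [k]-divides over the earlier
   terms of the sequence, as witnessed by the copies [b l (Some i)]. *)
Definition level_approx (C : set M) V W (R : set (V + W -> M)) (k : nat) : Prop :=
  forall n (D : list (level_test C W)),
    exists (b : nat -> option nat -> W -> M) (x : V -> M), forall l, l < n ->
    [/\ R (join_assign x (b l None)),
      forall s : 'I_k -> nat, injective s ->
        ~ exists x' : V -> M, forall j, R (join_assign x' (b l (Some (s j)))) &
      forall t, List.In t D -> forall f : 'I_(lt_size t) -> nat, (forall j, f j < l) ->
        forall i, lt_set t (join_assign (b l None) (fun j => b (f j) None (lt_coord t j))) <->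
          lt_set t (join_assign (b l (Some i)) (fun j => b (f j) None (lt_coord t j)))].

(** By left transitivity, a block of later terms does not divide over [C] from a given term
    ([ndblk]). The formula at this term therefore still divides over [C] and the block, and a
    consistent sequence read backwards is an approximation. *)
Lemma nondiv_sequence_bound (C : set M) V W (R : set (V + W -> M)) k (b : W -> M) :
  sm C -> sm W -> definable C R -> ~ level_approx C R k ->
  divides_by C k [set a : V -> M | R (join_assign a b)] ->
  exists n, forall a : nat -> W -> M,
    (forall i, i < n -> same_type C b (a i) /\
      nondiv (a i) C (\bigcup_(j in [set j | j < i]) range (a j))) ->
    ~ exists x : V -> M, forall i, i < n -> R (join_assign x (a i)).
Proof.
move=> sC sW dR nla dvb; apply: contrapT => /forallNP nn; apply: nla => n D.
have /existsNP[a /not_implyP[aP /contrapT[x xP]]] := nn n.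
have sbelow i : sm (\bigcup_(j in [set j | j < i]) range (a j)).
  apply: smallT_bigcup => // [|j _]; last exact: smallT_range.
  exact: smallT_emb (emb_set _) (smallT_nat inaccK).
pose blk l m : 'I_m * W -> M := fun p => a (l.+1 + p.1) p.2.
have ndblk l m : l.+1 + m <= n ->
    nondiv (blk l m) C (\bigcup_(j in [set j | j < l.+1]) range (a j)).
  elim: m => [|m IH] lm.
    apply: (@nondiv_same_type _ _ _ (fun p : 'I_0 * W => a 0 p.2)).
      by move=> S dS; congr S; apply: funext => -[[]].
    move=> S dS Sa [k' [tau [tauC tauk]]].
    apply: (tauk (fun j : 'I_k' => j : nat)); first exact: ord_inj.
    by exists (fun p : 'I_0 * W => a 0 p.2) => j; congr S: Sa; apply: funext => -[[]].
  have lm' : l.+1 + m < n by rewrite -addnS.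
  have h1 := IH (ltnW lm'); have [_ h2] := aP _ lm'.
  have h3 : nondiv (a (l.+1 + m)) (C `|` range (blk l m))
      (\bigcup_(j in [set j | j < l.+1]) range (a j)).
    apply: nondiv_mono h2; first exact: subsetUl.
    move=> y [[j /= jl aj]|[Cy|[[i w] _ <-]]]; [left|by right|left].
      exists j => //=; apply: (leq_trans jl); exact: leq_addr.
    by exists (l.+1 + i); [rewrite /= ltn_add2l|exists w].
  have sU : sm ('I_m * W) by apply: smallT_prod => //; apply: smallT_countable.
  have h4 := nondiv_left_transitivity sU sC (sbelow _) h1 h3.
  pose f (p : 'I_m.+1 * W) : 'I_m * W + W := match insub (p.1 : nat) with
    | Some i => inl (i, p.2) | None => inr p.2 end.
  have <- : join_assign (blk l m) (a (l.+1 + m)) \o f = blk l m.+1.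
    apply: funext => -[i w]; rewrite /f /blk /=; case: insubP => [j jm je|im] /=.
      by rewrite je.
    congr (a (l.+1 + _) w).
    by apply/eqP; rewrite eqn_leq leqNgt im -ltnS ltn_ord.
  exact: nondiv_comp.
(* Level [l] is the term of index [n.-1 - l], so that the levels before it are the terms after
   it. *)
pose below l := C `|` \bigcup_(j in [set j | j < l]) range (fun w => a (n.-1 - j) w).
have dv l : l < n -> divides_by (below l) k
    [set y : V -> M | R (join_assign y (a (n.-1 - l)))].
  move=> ln; pose l' := n.-1 - l.
  have E : l'.+1 + l = n by rewrite /l'; lia.
  have l'n : l' < n by rewrite -E addSn ltnS leq_addr.
  have [ea _] := aP _ l'n.
  have [s sC' sb] := homogeneous inaccK homM sC sW ea.
  have := divides_by_conj dR sC' dvb; rewrite sb => dva.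
  have sU : sm ('I_l * W) by apply: smallT_prod => //; apply: smallT_countable.
  have dSa : definable (\bigcup_(j in [set j | j < l'.+1]) range (a j) `|` C)
      [set y : V -> M | R (join_assign y (a l'))].
    apply: (definable_fiber dR); last exact: subsetUr.
    by move=> y [w _ <-]; left; exists l' => //=; exists w.
  have := divides_by_nondiv sU sC (sbelow _) dSa dva (ndblk l' l _).
  rewrite E => /(_ (leqnn _)); apply: divides_by_mono => y [Cy|[j /= jl [w _ <-]]]; first by left.
  right; have jl' : l - j.+1 < l by lia.
  exists (Ordinal jl', w) => //; rewrite /blk /=; congr (a _ w).
  by rewrite /l'; lia.
have h l : exists tau : nat -> M -> M, l < n -> (forall i, automorphism_over (below l) (tau i)) /\
    forall s : 'I_k -> nat, injective s ->
      ~ exists y : V -> M, forall j, R (join_assign (tau (s j) \o y) (a (n.-1 - l))).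
  by have [/dv[tau h]|] := pselect (l < n); [exists tau|exists (fun _ => id)].
have [tau tauP] := choice h.
have h2 l i : exists t, l < n -> [/\ automorphism_over (below l) t, cancel (tau l i) t & cancel t (tau l i)].
  have [ln|nln] := pselect (l < n); last by exists id.
  by have [/(_ i) /automorphism_over_inv[t ?] _] := tauP l ln; exists t.
pose t l := projT1 (choice (h2 l)); pose tP l := projT2 (choice (h2 l)).
have {}tP l i : l < n -> [/\ automorphism_over (below l) (t l i), cancel (tau l i) (t l i) &
  cancel (t l i) (tau l i)] by exact: tP.
exists (fun l o => if o is Some i then t l i \o a (n.-1 - l) else a (n.-1 - l)), x => l ln.
have Cb : C `<=` below l by exact: subsetUl.
split.
- by apply: xP; lia.
- move=> s si [y yP]; have [_ nh] := tauP l ln; apply: (nh s si); exists y => j.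
  have [_ c1 c2] := tP l (s j) ln; have [tb _] := tauP l ln.
  apply/(definable_move _ _ dR (automorphism_over_mono Cb (tb _)) c1); exact: yP.
- move=> c _ f fl i; have [tb _ _] := tP l i ln.
  have dc := lt_definable c.
  rewrite (definable_automorphism _ (automorphism_over_mono Cb tb) dc) comp_join.
  suff -> : t l i \o (fun j => a (n.-1 - f j) (lt_coord c j)) =
    (fun j => a (n.-1 - f j) (lt_coord c j)) by [].
  apply: funext => j /=; have [_ ->] := tb; first by [].
  by right; exists (f j) => //=; exists (lt_coord c j).
Qed.

End Transitivity.

Arguments lt_set {L M C W} l _.
Arguments lt_coord {L M C W} l _.
Arguments lt_definable {L M C W} l.

(** * Abstract independence *)

Section Perp.
Variables (L : language) (K : Type) (M : structure L).
Hypothesis inaccK : strongly_inaccessible K.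
Hypothesis countL : countable_language L.
Hypothesis satM : saturated K M.
Hypothesis homM : strongly_homogeneous K M.
Variable m0 : M.
Notation sm := (smallT K).
Variable lt : K -> K -> Prop.
Hypothesis io : initial_order lt.
Variable perp : set M -> set M -> set M -> Prop.
Hypothesis perp_inv : invariant_rel K perp.
Hypothesis perp_lmon : left_monotonicity K perp.
Hypothesis perp_rmon : right_monotonicity K perp.
Hypothesis perp_bmon : right_base_monotonicity K perp.
Hypothesis perp_loc : local_character K perp.
Hypothesis perp_ext : extension K perp.
Hypothesis perp_ind : independence_theorem K perp.

Implicit Types A B C D N : set M.

Let smE T (A : set T) : small K A <-> sm A := @smallE K T A.

Lemma perp_image (s : M -> M) A C B : automorphism s -> sm A -> sm C -> sm B ->
  perp A C B <-> perp (s @` A) (s @` C) (s @` B).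
Proof. by move=> aut sA sC sB; apply: perp_inv => //; apply/smE. Qed.

Lemma smallT_image (s : M -> M) (A : set M) : sm A -> sm (s @` A).
Proof.
move=> sA; have -> : s @` A = range (fun x : A => s (set_val x)).
  apply/seteqP; split=> x [y].
    by move=> Ay <-; exists (sub_elt Ay).
  by move=> _ <-; exists (set_val y) => //; apply: set_val_in.
exact: smallT_range.
Qed.

Lemma perp_right A C B D : sm A -> sm C -> sm D -> B `<=` D -> perp A C D -> perp A C B.
Proof.
move=> sA sC sD BD; have sB : sm B := smallT_sub BD sD.
by move=> h; apply: (perp_rmon (D := D)); rewrite ?smE //; rewrite setUC setUidl.
Qed.

Lemma perp_left (A A' C B : set M) : sm A' -> sm C -> sm B -> A `<=` A' -> perp A' C B -> perp A C B.
Proof.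
move=> sA sC sB AA; have sA0 : sm A := smallT_sub AA sA.
by move=> h; apply: (perp_lmon (D := A')); rewrite ?smE //; rewrite setUC setUidl.
Qed.

Lemma perp_base A C B D : sm A -> sm D -> C `<=` B -> B `<=` D ->
  perp A C D -> perp A B D.
Proof.
move=> sA sD CB BD; have sB : sm B := smallT_sub BD sD.
have sC : sm C := smallT_sub CB sB.
by apply: perp_bmon => //; apply/smE.
Qed.

Lemma perp_extension A C B D : sm A -> sm C -> sm B -> sm D -> B `<=` D ->
  perp A C B -> exists2 s, automorphism_over (B `|` C) s & perp (s @` A) C D.
Proof.
move=> sA sC sB sD BD pA.
have [||||A' [[s [sBC sA']] pA']] := perp_ext (D := D) _ _ _ _ pA BD; try exact/smE.
have [t [tBC st ts]] := automorphism_over_inv sBC.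
exists t => //; suff -> : t @` A = A' by [].
rewrite -sA'; apply/seteqP; split=> [x [y [z Az <-] <-]|x Ax]; first by rewrite st.
by exists (s x); [exists x|rewrite st].
Qed.

Lemma perp_self A C : sm A -> sm C -> perp A C C.
Proof.
move=> sA sC; have [|kappa [_ h]] := perp_loc (A := A); first exact/smE.
have [|C0 [C0C _ pA]] := h C; first exact/smE.
exact: perp_base pA.
Qed.

Lemma perp_existence A C D : sm A -> sm C -> sm D ->
  exists2 s, automorphism_over C s & perp (s @` A) C D.
Proof.
move=> sA sC sD.
have sCD : sm (C `|` D) by exact: smallT_setU.
have [s sC' pA] := perp_extension sA sC sC sCD (@subsetUl _ _ _) (perp_self sA sC).
exists s; first by rewrite setUid in sC'.
by apply: perp_right pA => //; apply: smallT_image.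
Qed.

(* The form in which local character is used: [delta] has cofinality larger than the
   bound for [A], so that [A] is independent from an increasing union of length [delta]
   over one of its terms. *)
Definition cofinal_for (A : set M) (delta : K) : Prop :=
  forall (C : set M) (F : K -> set M), sm C -> (forall i, lt i delta -> sm (F i)) ->
  exists2 gamma, lt gamma delta &
    perp A (C `|` \bigcup_(i in [set i | lt i gamma]) F i)
      (C `|` \bigcup_(i in [set i | lt i delta]) F i).

Lemma small_below delta (F : K -> set M) : (forall i, lt i delta -> sm (F i)) ->
  sm (\bigcup_(i in [set i | lt i delta]) F i).
Proof. by move=> sF; apply: smallT_bigcup => //; apply: io_small. Qed.

Lemma bigcup_below_sub gamma delta (F : K -> set M) : lt gamma delta ->
  \bigcup_(i in [set i | lt i gamma]) F i `<=` \bigcup_(i in [set i | lt i delta]) F i.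
Proof. by move=> gd x [i ig Fx]; exists i => //; apply: (io_trans io) gd. Qed.

(** Outside [C], a base of size below [kappa] meets fewer than [kappa] of the sets [F i], and their
    indices are bounded below [delta]. *)
Lemma cofinal_exists A : sm A -> exists delta, cofinal_for A delta.
Proof.
move=> sA; have [|kappa [sk h]] := perp_loc (A := A); first exact/smE.
have [delta dP] := cofinality_exists inaccK io sk.
exists delta => C F sC sF.
set Full := C `|` _.
have sFull : sm Full by apply: smallT_setU => //; apply: small_below.
have [|B0 [B0F cB0 pA]] := h Full; first exact/smE.
have ex (x : (B0 `\` C)) : exists i, lt i delta /\ F i (set_val x).
  have [B0x nCx] := set_val_in x.
  by case: (B0F _ B0x) => // -[i id Fx]; exists i.
have [f fP] := choice ex.
have [||gamma gd gP] := dP (range f).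
- by move=> _ [x _ <-]; have [] := fP x.
- have e : emb (range f) B0.
    apply: emb_trans (emb_sub (@subDsetl _ B0 C)).
    apply: (@emb_surj (B0 `\` C) (range f) (fun x => sub_elt (imageT f x))) => y.
    by have [x _ e] := set_val_in y; exists x; apply: set_val_inj.
  case: cB0 => /card_leE c1 c2; split; first by apply/card_leE; apply: emb_trans c1.
  by move=> /card_leE c3; apply: c2; apply/card_leE; apply: emb_trans e.
exists gamma => //; apply: perp_base pA => //.
  move=> x B0x; have [Cx|nCx] := pselect (C x); first by left.
  right; have B0C : (B0 `\` C) x by split.
  exists (f (sub_elt B0C)); first by apply: gP; exists (sub_elt B0C).
  by have [_] := fP (sub_elt B0C).
by apply: setUS; apply: bigcup_below_sub.
Qed.

Lemma automorphism_inv (s : M -> M) : automorphism s ->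
  exists t, [/\ automorphism t, cancel s t & cancel t s].
Proof.
move=> aut; have [|t [[taut _] st ts]] := @automorphism_over_inv _ _ set0 s; first by split.
by exists t.
Qed.

Lemma cofinal_for_image A delta (s : M -> M) : sm A -> automorphism s ->
  cofinal_for A delta -> cofinal_for (s @` A) delta.
Proof.
move=> sA aut h C F sC sF.
have [t [taut st ts]] := automorphism_inv aut.
have sF' i : lt i delta -> sm (t @` F i) by move=> /sF; apply: smallT_image.
have [gamma gd pA] := h (t @` C) (fun i => t @` F i) (smallT_image _ sC) sF'.
exists gamma => //.
have E g : s @` (t @` C `|` \bigcup_(i in [set i | lt i g]) (t @` F i)) =
    C `|` \bigcup_(i in [set i | lt i g]) F i.
  apply/seteqP; split=> [x [y [[z Cz <-]|[i ig [z Fz <-]]] <-]|x [Cx|[i ig Fx]]].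
  - by left; rewrite ts.
  - by right; exists i => //; rewrite ts.
  - by exists (t x); [left; exists x|rewrite ts].
  - by exists (t x); [right; exists i => //; exists x|rewrite ts].
have sFt g : (forall i, lt i g -> lt i delta) ->
    sm (t @` C `|` \bigcup_(i in [set i | lt i g]) (t @` F i)).
  move=> gP; apply: smallT_setU => //; first exact: smallT_image.
  by apply: small_below => i /gP; apply: sF'.
rewrite -!E; apply/(perp_image aut sA _ (sFt _ _)) => //.
by apply: sFt => i ig; apply: (io_trans io) gd.
Qed.

(** The independence theorem, iterated along the list: the conjugate of [a] that goes with the head
    is amalgamated with the tuple found for the tail. *)
Lemma amalgamate V W (N : set M) (a : V -> M) (b : W -> M) (I : Type) (c : I -> W -> M)
    (s : list I) : sm V -> sm W -> sm N -> elementary_substructure N ->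
  perp (range a) N (range b) ->
  (forall j, List.In j s -> same_type N b (c j)) ->
  (forall j s1 s2, s = s1 ++ j :: s2 ->
    perp (range (c j)) N (\bigcup_(i in [set i | List.In i s2]) range (c i))) ->
  exists a' : V -> M, [/\ perp (range a') N (\bigcup_(i in [set i | List.In i s]) range (c i)),
    same_type N a a' & forall j, List.In j s -> same_type N (join_assign a b) (join_assign a' (c j))].
Proof.
move=> sV sW sN elN pab.
have sU s' : sm (\bigcup_(i in [set i | List.In i s']) range (c i)).
  apply: smallT_bigcup => // [|i _]; last exact: smallT_range.
  elim: s' => [|i s' IH]; first by apply: smallT_sub (smallT_set0 inaccK _) => x.
  apply: smallT_sub (smallT_setU inaccK (smallT_set1 inaccK i) IH).
  by move=> x /= [->|]; [left|right].
have sa : sm (range a) := smallT_range a sV.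
elim: s => [|j s IH] eqs chain.
  exists a; split=> //; apply: (perp_right sa sN (smallT_range b sW)) pab.
  by move=> x [].
have [|j' s1 s2 es|a2 [pa2 a2N a2P]] := IH.
- by move=> j' js; apply: eqs; right.
- by apply: (chain j' (j :: s1)); rewrite es.
have [t tN tb] := homogeneous inaccK homM sN sW (eqs j (or_introl erefl)).
have pj := chain j [::] s erefl.
have pa1 : perp (range (t \o a)) N (range (c j)).
  have [taut _] := tN.
  rewrite -tb -!range_comp -{1}(automorphism_over_image tN).
  by apply/(perp_image taut sa sN (smallT_range b sW)).
have [|||||a' [pa' /tuple_equivE a'1 /tuple_equivE a'2]] :=
    perp_ind (N := N) (c1 := t \o a) (c2 := a2) _ elN _ _ _ pj pa1 pa2.
- exact/smE.
- by apply/smE; apply: smallT_range.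
- exact/smE.
- by apply/smE; apply: smallT_setT.
- apply/tuple_equivE; apply: same_type_trans a2N; apply: same_type_sym; exact: same_type_automorphism.
have aN : same_type N a' a2 by apply: same_type_mono a'2; apply: subsetUl.
exists a'; split.
- apply: perp_right pa' => //; [exact: smallT_range|apply: smallT_setU => //; exact: smallT_range|].
  by move=> x [i /= [<-|il] cx]; [left|right; exists i].
- exact: same_type_trans a2N (same_type_sym aN).
- move=> i /= [<-|il].
    apply: (@same_type_trans _ _ _ _ _ (join_assign (t \o a) (c j))).
      by rewrite -tb -comp_join; apply: same_type_automorphism.
    by apply/same_type_join; apply: same_type_sym; rewrite setUC.
  apply: same_type_trans (a2P i il) _; apply/same_type_join; apply: same_type_sym.
  apply: same_type_mono a'2 => x [[w _ <-]|Nx]; [right|by left].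
  by exists i => //; exists w.
Qed.

Lemma smallT_list T (l : list T) : sm [set x | List.In x l].
Proof.
elim: l => [|i l IH]; first by apply: smallT_sub (smallT_set0 inaccK _) => x.
apply: smallT_sub (smallT_setU inaccK (smallT_set1 inaccK i) IH).
by move=> x /= [->|]; [left|right].
Qed.

(** * Independent conjugates over a model, and non-dividing *)

Section Good.
Variables (B : Type) (bb : K -> B -> M).
Hypothesis sB : sm B.

(** The type of [c] over [N] as an element of a power set, so that there are few types over a small
    [N]. *)
Definition type_index (N : set M) (c : B -> M) : set [set E : set (B -> M) | definable N E] :=
  [set E | set_val E c].
Arguments type_index : clear implicits.

Lemma type_index_same_type N c c' : type_index N c = type_index N c' -> same_type N c c'.
Proof.
move=> e E dE Ec; pose E' := sub_elt (dE : [set E : set (B -> M) | definable N E] E).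
have : type_index N c E' by [].
by rewrite e.
Qed.

Definition ranges (s : list K) := \bigcup_(i in [set i | List.In i s]) range (bb i).

Fixpoint good N (p : set [set E : set (B -> M) | definable N E]) (s : list K) : Prop :=
  match s with
  | nil => True
  | j :: s => [/\ good p s, ~ List.In j s, type_index N (bb j) = p &
      perp (range (bb j)) N (ranges s)]
  end.

Lemma good_cat N (p : set [set E : set (B -> M) | definable N E]) s1 s2 :
  good p (s1 ++ s2) -> good p s2.
Proof. by elim: s1 => //= j s1 IH [/IH]. Qed.

Lemma good_in N (p : set [set E : set (B -> M) | definable N E]) s j :
  good p s -> List.In j s -> type_index N (bb j) = p.
Proof. by elim: s => //= i s IH [/IH h _ e _] [<-|/h]. Qed.

(* If there is no such [N], close off a chain of models [N i] under adding
   maximal such sequences; a [bb j] outside all of them is, by local character,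
   independent from the union of the chain over some [N i], against maximality. *)
Lemma good_exists (C : set M) k delta : sm C ->
  (forall j, cofinal_for (range (bb j)) delta) ->
  exists N (p : set [set E : set (B -> M) | definable N E]) s,
    [/\ C `<=` N, sm N, elementary_substructure N, good p s & size s = k].
Proof.
move=> sC cof; apply: contrapT => nex.
have bound N (p : set [set E : set (B -> M) | definable N E]) s : C `<=` N -> sm N ->
    elementary_substructure N -> good p s -> size s < k.
  move=> CN sN elN gs; rewrite ltnNge; apply/negP => ks; apply: nex.
  exists N, p, (drop (size s - k) s); split=> //; last by rewrite size_drop subKn.
  by apply: (@good_cat _ _ (take (size s - k) s)); have := cat_take_drop (size s - k) s => ->.
have maxex N (p : set [set E : set (B -> M) | definable N E]) : exists s,
    C `<=` N -> sm N -> elementary_substructure N ->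
    good p s /\ forall s', good p s' -> size s' <= size s.
  apply: contrapT => /forallNP nm.
  have step n : exists s, good p s /\ n <= size s.
    elim: n => [|n [s [gs ns]]]; first by exists nil.
    apply: contrapT => /forallNP nl; apply: (nm s) => CN sN elN; split=> // s' gs'.
    by rewrite leqNgt; apply/negP => ss; apply: (nl s'); split=> //; apply: leq_ltn_trans ss.
  have [s [gs ks]] := step k; apply: (nm s) => CN sN elN.
  by have := bound _ _ _ CN sN elN gs; rewrite ltnNge ks.
pose smax N p := projT1 (cid (maxex N p)).
have smaxP N p : C `<=` N -> sm N -> elementary_substructure N ->
    good p (smax N p) /\ forall s', good p s' -> size s' <= size (smax N p).
  exact: projT2 (cid (maxex N p)).
(* All indices used by the chosen maximal sequences, one for each type over [N]. They form a small
   set because the types do. *)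
pose EJ N := \bigcup_(p in [set: set [set E : set (B -> M) | definable N E]])
  [set j | List.In j (smax N p)].
have sEJ N : sm N -> sm (EJ N).
  move=> sN; apply: smallT_bigcup => // [|p _]; last exact: smallT_list.
  by apply: smallT_setT; apply: smallT_set => //; apply: smallT_definable.
pose E N := \bigcup_(j in EJ N) range (bb j).
have sE N : sm N -> sm (E N).
  by move=> sN; apply: smallT_bigcup => // [|j _]; [exact: sEJ|exact: smallT_range].
have modex (X : set M) : exists N, sm X -> [/\ X `<=` N, sm N & elementary_substructure N].
  have [sX|nX] := pselect (sm X); last by exists X.
  by have [N ?] := lowenheim_skolem inaccK countL m0 sX; exists N.
have [Mod ModP] := choice modex.
have [|i f _|N NE] := @wf_choice K (set M) lt (io_wf io) set0
    (fun i f u => u = Mod (C `|` \bigcup_(j in [set j | lt j i]) (f j `|` E (f j)))).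
- move=> i f g u fg ->; congr (Mod (C `|` _)).
  by apply/seteqP; split=> x [j ji h]; exists j => //; move: h; rewrite fg.
- by eexists.
pose F i := N i `|` E (N i).
have NP i : [/\ C `|` \bigcup_(j in [set j | lt j i]) F j `<=` N i, sm (N i) &
    elementary_substructure (N i)].
  elim/(well_founded_ind (io_wf io)): i => i IH.
  rewrite (NE i); apply: ModP; apply: smallT_setU => //; apply: small_below => j ji.
  by have [_ sN _] := IH j ji; apply: smallT_setU => //; apply: sE.
have sF i : sm (F i) by have [_ sN _] := NP i; apply: smallT_setU => //; apply: sE.
(* [K] is not small, so some index is used over none of the models below [delta]. *)
have [j nj] : exists j, ~ (\bigcup_(i in [set i | lt i delta]) EJ (N i)) j.
  apply: contrapT => /forallNP h.
  have : sm (\bigcup_(i in [set i | lt i delta]) EJ (N i)).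
    apply: smallT_bigcup => // [|i _]; first exact: io_small.
    by have [_ sN _] := NP i; apply: sEJ.
  move=> [[]]; apply: emb_trans (emb_setT _) (emb_sub _) => x _.
  exact: contrapT (h x).
have [gamma gd pj] := cof j C F sC (fun i _ => sF i).
have [CN sN elN] := NP gamma.
have CNg : C `<=` N gamma by move=> x Cx; apply: CN; left.
pose p := type_index (N gamma) (bb j).
have [gs gmax] := smaxP _ p CNg sN elN.
(* [N gamma] lies between the base and the right-hand side of [pj], and the maximal sequence for [p]
   lies in that right-hand side; [j] can be put in front of it. *)
suff /gmax : good p (j :: smax _ p) by rewrite /= ltnn.
split=> //; first by move=> js; apply: nj; exists gamma => //; exists p.
have sfull : sm (C `|` \bigcup_(i in [set i | lt i delta]) F i).
  by apply: smallT_setU => //; apply: small_below.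
have sb : sm (range (bb j)) by exact: smallT_range.
apply: (perp_right sb sN sfull); last first.
  apply: perp_base pj => // x Nx; right; exists gamma => //; by left.
move=> x [i ip bx]; right; exists gamma => //; right; exists i => //.
by exists p.
Qed.

End Good.

Lemma smallT_of_K (B : Type) : sm B -> emb (K * B) K.
Proof.
move=> sB; apply: (@emb_rank K inaccK lt io _ fst) => k.
apply: smallT_emb sB.
apply: emb_trans (@emb_map _ _ _ [set: B] snd _ _) (emb_set _) => //.
by move=> [a b] [c d] /= -> -> ->.
Qed.

Theorem perp_nondiv V (a : V -> M) C B : sm V -> sm C -> sm B ->
  perp (range a) C B -> nondiv a C B.
Proof.
move=> sV sC sB pa S dS Sa [k dvS].
pose b := fun x : B => set_val x.
have rb : range b = B by exact: range_set_val.
have [R dR RE] : exists2 R, definable C R & forall a, S a <-> R (join_assign a b).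
  by apply: definable_unfiber; rewrite rb.
have ES : S = [set a : V -> M | R (join_assign a b)].
  by apply: funext => a'; apply/propext.
move: dvS; rewrite ES => /(divides_byE inaccK homM k b sC sB dR)[b' [b'C b'k]].
pose T := (K * [set E : set (B -> M) | definable C E /\ E b] + {s : 'I_k -> K | injective s})%type.
pose blk (x : K * B -> M) j : B -> M := fun w => x (j, w).
pose P (t : T) : set (K * B -> M) := match t with
  | inl p => [set x : K * B -> M | set_val p.2 (blk x p.1)]
  | inr s => [set x : K * B -> M |
      ~ exists a : V -> M, forall j, R (join_assign a (blk x (sval s j)))]
  end.
have [|l|x xP] := @compactness _ _ _ inaccK satM m0 (K * B) T C P (smallT_of_K sB) sC.
- move=> [[j E]|s] /=.
    have [dE _] := set_val_in E.
    by apply: (definable_pre dE) => // w; left; exists (j, w).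
  apply: definableC.
  have dAll : definable C [set x : K * B + V -> M | forall j : 'I_k,
      R (join_assign (fun v => x (inr v)) (blk (fun y => x (inl y)) (sval s j)))].
    apply: definableAll => j; apply: (definable_pre dR) => // -[v|w]; left; first by exists (inr v).
    by exists (inl (sval s j, w)).
  apply: definable_ext (definable_proj m0 dAll) => x /=.
  by split=> -[h hP]; exists h.
(* Finitely many elements of [K] are mentioned. Their positions in [keys] select terms of [b'],
   distinct ones for distinct elements. *)
- pose keys : seq {classic K} := flatten (List.map (fun t : T => match t with
    | inl _ => [::] | inr s => [seq sval s j | j <- enum 'I_k] end) l).
  exists (fun y : K * B => b' (index (y.1 : {classic K}) keys) y.2) => -[[j E]|s] tl /=.
    have [dE Eb] := set_val_in E; exact: (b'C (index (j : {classic K}) keys) _ dE Eb).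
  have skeys j : (sval s j : {classic K}) \in keys.
    rewrite /keys {keys}; elim: l tl => //= t l IH [->|/IH h]; last by rewrite mem_cat h orbT.
    by rewrite mem_cat map_f ?mem_enum.
  move=> [a' a'P]; apply: (b'k (fun j => index (sval s j : {classic K}) keys)).
    move=> i j e; apply: (svalP s).
    by rewrite -(@nth_index {classic K} (sval s i) _ _ (skeys i)) e nth_index.
  by exists a'.
pose bb j := blk x j.
have bbC j : same_type C b (bb j).
  move=> E dE Eb.
  exact: (xP (inl (j, sub_elt (conj dE Eb : [set E : set (B -> M) | definable C E /\ E b] E)))).
have bbk (s : 'I_k -> K) : injective s ->
    ~ exists a : V -> M, forall j, R (join_assign a (bb (s j))).
  by move=> si; exact: (xP (inr (exist _ s si))).
have [delta cofB] := cofinal_exists sB.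
have cof j : cofinal_for (range (bb j)) delta.
  have [s [sa _] <-] := homogeneous inaccK homM sC sB (bbC j).
  by rewrite -range_comp rb; apply: cofinal_for_image.
have [N [p [s [CN sN elN gs ks]]]] := @good_exists B bb sB C k delta sC cof.
have sra : sm (range a) by exact: smallT_range.
(* Here [k] is zero, and any tuple realises an empty family. *)
case: s => [|j0 s0] in gs ks.
  move: bbk; rewrite -ks => /(_ (fun j : 'I_0 => False_rect _ (notF (ltn_ord j)))).
  by case=> [[] //|]; exists a => -[].
set s := j0 :: s0 in gs ks.
have tyN j : List.In j s -> same_type N (bb j0) (bb j).
  move=> js; apply: type_index_same_type.
  by rewrite (good_in gs js) (good_in gs (or_introl erefl)).
have [t tC tb] := homogeneous inaccK homM sC sB (bbC j0).
have rt : range (t \o b) = t @` B by rewrite -range_comp rb.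
have pta : perp (range (t \o a)) C (t @` B).
  rewrite -range_comp -{1}(automorphism_over_image tC).
  by have [taut _] := tC; apply/(perp_image taut sra sC sB).
have sta : sm (range (t \o a)) by exact: smallT_range.
have stB : sm (t @` B) by exact: smallT_image.
have sD : sm (t @` B `|` N) by exact: smallT_setU.
(* [r] fixes [bb j0] and [C], so the type of the pair is kept, while the moved tuple becomes
   independent from [bb j0] over [N] by base monotonicity. *)
have [r rC pra] := perp_extension sta sC stB sD (@subsetUl _ _ _) pta.
have srta : sm (range (r \o (t \o a))) by exact: smallT_range.
have {}pra : perp (range (r \o (t \o a))) N (range (bb j0)).
  rewrite -tb rt; apply: (perp_right srta sN sD) (@subsetUl _ _ _) _.
  rewrite -range_comp; apply: perp_base pra => //; first exact: smallT_image.
have [|a' [_ _ a'P]] := @amalgamate V B N (r \o (t \o a)) (bb j0) K bb s sV sB sN elN pra tyN.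
  move=> j s1 s2 es; move: gs; rewrite es => /(@good_cat B bb _ _ s1).
  by case.
have us : forall i j : 'I_k, i < j -> nth j0 s i <> nth j0 s j.
  have : good bb p s by [].
  have : size s = k by [].
  elim: (s) (k) => [|i0 s' IH] k' sk /=; first by move: (sk) => <- _ [].
  move=> [gs' ni _ _] [[|i] ik] [[|j] jk] //= ij; rewrite -sk in ik jk.
    move=> e; apply: ni; have jk' : j < size s' by [].
    by rewrite e; exact: (@list_in_nth _ j0 s' (Ordinal jk')).
  have ik' : i < size s' by []. have jk' : j < size s' by [].
  exact: (IH (size s') erefl gs' (Ordinal ik') (Ordinal jk') ij).
apply: (bbk (fun i => nth j0 s i)).
  move=> i j e; apply/eqP; rewrite -val_eqE eqn_leq; apply/andP; split;
    rewrite leqNgt; apply/negP => h; [by case: (us _ _ h)|by case: (us _ _ h)].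
exists a' => i; have := a'P (nth j0 s i).
have ins : List.In (nth j0 s i) s by rewrite -ks in i *; exact: list_in_nth.
move=> /(_ ins); apply; first exact: definable_mono dR.
rewrite -tb; have -> : t \o b = r \o (t \o b).
  apply: funext => w /=; have [_ ->] := rC => //; left; exists (b w) => //.
  exact: set_val_in.
rewrite -(comp_join r (t \o a) (t \o b)) -(comp_join t a b).
apply: (definable_automorphism _ (automorphism_over_mono (@subsetUr _ _ _) rC) dR).1.
by apply: (definable_automorphism _ tC dR).1; exact: (RE a).1.
Qed.

Lemma wf_ltn : well_founded (fun i j : nat => is_true (i < j)).
Proof.
suff A n : forall m, m < n -> Acc (fun i j : nat => is_true (i < j)) m.
  by move=> n; apply: (A n.+1).
elim: n => [|n IH] m; first by rewrite ltn0.
rewrite ltnS => mn; constructor=> k km; apply: IH; exact: leq_trans mn.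
Qed.

Lemma list_params V (l : list (set (V -> M))) : (forall Q, List.In Q l -> definable setT Q) ->
  exists P : set M, sm P /\ forall Q, List.In Q l -> definable P Q.
Proof.
elim: l => [|Q l IH] dl; first by exists set0; split=> //; apply: smallT_set0.
have [P [sP PP]] := IH (fun Q Ql => dl Q (or_intror Ql)).
have : definable (setT `|` set0) Q by rewrite setU0; apply: dl; left.
move=> /definable_finite[n [m [R [_ dR RE]]]].
exists (range m `|` P); split.
  by apply: smallT_setU => //; apply: smallT_range; apply: smallT_countable.
move=> Q' /= [<-|/PP]; last by apply: definable_mono; apply: subsetUr.
apply: definable_ext RE _; exact: (definable_fiber dR).
Qed.

(** Move [a] to be independent also from the parameters of the dividing sets that cover [S]. One of
    these sets contains the moved tuple, against [perp_nondiv]. *)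
Theorem perp_nonfork V (a : V -> M) C B : sm V -> sm C -> sm B ->
  perp (range a) C B -> nonfork a C B.
Proof.
move=> sV sC sB pa S dS Sa [l [l1 l2]].
have [P [sP PP]] := list_params (fun Q Ql => (l1 Q Ql).1).
have sD : sm (B `|` P) by exact: smallT_setU.
have [r rC] := perp_extension (smallT_range a sV) sC sB sD (@subsetUl _ _ _) pa.
rewrite range_comp => /(perp_nondiv sV sC sD) ndra.
have /l2[Q Ql Qra] : S (r \o a) by exact: (definable_automorphism a rC dS).1.
apply: (ndra Q) Qra _; last by have [] := l1 Q Ql.
by apply: definable_mono (PP Q Ql) => x Px; left; right.
Qed.

(** * Long dividing sequences and simplicity *)

Record level_cond (C : set M) W := LevelCond {
  lc_test : level_test C W;
  lc_level : K;
  lc_fun : 'I_(lt_size lc_test) -> K;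
  lc_copy : nat;
  lc_lt : forall j, lt (lc_fun j) lc_level }.
Arguments lc_fun {C W} l _.
Arguments lc_lt {C W} l _.

(** Compactness stretches the approximations to a sequence indexed by [K]. A common realisation is
    independent from some term over [C] and the earlier terms, over which the formula at this term
    divides. *)
Theorem no_level_approx (C : set M) V W (R : set (V + W -> M)) k :
  sm C -> sm V -> sm W -> definable C R -> ~ level_approx C R k.
Proof.
move=> sC sV sW dR la.
have [k0] : exists k0 : K, True.
  apply: contrapT => nK; have [+ _ _] := inaccK; apply; rewrite /countable card_leE.
  by exists (fun x : [set: K] => False_rect _ (nK (ex_intro _ (set_val x) I))) => x;
    case: nK; exists (set_val x).
move=> _.
pose X := (V + K * (option nat * W))%type.
have eX : emb X K.
  apply: (@emb_rank K inaccK lt io _ (fun x : X => if x is inr p then p.1 else k0)) => j.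
  apply: (@smallT_emb _ _ (V + (option nat * W))).
    apply: emb_trans (@emb_map _ _ _ [set: V + (option nat * W)]
      (fun x : X => match x with inl v => inl v | inr p => inr p.2 end) _ _) (emb_set _) => //.
    by move=> [v|[i p]] [v'|[i' p']] //= e e' [->] //; rewrite e e'.
  by apply: smallT_sum => //; apply: smallT_prod => //; apply: smallT_countable.
pose T := (K + K * {s : 'I_k -> nat | injective s} + level_cond C W)%type.
pose xv (x : X -> M) v := x (inl v).
pose xb (x : X -> M) l o w := x (inr (l, (o, w))).
pose par (x : X -> M) (t : level_cond C W) j :=
  xb x (lc_fun t j) None (lt_coord (lc_test t) j).
pose P (t : T) : set (X -> M) := match t with
  | inl (inl l) => [set x : X -> M | R (join_assign (xv x) (xb x l None))]
  | inl (inr p) => [set x : X -> M | ~ exists x' : V -> M, forall j,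
      R (join_assign x' (xb x p.1 (Some (sval p.2 j))))]
  | inr t => [set x : X -> M |
      lt_set (lc_test t) (join_assign (xb x (lc_level t) None) (par x t)) <->
      lt_set (lc_test t) (join_assign (xb x (lc_level t) (Some (lc_copy t))) (par x t))]
  end.
have [|l|x xP] := @compactness _ _ _ inaccK satM m0 X T C P eX sC.
- move=> [[l|[l s]]|t] /=.
  + apply: (definable_pre dR) => // -[v|w]; left; first by exists (inl v).
    by exists (inr (l, (None, w))).
  + apply: definableC.
    have dAll : definable C [set x : X + V -> M | forall j : 'I_k,
        R (join_assign (fun v => x (inr v)) (xb (fun y => x (inl y)) l (Some (sval s j))))].
      apply: definableAll => j; apply: (definable_pre dR) => // -[v|w]; left; first by exists (inr v).
      by exists (inl (inr (l, (Some (sval s j), w)))).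
    apply: definable_ext (definable_proj m0 dAll) => x /=.
    by split=> -[h hP]; exists h.
  + apply: definableIff; apply: (definable_pre (lt_definable (lc_test t))) => // -[w|j]; left.
    * by exists (inr (lc_level t, (None, w))).
    * by exists (inr (lc_fun t j, (None, lt_coord (lc_test t) j))).
    * by exists (inr (lc_level t, (Some (lc_copy t), w))).
    * by exists (inr (lc_fun t j, (None, lt_coord (lc_test t) j))).
- pose keys : seq {classic K} := flatten (List.map (fun t : T => match t with
    | inl _ => [::] | inr t => [seq lc_fun t j | j <- enum 'I_(lt_size (lc_test t))] end) l).
  have keysP t j : List.In (inr t) l -> (lc_fun t j : {classic K}) \in keys.
    rewrite /keys {keys}; elim: l => //= t' l IH [->|/IH h]; last by rewrite mem_cat h orbT.
    by rewrite mem_cat map_f ?mem_enum.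
  (* The rank among the levels that occur as parameters in [l]. It increases strictly from a
     parameter level to the level of its condition, which is all that is needed; other levels may
     collide. *)
  pose rho (i : K) := count (fun y : {classic K} => `[< lt y i >]) keys.
  have rho_lt i j : lt j i -> (j : {classic K}) \in keys -> rho j < rho i.
    move=> ji; rewrite /rho; elim: keys {keysP rho} => //= y s IH.
    have mono (s' : seq {classic K}) : count (fun y => `[< lt y j >]) s' <=
        count (fun y => `[< lt y i >]) s'.
      by apply: sub_count => z /asboolP zj; apply/asboolP; apply: (io_trans io) ji.
    rewrite inE => /orP[/eqP <-|/IH h].
      rewrite (asboolT ji) (asboolF (@io_irr _ _ io j)) add0n add1n ltnS; exact: mono.
    have [yj|nyj] := pselect (lt y j).
      by rewrite !asboolT ?ltn_add2l //; apply: (io_trans io) ji.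
    by rewrite (asboolF nyj) add0n; apply: ltn_addl.
  pose D : list (level_test C W) := flatten (List.map (fun t : T => match t with
    | inl _ => [::] | inr t => [:: lc_test t] end) l).
  have DP t : List.In (inr t) l -> List.In (lc_test t) D.
    rewrite /D {D}; elim: l {keys keysP rho rho_lt} => //= t' l IH [->|/IH h]; first by left.
    by apply/List.in_or_app; right.
  have [b [x bx]] := la (size keys).+1 D.
  have rn i : rho i < (size keys).+1 by rewrite ltnS count_size.
  exists (fun y => match y with inl v => x v | inr p => b (rho p.1) p.2.1 p.2.2 end).
  move=> [[i|[i s]]|t] tl.
  + have [h _ _] := bx _ (rn i).
    by congr R: h; apply: funext => -[].
  + by have [_ h _] := bx _ (rn i); apply: h; exact: svalP s.
  + have [_ _ h] := bx _ (rn (lc_level t)).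
    apply: (h _ (DP t tl) (fun j => rho (lc_fun t j))) => j.
    by apply: rho_lt (keysP _ _ tl); apply: lc_lt.
pose bl l := xb x l None.
have sx : sm (range (xv x)) by exact: smallT_range.
have sF i : sm (range (bl i)) by exact: smallT_range.
have [delta cof] := cofinal_exists sx.
have [gamma gd px] := cof C (fun i => range (bl i)) sC (fun i _ => sF i).
set Cg := C `|` \bigcup_(i in [set i | lt i gamma]) range (bl i) in px.
have sbelow g : sm (C `|` \bigcup_(i in [set i | lt i g]) range (bl i)).
  by apply: smallT_setU => //; apply: small_below => i _; apply: sF.
have {}px : perp (range (xv x)) Cg (range (bl gamma)).
  apply: (perp_right sx (sbelow _) (sbelow _) _ px) => y by_.
  by right; exists gamma.
apply: (perp_nondiv sV (sbelow _) (sF _) px) (xP (inl (inl gamma))) _.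
  apply: (definable_fiber dR); first exact: subsetUl.
  by move=> y Cy; right; left.
exists k; apply/(divides_byE inaccK homM k _ (sbelow _) sW (definable_mono (@subsetUl _ _ _) dR)).
exists (fun i => xb x gamma (Some i)); split=> [i E dE|s si]; last first.
  exact: (xP (inl (inr (gamma, exist _ s si)))).
(* A set definable over [Cg] uses finitely many coordinates of earlier terms, so it is a level test
   and the copies pass it together with the term. *)
move: dE; rewrite /Cg setUC => /definable_finite[r [m [E' [mU dE' EE]]]].
have h j : exists p : K * W, lt p.1 gamma /\ bl p.1 p.2 = m j.
  by have [l lg [w _ e]] := mU j; exists (l, w).
have [f fP] := choice h.
pose c := LevelTest (fun j => (f j).2) dE'.
have cl j : lt ((fun j : 'I_(lt_size c) => (f j).1) j) gamma by have [] := fP j.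
have := xP (inr (LevelCond i cl)); rewrite /P /par /=.
have -> : (fun j => xb x (f j).1 None (f j).2) = m.
  by apply: funext => j; have [_ <-] := fP j.
by rewrite !EE => -[].
Qed.

Lemma mem_list_in (T : eqType) (x : T) (s : seq T) : x \in s -> List.In x s.
Proof. by elim: s => //= y s IH; rewrite inE => /orP[/eqP ->|/IH]; [left|right]. Qed.

Lemma list_in_flatten S T (g : S -> list T) (l : list S) x y :
  List.In y l -> List.In x (g y) -> List.In x (flatten (List.map g l)).
Proof.
move=> yl xy; elim: l yl => //= z l IH [->|/IH h]; apply/List.in_or_app; by [left|right].
Qed.

Lemma infinite_homogeneous (P : nat -> Prop) : exists2 g : nat -> nat, injective g &
  (forall i, P (g i)) \/ (forall i, ~ P (g i)).
Proof.
have [inf|/existsNP[n nP]] := pselect (forall n, exists m, n <= m /\ P m); last first.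
  exists (fun i => n + i); first by move=> i j /addnI.
  by right=> i Pi; apply: nP; exists (n + i); rewrite leq_addr.
have [next nextP] := choice inf.
pose g := fix g i := if i is i.+1 then next (g i).+1 else next 0.
have gP i : P (g i) by case: i => [|i] /=; [have [] := nextP 0|have [] := nextP (g i).+1].
exists g; last by left.
have glt : {homo g : i j / i < j}.
  move=> i j; have gS n : g n < g n.+1 by have [] := nextP (g n).+1.
  elim: j => // j IH; rewrite ltnS leq_eqVlt => /orP[/eqP -> //|/IH h].
  exact: ltn_trans h (gS j).
move=> i j e; case: (ltngtP i j) => // /glt; by rewrite e ltnn.
Qed.

Lemma infinite_homogeneous_list (Ps : list (nat -> Prop)) : exists2 g : nat -> nat,
  injective g & forall P, List.In P Ps -> forall i j, P (g i) <-> P (g j).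
Proof.
elim: Ps => [|P Ps [g gi gP]]; first by exists id.
have [h hi hP] := infinite_homogeneous (P \o g).
exists (g \o h) => [i j /gi /hi //|Q /= [<-|QPs] i j]; last exact: gP.
by case: hP => hP; [split=> _; apply: hP|split=> /hP].
Qed.

(** Build a branch. At each node finitely many instances of the tests are relevant, so infinitely
    many children agree on all of them; one continues the branch and all of them serve as its
    copies. Siblings are [k]-inconsistent and branches are consistent. *)
Lemma tree_level_approx m n (phi : formula L ('I_m + 'I_n)) k :
  tree_property M phi k -> level_approx set0 [set a : 'I_m + 'I_n -> M | sat a phi] k.
Proof.
move=> [bt [path incons]] N D.
pose par (nu : nat -> nat) (t : level_test (set0 : set M) 'I_n) (f : 'I_(lt_size t) -> nat) j :=
  bt (mkseq nu (f j).+1) (lt_coord t j).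
have [|||F FP] := @wf_choice nat (nat * (nat -> nat)) (fun i j => i < j) _ (0, id)
  (fun l F u => injective u.2 /\ forall t, List.In t D -> forall f, (forall j, f j < l) ->
    forall i, lt_set t (join_assign (bt (rcons (mkseq (fst \o F) l) u.1)) (par (fst \o F) t f)) <->
     lt_set t (join_assign (bt (rcons (mkseq (fst \o F) l) (u.2 i))) (par (fst \o F) t f))).
- exact: wf_ltn.
- move=> l F G u FG [ui uP]; split=> // t tD f fl i.
  have mk l' : l' <= l -> mkseq (fst \o G) l' = mkseq (fst \o F) l'.
    move=> l'l; apply/eq_in_map => j; rewrite mem_iota add0n => /andP[_ jl'] /=.
    by rewrite FG //; apply: leq_trans l'l.
  have -> : par (fst \o G) t f = par (fst \o F) t f.
    by apply: funext => j; rewrite /par mk.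
  by rewrite mk //; apply: uP.
- move=> l F _.
  pose test (t : level_test (set0 : set M) 'I_n) (f : {ffun 'I_(lt_size t) -> 'I_l}) (c : nat) : Prop :=
    lt_set t (join_assign (bt (rcons (mkseq (fst \o F) l) c))
      (par (fst \o F) t (fun j => f j : nat))).
  have [g gi gP] := infinite_homogeneous_list (flatten (List.map (fun t =>
    List.map (test t) (enum {ffun 'I_(lt_size t) -> 'I_l})) D)).
  exists (g 0, g); split=> //= t tD f fl i.
  pose f' := [ffun j => Ordinal (fl j)].
  have f'E : (fun j => f' j : nat) = f by apply: funext => j; rewrite ffunE.
  have := gP (test t f') _ 0 i; rewrite /test f'E; apply.
  apply: list_in_flatten tD _; apply/List.in_map_iff; exists f'; split.
    by rewrite /test f'E.
  by apply: mem_list_in; rewrite mem_enum.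
pose nu := fst \o F.
have [x xP] := path nu.
exists (fun l o => bt (rcons (mkseq nu l) (if o is Some i then (F l).2 i else nu l))), x.
move=> l _; have [gi gP] := FP l; split.
- by have := xP l.+1; rewrite mkseqS.
- move=> s si [x' x'P]; apply: (incons (mkseq nu l) (fun j => (F l).2 (s j))).
    by move=> i j /gi /si.
  by exists x'.
- move=> t tD f fl i; have := gP t tD f fl i.
  suff -> : (fun j => bt (rcons (mkseq nu (f j)) (nu (f j))) (lt_coord t j)) =
    par (fst \o F) t f by [].
  by apply: funext => j; rewrite /par mkseqS.
Qed.

Theorem simple_of_perp : simple M.
Proof.
move=> m n phi k _ /tree_level_approx; apply: no_level_approx; last exact: definable_formula.
- exact: smallT_set0.
- exact: smallT_countable.
- exact: smallT_countable.
Qed.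

(** * Forking, dividing and symmetry of non-forking *)

Lemma independent_sequence W (d : W -> M) C : sm W -> sm C ->
  exists dd : nat -> W -> M, forall i, same_type C d (dd i) /\
    nonfork (dd i) C (\bigcup_(j in [set j | j < i]) range (dd j)).
Proof.
move=> sW sC.
have sU (f : nat -> W -> M) i : sm (\bigcup_(j in [set j | j < i]) range (f j)).
  apply: smallT_bigcup => // [|j _]; last exact: smallT_range.
  exact: smallT_emb (emb_set _) (smallT_nat inaccK).
apply: (@wf_choice nat (W -> M) (fun i j => i < j) _ (fun=> m0)
  (fun i f u => same_type C d u /\ nonfork u C (\bigcup_(j in [set j | j < i]) range (f j)))).
- exact: wf_ltn.
- move=> i f g u fg [u1 u2]; split=> //.
  suff <- : \bigcup_(j in [set j | j < i]) range (f j) =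
    \bigcup_(j in [set j | j < i]) range (g j) by [].
  by apply: eq_bigcupr => j ji; rewrite fg.
- move=> i f _.
  have [s sC'] := perp_existence (smallT_range d sW) sC (sU f i).
  rewrite range_comp => /(perp_nonfork sW sC (sU f i)) h.
  by exists (s \o d); split=> //; apply: same_type_automorphism.
Qed.

(** Take an independent sequence in the type of all the parameters [d]. A common realisation of many
    conjugates of [S] picks a covering set for each; some set is picked as often as
    [nondiv_sequence_bound] forbids. *)
Theorem nondiv_nonfork V (a : V -> M) C B : sm V -> sm C -> sm B -> nondiv a C B -> nonfork a C B.
Proof.
move=> sV sC sB nda S dS Sa [l [l1 l2]].
have [P [sP PP]] := list_params (fun Q Ql => (l1 Q Ql).1).
pose W := (P `|` B : set M); pose d := fun x : W => set_val x.
have rd : range d = P `|` B by exact: range_set_val.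
have sW : sm W by exact: smallT_setU.
have unf (Q : set (V -> M)) : definable (P `|` B `|` C) Q ->
    exists2 R : set (V + W -> M), definable C R & forall a, Q a <-> R (join_assign a d).
  by move=> dQ; apply: definable_unfiber; rewrite rd.
have [RS dRS RSE] : exists2 R : set (V + W -> M), definable C R & forall a, S a <-> R (join_assign a d).
  by apply: unf; apply: definable_mono dS => x [Bx|Cx]; [left; right|right].
pose bnd (Q : set (V -> M)) n := exists R : set (V + W -> M),
  [/\ definable C R, forall a, Q a <-> R (join_assign a d) & forall aa : nat -> W -> M,
    (forall i, i < n -> same_type C d (aa i) /\
      nondiv (aa i) C (\bigcup_(j in [set j | j < i]) range (aa j))) ->
    ~ exists x : V -> M, forall i, i < n -> R (join_assign x (aa i))].
have [||N NP] := @list_nat_bound _ bnd l.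
- move=> Q n m nm [R [dR RE h]]; exists R; split=> // aa aaP [x xP].
  apply: (h aa) => [i ni|]; first by apply: aaP; apply: leq_trans nm.
  by exists x => i ni; apply: xP; apply: leq_trans nm.
- move=> Q Ql; have [_ [k dv]] := l1 Q Ql.
  have [|R dR RE] := unf Q; first by apply: definable_mono (PP Q Ql) => x Px; left; left.
  have EQ : Q = [set a : V -> M | R (join_assign a d)].
    by apply: funext => a'; apply/propext.
  rewrite EQ in dv.
  have nla := no_level_approx (k := k) sC sV sW dR.
  have [n nP] := nondiv_sequence_bound inaccK satM homM m0 sC sW dR nla dv.
  by exists n, R.
have [dd ddP] := independent_sequence d sW sC.
(* With this many terms, one of the [size l] covering sets is picked at least [N] times. *)
pose k := (size l * N).+1.
have [s [si [x xP]]] : exists s : 'I_k -> nat, injective s /\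
    exists x : V -> M, forall j, RS (join_assign x (dd (s j))).
  apply: contrapT => /forallNP nx; apply: (nda S dS Sa); exists k.
  have -> : S = [set a : V -> M | RS (join_assign a d)].
    by apply: funext => a'; apply/propext.
  apply/(divides_byE inaccK homM k d sC sW dRS).
  exists dd; split=> [i|s si ex]; first by have [] := ddP i.
  by apply: (nx s).
have col (j : 'I_k) : exists q : 'I_(size l), exists2 R : set (V + W -> M),
    R (join_assign x (dd (s j))) & definable C R /\
      forall a, nth setT l q a <-> R (join_assign a d).
  have [ed _] := ddP (s j).
  have [t tC td] := homogeneous inaccK homM sC sW ed.
  have [t' [t'C tt' t't]] := automorphism_over_inv tC.
  have /l2[Q Ql Qx] : S (t' \o x).
    by apply/RSE; apply/(definable_move _ _ dRS t'C t't); rewrite td.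
  have [q qE] : exists q : 'I_(size l), nth setT l q = Q.
    elim: l Ql {l1 l2 PP NP k s si xP j ed td} => //= Q' l IH [->|/IH[q <-]].
      by exists ord0.
    by exists (lift ord0 q).
  have [R [dR RE _]] := NP Q Ql.
  exists q, R; last by rewrite qE.
  by rewrite -td; apply/(definable_move _ _ dR t'C t't); apply/RE.
have [c cP] := choice col.
have [q qN] : exists q, N <= #|[pred j | c j == q]|.
  apply: contrapT => /forallNP nq.
  have : \sum_q #|[pred j | c j == q]| = #|'I_k|.
    rewrite -sum1_card (partition_big c predT) //=; apply: eq_bigr => q _.
    by rewrite -sum1_card; apply: eq_bigl => j; rewrite inE.
  have : \sum_(q < size l) #|[pred j | c j == q]| <= \sum_(q < size l) N.
    by apply: leq_sum => q _; apply: ltnW; rewrite ltnNge; apply/negP.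
  by rewrite sum_nat_const !card_ord => h e; move: h; rewrite e /k; lia.
have [R [dR RE h]] := NP _ (list_in_nth setT q).
(* Increasing order keeps each selected term non-dividing from the selected terms before it. *)
pose t := sort leq [seq s j | j <- enum [pred j | c j == q]].
have st : size t = #|[pred j | c j == q]| by rewrite size_sort size_map -cardE.
have tlt i j : i < j -> j < size t -> nth 0 t i < nth 0 t j.
  have : sorted ltn t.
    rewrite ltn_sorted_uniq_leq sort_uniq map_inj_uniq ?enum_uniq //.
    by apply: sort_sorted; apply: leq_total.
  move=> /(sorted_ltn_nth ltn_trans 0) srt ij jt; apply: srt => //.
  by rewrite inE; apply: ltn_trans jt.
apply: (h (fun i => dd (nth 0 t i))) => [i iN|].
  have it : i < size t by rewrite st; apply: leq_trans qN.
  have [e1 /nonfork_nondiv e2] := ddP (nth 0 t i); split=> //.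
  apply: nondiv_mono e2 => // y [[j /= ji dj]|Cy]; [left|by right].
  by exists (nth 0 t j) => //=; apply: tlt.
exists x => i iN.
have it : i < size t by rewrite st; apply: leq_trans qN.
have : nth 0 t i \in [seq s j | j <- enum [pred j | c j == q]].
  by rewrite -(mem_sort leq); apply: mem_nth.
move=> /mapP[j]; rewrite mem_enum inE => /eqP cj ->.
(* [R] and [R'] come from separate choices but have the same fibre over [d], hence over every
   conjugate of [d]. *)
have [R' R'x [dR' R'E]] := cP j.
have [ed _] := ddP (s j).
have [u uC ud] := homogeneous inaccK homM sC sW ed.
have [u' [u'C uu' u'u]] := automorphism_over_inv uC.
rewrite -ud; apply/(definable_move _ _ dR u'C u'u); apply/RE; rewrite -cj; apply/R'E.
by apply/(definable_move _ _ dR' u'C u'u); rewrite ud.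
Qed.

(** Non-forking extensions give realisations [aa i] of the type of [a] over [C] and [b], each
    non-forking over [C] from the preceding ones. As [b] satisfies the formula at every [aa i], the
    sequence bound excludes dividing. *)
Theorem nonfork_nondiv_sym V W (a : V -> M) (b : W -> M) C : sm V -> sm W -> sm C ->
  nonfork a C (range b) -> nondiv b C (range a).
Proof.
move=> sV sW sC nfa S dS Sb [k dv].
have [R dR RE] := definable_unfiber dS.
have ES : S = [set b : W -> M | R (join_assign b a)].
  by apply: funext => b'; apply/propext.
rewrite ES in dv.
have nla := no_level_approx (k := k) sC sW sV dR.
have [n nP] := nondiv_sequence_bound inaccK satM homM m0 sC sV dR nla dv.
have sb : sm (range b) by exact: smallT_range.
have sU (f : nat -> V -> M) i : sm (range b `|` \bigcup_(j in [set j | j < i]) range (f j)).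
  apply: smallT_setU => //; apply: smallT_bigcup => // [|j _]; last exact: smallT_range.
  exact: smallT_emb (emb_set _) (smallT_nat inaccK).
have [|||aa aaP] := @wf_choice nat (V -> M) (fun i j => i < j) _ (fun=> m0)
  (fun i f u => same_type (range b `|` C) a u /\
    nonfork u C (range b `|` \bigcup_(j in [set j | j < i]) range (f j))).
- exact: wf_ltn.
- move=> i f g u fg [u1 u2]; split=> //.
  suff <- : \bigcup_(j in [set j | j < i]) range (f j) =
    \bigcup_(j in [set j | j < i]) range (g j) by [].
  by apply: eq_bigcupr => j ji; rewrite fg.
- move=> i f _.
  by have [u [u1 u2]] := nonfork_extension inaccK satM m0 sV sC sb (sU f i) (@subsetUl _ _ _) nfa;
    exists u.
apply: (nP aa) => [i _|]; last first.
  exists b => i _; have [e _] := aaP i.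
  have dR' : definable (range b `|` C) [set a : V -> M | R (join_assign b a)].
    apply: (definable_pre dR) => [x|[w|v]]; [by right| |by left; exists v].
    by right; exists (b w) => //; left; exists w.
  by apply: (e _ dR'); apply/RE.
have [e /nonfork_nondiv h] := aaP i; split; first by apply: same_type_mono e; apply: subsetUr.
by apply: nondiv_mono h => // x [Ux|Cx]; [left; right|right].
Qed.

Theorem nonfork_sym V W (a : V -> M) (b : W -> M) C : sm V -> sm W -> sm C ->
  nonfork a C (range b) -> nonfork b C (range a).
Proof.
move=> sV sW sC h; apply: nondiv_nonfork => //; [exact: smallT_range|exact: nonfork_nondiv_sym].
Qed.

(** * Symmetry of the given relation *)

Section Symmetric.
Hypothesis perp_fin : finite_character K perp.
Hypothesis perp_norm : left_normality K perp.
Hypothesis perp_tran : left_transitivity K perp.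

Lemma perp_left_trans (A E C B : set M) : sm A -> sm E -> sm C -> sm B ->
  perp E C B -> perp A (C `|` E) B -> perp (A `|` (C `|` E)) C B.
Proof.
move=> sA sE sC sB pE pA.
have sCE : sm (C `|` E) by exact: smallT_setU.
have pCE : perp (C `|` E) C B by rewrite setUC; apply: perp_norm => //; apply/smE.
have pD : perp (A `|` (C `|` E)) (C `|` E) B by apply: perp_norm => //; apply/smE.
apply: perp_tran pCE pD; try apply/smE => //.
- exact: smallT_setU.
- exact: subsetUl.
- exact: subsetUr.
Qed.

Definition before W (f : K -> W -> M) (i : K) : set M :=
  \bigcup_(j in [set j | lt j i]) range (f j).

Lemma before_congr W (f g : K -> W -> M) i : (forall j, lt j i -> f j = g j) ->
  before f i = before g i.
Proof. by move=> fg; apply: eq_bigcupr => j ji; rewrite fg. Qed.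

Lemma small_before W (f : K -> W -> M) i : sm W -> sm (before f i).
Proof. by move=> sW; apply: small_below => j _; apply: smallT_range. Qed.

Lemma cofinal_perp A C W (f : K -> W -> M) delta : sm A -> sm C -> sm W ->
  cofinal_for A delta ->
  (forall i, lt i delta -> perp (before f i) C (range (f i))) ->
  exists2 gamma, lt gamma delta & perp A C (range (f gamma)).
Proof.
move=> sA sC sW cof pf.
have sF i : sm (range (f i)) by exact: smallT_range.
have [gamma gd pA] := cof C (fun i => range (f i)) sC (fun i _ => sF i).
exists gamma => //.
have sE i : sm (before f i) by exact: small_before.
have sCE i : sm (C `|` before f i) by exact: smallT_setU.
have {}pA : perp A (C `|` before f gamma) (range (f gamma)).
  apply: (perp_right sA (sCE _) (sCE delta) _ pA) => x fx; right.
  by exists gamma.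
apply: (perp_left _ sC (sF gamma) (@subsetUl _ A (C `|` before f gamma))).
  exact: smallT_setU.
by apply: perp_left_trans => //; apply: pf.
Qed.

(** A finite subset lies in the part up to its last term. With finite character this treats
    successor and limit stages of the recursion in [perp_sym] alike. *)
Lemma before_finite W (f : K -> W -> M) i (a : set M) : finite_set a ->
  a `<=` before f i -> a = set0 \/
  exists2 j, lt j i & a `<=` before f j `|` range (f j).
Proof.
move=> fa ai; have [s sE] := (finite_seqP (a : set {classic M})).1 fa.
have h (x : M) : exists j, a x -> lt j i /\ range (f j) x.
  have [ax|nax] := pselect (a x); last by exists i.
  by have [j ji fx] := ai x ax; exists j.
have [g gP] := choice h.
have tot := io_total io; have tr := io_trans io.
have [n|[m [ml _ mP]]] := list_max tot tr (fun=> True) (List.map g s).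
  left; rewrite sE; case: s sE n => [|x s] sE n; first by apply/seteqP; split.
  by exfalso; apply: (n (g x)) => //; left.
right; exists m.
  have /List.in_map_iff[x [<- xs]] := ml.
  have : a x.
    rewrite sE /=; elim: (s) xs => //= y s' IH [->|/IH]; rewrite inE ?eqxx //.
    by move=> ->; rewrite orbT.
  by move=> /gP[].
move=> x ax; have [gi fx] := gP x ax.
have : List.In (g x) (List.map g s).
  apply/List.in_map_iff; exists x; split=> //; move: ax; rewrite sE /=.
  by elim: (s) => //= y s' IH; rewrite inE => /orP[/eqP ->|/IH]; [left|right].
by move=> /mP[//|gm|<-]; [left; exists (g x)|right].
Qed.

(* Build [f] with [before f i] independent from [A] and [f i]; finite character
   carries independence from [A] through limits, and local character of [A]
   applied to the sequence turns it around. *)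
Theorem perp_sym A B C : sm A -> sm B -> sm C -> perp B C A -> perp A C B.
Proof.
move=> sA sB sC pBA.
pose b := fun x : B => set_val x.
have rb : range b = B by exact: range_set_val.
have sR (u : B -> M) : sm (range u) by exact: smallT_range.
pose P i (f : K -> B -> M) (u : B -> M) := same_type (C `|` A) b u /\
  perp (before f i) C ((A `|` range u) `|` C).
have sCA : sm (C `|` A) by exact: smallT_setU.
(* Up to the last term [f j] met by a finite subset, left transitivity combines independence of
   [f j] from [A] with that of the earlier terms over [C] and [f j], obtained from [P j] by base
   monotonicity. *)
have limit (f : K -> B -> M) i : (forall j, lt j i -> P j f (f j)) -> perp (before f i) C A.
  move=> fP; have sE k := small_before f k sB.
  apply: perp_fin; try exact/smE.
  move=> a fa ai; have [->|[j ji aj]] := before_finite fa ai.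
    by apply: (perp_left sB sC sA _ pBA).
  have [ebf pj] := fP j ji.
  have [s sCA' sb] := homogeneous inaccK homM sCA sB ebf.
  have pfj : perp (range (f j)) C A.
    rewrite -sb -range_comp rb.
    rewrite -{1}(automorphism_over_image (automorphism_over_mono (@subsetUl _ C A) sCA')).
    rewrite -{1}(automorphism_over_image (automorphism_over_mono (@subsetUr _ C A) sCA')).
    by have [saut _] := sCA'; apply/(perp_image saut sB sC sA).
  have sD : sm ((A `|` range (f j)) `|` C) by do 2?[apply: smallT_setU => //].
  have sCf : sm (C `|` range (f j)) by exact: smallT_setU.
  have pj' : perp (before f j) (C `|` range (f j)) A.
    apply: (perp_right (sE j) sCf sD); first by move=> x Ax; left; left.
    by apply: perp_base pj => // x [Cx|fx]; [right|left; right].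
  have := perp_left_trans (sE j) (sR (f j)) sC sA pfj pj'.
  apply: perp_left => //; first exact: smallT_setU.
  by move=> x /aj[fx|fx]; [left|right; right].
have [||f fP] := @wf_choice K (B -> M) lt (io_wf io) (fun=> m0) P.
- move=> i f g u fg [u1 u2]; split=> //.
  by rewrite -(before_congr (f := f) (g := g) fg).
- move=> i f fP; have pE := limit f i fP.
  have sE := small_before f i sB.
  have sD : sm (A `|` (B `|` C)) by do 2?[apply: smallT_setU => //].
  have [s sAC ps] := perp_extension sE sC sA sD (@subsetUl _ _ _) pE.
  (* Extension moves the terms already built. The inverse puts them back and moves [b] instead. *)
  have [t [tAC st ts]] := automorphism_over_inv sAC.
  exists (t \o b); split.
    by rewrite setUC; apply: same_type_automorphism.
  have taut : automorphism t by have [] := tAC.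
  have := (perp_image taut (smallT_image s sE) sC sD).1 ps.
  have -> : t @` (s @` before f i) = before f i.
    apply/seteqP; split=> [x [y [z fz <-] <-]|x fx]; first by rewrite st.
    by exists (s x); [exists x|rewrite st].
  rewrite (automorphism_over_image (automorphism_over_mono (@subsetUr _ A C) tAC)).
  apply: perp_right => //; first exact: smallT_image.
  move=> x [[Ax|[w _ <-]]|Cx].
  + exists x; first by left.
    by have [_ ->] := tAC => //; left.
  + by exists (b w) => //; right; left; exact: set_val_in.
  + exists x; first by right; right.
    by have [_ ->] := tAC => //; right.
have [delta cof] := cofinal_exists sA.
have [|gamma gd pA] := @cofinal_perp A C B f delta sA sC sB cof.
  move=> i _; have [_ pi] := fP i.
  apply: perp_right pi; [exact: small_before|by []| |].
    by do 2?[apply: smallT_setU => //].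
  by move=> x fx; left; right.
have [ebf _] := fP gamma.
have [s sCA' sb] := homogeneous inaccK homM sCA sB ebf.
have [saut _] := sCA'; apply/(perp_image saut sA sC sB).
rewrite (automorphism_over_image (automorphism_over_mono (@subsetUl _ C A) sCA')).
rewrite (automorphism_over_image (automorphism_over_mono (@subsetUr _ C A) sCA')).
by rewrite -{1}rb range_comp sb.
Qed.

(** * Coheirs over a model, and the converse inclusion *)

Section Coheir.
Variables (N : set M) (V : Type) (U : set (set (V -> M))).
Hypothesis sN : sm N.
Hypothesis sV : sm V.
Hypothesis ultraU : UltraFilter U.
Hypothesis UN : U [set y : V -> M | forall v, N (y v)].

(* [y] realises over [D] the global type defined by the ultrafilter [U]. *)
Definition realises_ultra (y : V -> M) (D : set M) : Prop :=
  forall S, definable D S -> U S -> S y.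

Lemma realises_ultraE y D S : realises_ultra y D -> definable D S -> S y <-> U S.
Proof.
move=> yD dS; split=> [Sy|]; last exact: yD.
have [//|US] := in_ultra_setVsetC S ultraU.
by have := yD _ (definableC dS) US.
Qed.

Lemma realises_ultra_mono y (D D' : set M) : D `<=` D' ->
  realises_ultra y D' -> realises_ultra y D.
Proof. by move=> DD h S dS; apply: h; apply: definable_mono dS. Qed.

Lemma realises_ultra_exists D : sm D -> exists y, realises_ultra y D.
Proof.
move=> sD; pose T : Type := [set S : set (V -> M) | definable D S /\ U S].
have [|l|y yP] := @compactness _ _ _ inaccK satM m0 V T D (fun S => set_val S)
    (small_emb sV) sD.
- by move=> S; have [] := set_val_in S.
- suff /filter_ex[y yl] : U [set y : V -> M | forall S : T, List.In S l -> set_val S y].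
    by exists y.
  elim: l => [|S l IH]; first by apply: filterS filterT => y _ S [].
  have [_ US] := set_val_in S.
  apply: filterS (filterI US IH) => y [Sy ly] S' /= [<- //|]; exact: ly.
- exists y => S dS US.
  exact: (yP (sub_elt (conj dS US : [set S | definable D S /\ U S] S))).
Qed.

(** Global coheirs are invariant: [U] concentrates on tuples [z] of [N], and for these the fibre of
    [S] at [z] is definable over [N], so only the type of [d] matters. *)
Lemma realises_ultra_same_type W (y y' : V -> M) (d d' : W -> M) :
  realises_ultra y (N `|` range d) -> realises_ultra y' (N `|` range d') ->
  same_type N d d' -> same_type N (join_assign y d) (join_assign y' d').
Proof.
move=> yd yd' dd' S dS Sy.
have dF e : definable (N `|` range e) [set y : V -> M | S (join_assign y e)].
  by apply: (definable_fiber dS); [exact: subsetUr|exact: subsetUl].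
apply/(realises_ultraE yd' (dF d')).
have := (realises_ultraE yd (dF d)).1 Sy => USy.
apply: filterS (filterI USy UN) => z [/= Szd Nz].
apply: (dd' [set d : W -> M | S (join_assign z d)]) => //.
by apply: (definable_pre dS) => // -[v|w]; [right; exists (z v)|left; exists w].
Qed.

Lemma realises_ultra_eqv0 y y' : realises_ultra y N -> realises_ultra y' N -> same_type N y y'.
Proof. by move=> yN y'N S dS /(realises_ultraE yN dS); apply: y'N. Qed.

(** Conjugates [f i] of [d], each with its predecessors independent from it, make a realisation [y']
    of the coheir independent from some [f gamma]. By invariance this pair is conjugate to [y],
    [d]. *)
Theorem coheir_perp W (y : V -> M) (d : W -> M) : sm W ->
  realises_ultra y (N `|` range d) -> perp (range y) N (range d).
Proof.
move=> sW yd.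
have sr (u : W -> M) : sm (range u) by exact: smallT_range.
have [||f fP] := @wf_choice K (W -> M) lt (io_wf io) (fun=> m0)
    (fun i f u => same_type N d u /\ perp (before f i) N (range u)).
- move=> i f g u fg [u1 u2]; split=> //.
  by rewrite -(before_congr (f := f) (g := g) fg).
- move=> i f _; have sE := small_before f i sW.
  have [s sN' ps] := perp_existence sE sN (sr d).
  have [t [tN st ts]] := automorphism_over_inv sN'.
  exists (t \o d); split; first exact: same_type_automorphism.
  have taut : automorphism t by have [] := tN.
  have := (perp_image taut (smallT_image s sE) sN (sr d)).1 ps.
  have -> : t @` (s @` before f i) = before f i.
    apply/seteqP; split=> [x [z [w fw <-] <-]|x fx]; first by rewrite st.
    by exists (s x); [exists x|rewrite st].
  by rewrite (automorphism_over_image tN) range_comp.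
have sy : sm (range y) by exact: smallT_range.
have [delta cof] := cofinal_exists sy.
have sD : sm (N `|` before f delta) by apply: smallT_setU => //; apply: small_before.
have [y' y'D] := realises_ultra_exists sD.
have eyy' : same_type N y y'.
  apply: realises_ultra_eqv0; first by apply: realises_ultra_mono yd; apply: subsetUl.
  by apply: realises_ultra_mono y'D; apply: subsetUl.
have [s [saut _] sy'] := homogeneous inaccK homM sN sV eyy'.
have cof' : cofinal_for (range y') delta.
  by rewrite -sy' -range_comp; apply: cofinal_for_image.
have sy'' : sm (range y') by exact: smallT_range.
have [|gamma gd py'] := @cofinal_perp (range y') N W f delta sy'' sN sW cof'.
  by move=> i _; have [] := fP i.
have [dfg _] := fP gamma.
have e : same_type N (join_assign y d) (join_assign y' (f gamma)).
  apply: realises_ultra_same_type dfg => //; apply: realises_ultra_mono y'D.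
  by apply: setUS => x fx; exists gamma.
have sVW : sm (V + W) by exact: smallT_sum.
have [t tN te] := homogeneous inaccK homM sN sVW e.
have [taut _] := tN; apply/(perp_image taut sy sN (sr d)).
rewrite (automorphism_over_image tN) !range_comp.
have -> : t \o y = y' by apply: funext => v; exact: (congr1 (@^~ (inl v)) te).
by have -> : t \o d = f gamma by apply: funext => w; exact: (congr1 (@^~ (inr w)) te).
Qed.

Lemma morley_same_type n (h h' : nat -> V -> M) :
  (forall i, i < n -> realises_ultra (h i) (N `|` \bigcup_(j in [set j | j < i]) range (h j))) ->
  (forall i, i < n -> realises_ultra (h' i) (N `|` \bigcup_(j in [set j | j < i]) range (h' j))) ->
  same_type N (fun p : 'I_n * V => h p.1 p.2) (fun p : 'I_n * V => h' p.1 p.2).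
Proof.
elim: n => [|n IH] hP hP'.
  by move=> S dS; congr S; apply: funext => -[[]].
have e1 := IH (fun i ni => hP i (ltnW ni)) (fun i ni => hP' i (ltnW ni)).
have r (g : nat -> V -> M) : range (fun p : 'I_n * V => g p.1 p.2) `<=`
    \bigcup_(j in [set j | j < n]) range (g j).
  by move=> x [[i v] _ <-]; exists i => //=; exists v.
have := realises_ultra_same_type (realises_ultra_mono (setUS (r h)) (hP n (leqnn _)))
  (realises_ultra_mono (setUS (r h')) (hP' n (leqnn _))) e1.
pose f (p : 'I_n.+1 * V) : V + 'I_n * V := match insub (p.1 : nat) with
  | Some i => inr (i, p.2) | None => inl p.2 end.
have E (g : nat -> V -> M) :
    join_assign (g n) (fun p : 'I_n * V => g p.1 p.2) \o f = (fun p => g p.1 p.2).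
  apply: funext => -[i w]; rewrite /f /=; case: insubP => [j jm je|im] /=.
    by rewrite je.
  congr (g _ w); apply/eqP; rewrite eqn_leq leqNgt im.
  by rewrite -ltnS ltn_ord.
by move=> /(@same_type_comp _ _ _ _ _ f); rewrite !E.
Qed.

End Coheir.

(** The traces on [N] of the sets in the type of [b] are inhabited, because [N] is elementary, and
    closed under intersection. An ultrafilter containing them is a global coheir. *)
Lemma coheir_exists N V (b : V -> M) : elementary_substructure N ->
  exists U : set (set (V -> M)), [/\ UltraFilter U,
    U [set y : V -> M | forall v, N (y v)] & forall S, definable N S -> S b -> U S].
Proof.
move=> elN.
pose F : set (set (V -> M)) := [set S | exists S0, [/\ definable N S0, S0 b &
  forall y, (forall v, N (y v)) -> S0 y -> S y]].
have PF : ProperFilter F.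
  split; last split.
  - move=> [S0 [dS0 S0b h]].
    have [|y S0y Ny] := elementary_realised m0 elN dS0; first by exists b.
    exact: h Ny S0y.
  - by exists setT; split=> //; apply: definable_ext (definableTrue _ _ True).
  - move=> P Q [S1 [d1 b1 h1]] [S2 [d2 b2 h2]].
    exists [set y : V -> M | S1 y /\ S2 y]; split=> //; first exact: definableAnd.
    by move=> y Ny [y1 y2]; split; [apply: h1|apply: h2].
  - move=> P Q PQ [S0 [d0 b0 h]]; exists S0; split=> // y Ny /(h y Ny); exact: PQ.
have [U [uU FU]] := @ultraFilterLemma _ F PF.
exists U; split=> //.
  by apply: FU; exists setT; split=> //; apply: definable_ext (definableTrue _ _ True).
by move=> S dS Sb; apply: FU; exists S; split.
Qed.

(** Two sequences of the same coheir are needed: [f] of length [K] for local character, and [g] of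
    length omega for the definition of dividing. Indiscernibility carries consistency from [g] to
    [f]. *)
Lemma nondiv_perp_model N V W (a : V -> M) (b : W -> M) : sm N -> sm V -> sm W ->
  elementary_substructure N -> nondiv a N (range b) -> perp (range a) N (range b).
Proof.
move=> sN sV sW elN nda.
have [U [ultraU UN Ub]] := coheir_exists b elN.
have sra : sm (range a) by exact: smallT_range.
have srb : sm (range b) by exact: smallT_range.
have [||f fP] := @wf_choice K (W -> M) lt (io_wf io) (fun=> m0)
    (fun i f u => realises_ultra U u (N `|` before f i)).
- by move=> i f g u fg; rewrite (before_congr (f := f) (g := g) fg).
- move=> i f _; apply: realises_ultra_exists => //.
  by apply: smallT_setU => //; apply: small_before.
have pf i : perp (before f i) N (range (f i)).
  have sE := small_before f i sW.
  apply: perp_sym => //; first exact: smallT_range.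
  have h : range (fun x : before f i => set_val x) = before f i by exact: range_set_val.
  rewrite -h; by apply: (coheir_perp sN sW ultraU UN) => //; rewrite h.
have sbelow (g : nat -> W -> M) i : sm (N `|` \bigcup_(j in [set j | j < i]) range (g j)).
  apply: smallT_setU => //; apply: smallT_bigcup => // [|j _]; last exact: smallT_range.
  exact: smallT_emb (emb_set _) (smallT_nat inaccK).
have [|||g gP] := @wf_choice nat (W -> M) (fun i j => i < j) _ (fun=> m0)
    (fun i g u => realises_ultra U u (N `|` \bigcup_(j in [set j | j < i]) range (g j))).
- exact: wf_ltn.
- move=> i g g' u gg'; suff -> : \bigcup_(j in [set j | j < i]) range (g j) =
    \bigcup_(j in [set j | j < i]) range (g' j) by [].
  by apply: eq_bigcupr => j ji; rewrite gg'.
- by move=> i g _; apply: realises_ultra_exists.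
have gb i : same_type N b (g i).
  by move=> S dS Sb; apply: (gP i); [apply: definable_mono dS; apply: subsetUl|apply: Ub].
have [delta cof] := cofinal_exists sra.
pose T := ([set R : set (V + W -> M) | definable N R /\ R (join_assign a b)] *
  [set i | lt i delta])%type.
pose P (t : T) := [set x : V -> M | set_val t.1 (join_assign x (f (set_val t.2)))].
have sD : sm (N `|` before f delta) by apply: smallT_setU => //; apply: small_before.
have [|l|a' a'P] := @compactness _ _ _ inaccK satM m0 V T (N `|` before f delta) P
    (small_emb sV) sD.
- move=> [R i]; have [dR _] := set_val_in R.
  apply: (definable_fiber dR); last exact: subsetUl.
  move=> x fx; right; exists (set_val i) => //; exact: set_val_in i.
- pose E (t : T) := set_val t.1.
  have dE t : definable N (E t) by have [] := set_val_in t.1.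
  pose R := [set e : V + W -> M | forall t, List.In t l -> E t e].
  have dR : definable N R by exact: definableAllList.
  pose le (x y : {classic K}) := `[< lt x y \/ x = y >].
  pose keys := sort le (undup [seq set_val t.2 : {classic K} | t <- l]).
  pose k := size keys.
  have [i0|nk] := pselect (exists i0 : K, True); last first.
    case: l {R dR keys k} => [|t l]; first by exists a.
    by case: nk; exists (set_val t.2).
  case: i0 => i0 _.
  have keys_lt i j : i < j -> j < k -> lt (nth i0 keys i) (nth i0 keys j).
    move=> ij jk.
    have le_trans : transitive le.
      move=> y x z /asboolP[xy|->] // /asboolP[yz|<-]; apply/asboolP; left=> //.
      exact: (io_trans io) yz.
    have : sorted le keys.
      apply: sort_sorted => x y.
      by case: (io_total io x y) => h; apply/orP; [left|left|right]; apply/asboolP;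
        [left|right|left].
    move=> /(sorted_ltn_nth le_trans (i0 : {classic K})) srt.
    have ik : i < k := ltn_trans ij jk.
    have /asboolP[//|e] := srt i j ik jk ij.
    have uk : uniq keys by rewrite sort_uniq undup_uniq.
    by have := nth_uniq (i0 : {classic K}) ik jk uk; rewrite e eqxx => /esym/eqP ji;
      move: ij; rewrite ji ltnn.
  have [s [si [x xP]]] : exists s : 'I_k -> nat, injective s /\
      exists x : V -> M, forall j, R (join_assign x (g (s j))).
    apply: contrapT => /forallNP nx.
    apply: (nda [set x : V -> M | R (join_assign x b)]).
    - by apply: (definable_fiber dR); [exact: subsetUl|exact: subsetUr].
    - by move=> t _; have [] := set_val_in t.1.
    exists k; apply/(divides_byE inaccK homM k b sN sW dR); exists g; split=> // s si ex.
    by apply: (nx s).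
  (* All terms satisfy the same [R] with [x], so their order is free; [morley_same_type] compares
     increasing tuples. *)
  pose t := sort leq [seq s j | j <- enum 'I_k].
  have st : size t = k by rewrite size_sort size_map -cardE card_ord.
  have tlt i j : i < j -> j < k -> nth 0 t i < nth 0 t j.
    have : sorted ltn t.
      rewrite ltn_sorted_uniq_leq sort_uniq map_inj_uniq ?enum_uniq //.
      by apply: sort_sorted; apply: leq_total.
    move=> /(sorted_ltn_nth ltn_trans 0) srt ij jt; apply: srt; rewrite ?inE ?st //.
    exact: ltn_trans jt.
  have e : same_type N (fun p : 'I_k * W => g (nth 0 t p.1) p.2)
      (fun p : 'I_k * W => f (nth i0 keys p.1) p.2).
    apply: (@morley_same_type N W U ultraU UN k (fun i => g (nth 0 t i))
      (fun i => f (nth i0 keys i))).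
      move=> i ik; apply: realises_ultra_mono (gP (nth 0 t i)).
      apply: setUS => y [j /= ji gy]; exists (nth 0 t j) => //=; exact: tlt.
    move=> i ik; apply: realises_ultra_mono (fP (nth i0 keys i)).
    apply: setUS => y [j /= ji gy]; exists (nth i0 keys j) => //=; exact: keys_lt.
  have dEx : definable N [set c : 'I_k * W -> M | exists x : V -> M, forall i : 'I_k,
      R (join_assign x (fun w => c (i, w)))].
    have dAll : definable N [set c : 'I_k * W + V -> M | forall i : 'I_k,
        R (join_assign (fun v => c (inr v)) (fun w => c (inl (i, w))))].
      apply: definableAll => i; apply: (definable_pre dR) => // -[v|w]; left; first by exists (inr v).
      by exists (inl (i, w)).
    apply: definable_ext (definable_proj m0 dAll) => c /=.
    by split=> -[z zP]; exists z.
  have [|z zP] := e _ dEx.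
    exists x => i /=.
    have : nth 0 t i \in [seq s j | j <- enum 'I_k].
      by rewrite -(mem_sort leq); apply: mem_nth; rewrite st.
    by move=> /mapP[j _ ->]; apply: xP.
  exists z => u ul; rewrite /P /=.
  have uk : (set_val u.2 : {classic K}) \in keys.
    rewrite mem_sort mem_undup.
    elim: (l) ul => //= u' l' IH [->|/IH h]; rewrite inE ?eqxx //.
    by rewrite h orbT.
  have ik : index (set_val u.2 : {classic K}) keys < k by rewrite index_mem.
  have ni : nth (i0 : K) keys (index (set_val u.2 : {classic K}) keys) = set_val u.2.
    exact: (@nth_index {classic K}).
  by have := zP (Ordinal ik) u ul; rewrite /= ni.
have aE gamma : lt gamma delta -> same_type N (join_assign a b) (join_assign a' (f gamma)).
  move=> gd R dR Rab.
  exact: (a'P (sub_elt (conj dR Rab : [set R | definable N R /\ R (join_assign a b)] R),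
    sub_elt (gd : [set i | lt i delta] gamma))).
(* A trivial sequence, only to obtain an index below [delta]. It shows that [a'] is a conjugate of
   [a] and inherits its [delta]. *)
have [g0 g0d _] := cof set0 (fun=> set0) (smallT_set0 inaccK _) (fun _ _ => smallT_set0 inaccK _).
have [s [saut _] sa] := homogeneous inaccK homM sN sV (same_type_join_l (aE g0 g0d)).
have cof' : cofinal_for (range a') delta.
  by rewrite -sa -range_comp; apply: cofinal_for_image.
have sra' : sm (range a') by exact: smallT_range.
have [|gamma gd pa'] := @cofinal_perp (range a') N W f delta sra' sN sW cof'.
  by move=> i _; apply: pf.
have sVW : sm (V + W) by exact: smallT_sum.
have [t tN te] := homogeneous inaccK homM sN sVW (aE gamma gd).
have [taut _] := tN; apply/(perp_image taut sra sN srb).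
rewrite (automorphism_over_image tN) !range_comp.
have -> : t \o a = a' by apply: funext => v; exact: (congr1 (@^~ (inl v)) te).
by have -> : t \o b = f gamma by apply: funext => w; exact: (congr1 (@^~ (inr w)) te).
Qed.

(** The type of [N] does not divide over [C] from [a] and [b], so left transitivity makes [a] with
    [N] non-dividing from [b]. Symmetry of non-forking, used twice, moves [N] into the base, where
    the case of a model applies. Left transitivity of [perp] then returns to [C]. *)
Theorem nonfork_perp V W (a : V -> M) (b : W -> M) C : sm V -> sm W -> sm C ->
  nonfork a C (range b) -> perp (range a) C (range b).
Proof.
move=> sV sW sC nfa.
have sra : sm (range a) by exact: smallT_range.
have srb : sm (range b) by exact: smallT_range.
have [N0 [CN0 sN0 elN0]] := lowenheim_skolem inaccK countL m0 sC.
have sab : sm (range a `|` range b) by exact: smallT_setU.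
have [s sC' pN] := perp_existence sN0 sC sab.
have [saut sCC] := sC'.
set N := s @` N0 in pN.
have sN : sm N by exact: smallT_image.
have elN : elementary_substructure N by exact: elementary_image.
have CN : C `<=` N by move=> c Cc; exists c; [exact: CN0|exact: sCC].
pose n := fun x : N => set_val x.
have rn : range n = N by exact: range_set_val.
have /nonfork_nondiv ndn : nonfork n C (range a `|` range b) by apply: perp_nonfork => //; rewrite rn.
have nd2 : nondiv (join_assign a n) C (range b).
  apply: (nondiv_left_transitivity inaccK satM homM m0 sV sC srb (nonfork_nondiv nfa)).
  apply: nondiv_mono ndn; first exact: subsetUl.
  by move=> x [bx|[Cx|ax]]; [left; right|right|left; left].
have sVN : sm (V + N) by exact: smallT_sum.
have nf3 := nonfork_sym sVN sW sC (nondiv_nonfork sVN sC srb nd2).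
have nf4 : nonfork b N (range a).
  apply: nonfork_mono nf3 => // x [[v _ <-]|Nx]; left; first by exists (inl v).
  by exists (inr (sub_elt Nx)).
have /nonfork_nondiv nd5 := nonfork_sym sW sV sN nf4.
have pa := nondiv_perp_model sN sV sW elN nd5.
have pNb : perp N C (range b) by apply: (perp_right sN sC sab) pN; apply: subsetUr.
have CNE : C `|` N = N by apply/seteqP; split=> x; [case=> // /CN|right].
have := perp_left_trans sra sN sC srb pNb; rewrite CNE => /(_ pa).
by apply: perp_left => //; exact: smallT_setU.
Qed.

End Symmetric.

End Perp.

Theorem theorem4p2p8 (L : language) (T : set (sentence L)) (K : Type)
    (M : structure L) (perp : set M -> set M -> set M -> Prop)
    (countL : countable_language L)
    (completeT : complete_theory T)
    (infT : only_infinite_models T)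
    (inaccK : strongly_inaccessible K)
    (monsterM : monster K T M)
    (perp_inv : invariant_rel K perp)
    (perp_lmon : left_monotonicity K perp)
    (perp_rmon : right_monotonicity K perp)
    (perp_bmon : right_base_monotonicity K perp)
    (perp_loc : local_character K perp)
    (perp_ext : extension K perp)
    (perp_ind : independence_theorem K perp) :
  [/\ rel_included K perp (@nonforking L M),
      simple M,
      rel_equal K (@nonforking L M) (@nondividing L M) &
      symmetric_rel K (@nonforking L M)]
  /\ (finite_character K perp -> left_normality K perp ->
      left_transitivity K perp ->
      [/\ rel_equal K perp (@nonforking L M),
          rel_equal K perp (@nondividing L M) &
          symmetric_rel K perp]).
Proof.
have [modM _ satM homM] := monsterM.
have [m0 _] : exists m0 : M, True.
  apply: contrapT => nM; apply: (infT M modM).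
  suff -> : [set: M] = set0 by [].
  by apply/seteqP; split=> // x _; apply: nM; exists x.
have [lt io] := initial_order_exists K.
have sE (A : set M) : small K A <-> smallT K A := @smallE K M A.
have rE (A : set M) : range (fun x : A => set_val x) = A := @range_set_val _ M A.
have nfE A C B : small K A -> small K C -> small K B -> @nonforking L M A C B <->
    nonfork (fun x : A => set_val x) C B.
  by move=> /sE sA /sE sC /sE sB; apply: (nonforkingE inaccK satM homM m0).
have ndE A C B : small K A -> small K C -> small K B -> @nondividing L M A C B <->
    nondiv (fun x : A => set_val x) C B.
  by move=> /sE sA /sE sC /sE sB; apply: (nondividingE inaccK satM homM m0).
have pnf : rel_included K perp (@nonforking L M).
  move=> A C B sA sC sB pA; apply/nfE => //.
  apply: (perp_nonfork inaccK countL satM homM m0 io perp_inv perp_rmon perp_bmon perp_loc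
    perp_ext perp_ind); try exact/sE.
  by rewrite rE.
have fd : rel_equal K (@nonforking L M) (@nondividing L M).
  move=> A C B sA sC sB; rewrite nfE // ndE //; split; first exact: nonfork_nondiv.
  by apply: (nondiv_nonfork inaccK countL satM homM m0 io perp_inv perp_rmon perp_bmon perp_loc
    perp_ext perp_ind); exact/sE.
have fsym : symmetric_rel K (@nonforking L M).
  move=> A C B sA sC sB /(nfE _ _ _ sA sC sB); rewrite -{1}(rE B) => h.
  apply/(nfE _ _ _ sB sC sA); rewrite -(rE A).
  by apply: (nonfork_sym inaccK countL satM homM m0 io perp_inv perp_rmon perp_bmon perp_loc
    perp_ext perp_ind) h; exact/sE.
split.
  split=> //; exact: (simple_of_perp inaccK countL satM homM m0 io perp_inv perp_rmon
    perp_bmon perp_loc perp_ext perp_ind).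
move=> fin norm tran.
have pf : rel_equal K perp (@nonforking L M).
  move=> A C B sA sC sB; split; first exact: pnf.
  move=> /(nfE _ _ _ sA sC sB); rewrite -{1}(rE B) => h; rewrite -(rE A) -(rE B).
  by apply: (nonfork_perp inaccK countL satM homM m0 io perp_inv perp_lmon perp_rmon perp_bmon
    perp_loc perp_ext perp_ind fin norm tran) h; exact/sE.
split=> // A C B sA sC sB; first by rewrite pf // fd.
by rewrite pf // pf //; apply: fsym.
Qed.
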